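(* Let $T$ be a triangulation of the $n$-gon and $\operatorname{in}_T(I_{2,n}):=\operatorname{in}_{\mathbf w_T}(I_{2,n})$ for a quadrilateral weight map $w_T$. The quotient $S/\operatorname{in}_T(I_{2,n})$ is isomorphic to the algebra of the semigroup generated by $\{\mathbf g_{ij}:1\le i<j\le n\}\subset\mathbb Z^{2n-3}$. In particular, the central fiber of the toric Gröbner degeneration of $\operatorname{Gr}(2,\mathbb C^n)$ induced by $T$ is isomorphic to that of the degeneration induced by principal coefficients at $T$.
   Context: **Plücker ideal and weights.** The vertices of an $n$-gon are labelled clockwise by the cyclically ordered set $[n]$; ''$i<j<k<l$'' refers to clockwise cyclic order. $S=\mathbb C[p_{ij}:1\le i<j\le n]$, $p_{ji}=-p_{ij}$, $I_{2,n}$ is generated by all $R_{ijkl}=p_{ij}p_{kl}-p_{ik}p_{jl}+p_{il}p_{jk}$, $A_{2,n}=S/I_{2,n}$ is the homogeneous coordinate ring of $\operatorname{Gr}(2,\mathbb C^n)$. $\operatorname{in}_w(f)$ is the sum of terms of $f$ of minimal $w$-weight, $\operatorname{in}_w(I)=\langle\operatorname{in}_w(f):f\in I\rangle$. A triangulation $T$ is a maximal set of pairwise non-crossing arcs, including the $n$ boundary edges. Let $\hat T$ be the triangulation of the $2n$-gon with vertices $1',1,2',2,\dots,n',n$ (clockwise) obtained by gluing to each boundary edge $\overline{i-1,i}$ a triangle with new vertex $i'$. $\hat D_T$ is its planar dual tree: interior vertices are triangles, interior edges $e_{ab}$ correspond to $\overline{ab}\in T$, leaves to boundary edges of the $2n$-gon;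 leaf $i'$ is the edge $\overline{i-1,i'}$, leaf $i$ is the edge $\overline{i',i}$. Along the path from leaf $i$ to leaf $j$ put $\sigma^{ab}_{i\rightsquigarrow j}=+1$ if it passes through $e_{ab}$ turning left at the first endpoint and right at the second, $-1$ if right then left, $0$ otherwise; $\mathbf g_{ij}=\sum_{\overline{ab}\in T}\sigma^{ab}_{i\rightsquigarrow j}f_{ab}$ with $\{f_{ab}\}_{\overline{ab}\in T}$ the standard basis of $\mathbb Z^{2n-3}$. A quadrilateral weight map for $T$ is a linear map $w_T:\mathbb R^{2n-3}\to\mathbb R$ with $w_T(f_{ad}+f_{bc})>w_T(f_{ab}+f_{cd})$ for all $a<b<c<d$ with $\overline{ab},\overline{bc},\overline{cd},\overline{ad},\overline{ac}\in T$; $(\mathbf w_T)_{ij}=w_T(\mathbf g_{ij})$. (The ideal $\operatorname{in}_{\mathbf w_T}(I_{2,n})$ is binomial and prime and does not depend on the choice of $w_T$.) The toric Gröbner degeneration induced by $T$ is the standard flat family over $\mathbb A^1$ with generic fiber $\operatorname{Proj}(A_{2,n})$ and central fiber $\operatorname{Proj}(S/\operatorname{in}_{\mathbf w_T}(I_{2,n}))$. **Principal coefficients.** For an $(m+f)\times m$ integer matrix $\tilde B=(b_{ij})$ with skew-symmetric top $m\times m$ part and a free generating set $x_1,\dots,x_{m+f}$ of $\mathbb C(u_1,\dots,u_{m+f})$, mutation at $k\le m$ replaces $x_k$ by $x_k'$ with $x_kx_k'=\prod_{b_{ik}>0}x_i^{b_{ik}}+\prod_{b_{ik}<0}x_i^{-b_{ik}}$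 and $b_{ij}$ by $-b_{ij}$ if $i=k$ or $j=k$, else by $b_{ij}+\operatorname{sgn}(b_{ik})\max(b_{ik}b_{kj},0)$. The ice quiver $(Q_T,F_T)$ has the elements of $T$ as vertices, boundary edges frozen; in every triangle of $T$ the sides are joined by arrows oriented clockwise, arrows between frozen vertices are dropped. $\tilde B=B_{(Q_T,F_T)}$ has rows indexed by $T$ (mutable arcs first), columns by the $m=n-3$ diagonals of $T$, $b_{ij}=\#(i\to j)-\#(j\to i)$, $f=n$; $A(\tilde B)\cong A_{2,n}$. Let $\hat B$ be the $(m+f)\times(m+f)$ skew-symmetric matrix with left $(m+f)\times m$ block $\tilde B$ and bottom right $f\times f$ block $0$, and $\hat B^{\rm prin}$ the $2(m+f)\times(m+f)$ matrix with top $\hat B$ and bottom the identity, with frozen variables $t_1,\dots,t_{m+f}$ for the last rows. The cluster algebra with principal coefficients and frozen variables $A(\tilde B^{\rm prin})$ is the $\mathbb C[t_1,\dots,t_{m+f}]$-subalgebra of the cluster algebra of $\hat B^{\rm prin}$ generated by all variables of extended clusters obtained from the initial one by iterated mutation in the first $m$ directions. It is graded with all such cluster variables (and $x_{m+1},\dots,x_{m+f}$) in degree $1$ and $t_i$ in degree $0$. The degeneration induced by principal coefficients at $T$ is the resulting family over $\operatorname{Spec}\mathbb C[t_1,\dots,t_{m+f}]$, with fiber $\operatorname{Proj}(A_{2,n})$ over $\mathbf t=\mathbf 1$ and central fiber the fiber over $\mathbf t=0$. *)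

(* Defs.v *)
From HB Require Import structures.
From mathcomp Require Import all_boot all_order all_algebra.
From mathcomp Require Import finmap boolp classical_sets functions.
From mathcomp Require monalg.
From mathcomp Require Import generic_quotient ring_quotient.

Set Implicit Arguments.
Unset Strict Implicit.
Unset Printing Implicit Defensive.

Import Order.TTheory GRing.Theory Num.Theory.
Local Open Scope ring_scope.
Local Open Scope quotient_scope.

Section Ideals.
Variables (K : comNzRingType) (A : comAlgType K).

Definition ideal_gen (E : set A) : set A :=
  [set x | exists2 s : seq (A * A),
     (forall e, e \in s -> E e.2) & x = \sum_(e <- s) e.1 * e.2].

Section Quotient.
Variable E : set A.

Definition in_ideal_gen : {pred A} := fun x => `[< ideal_gen E x >].

Lemma in_ideal_gen_zmod : zmod_closed in_ideal_gen.
Proof.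
split=> [|x y]; first by apply/asboolP; exists [::]; rewrite ?big_nil.
move=> /asboolP[s sE ->] /asboolP[t tE ->]; apply/asboolP.
exists (s ++ [seq (- e.1, e.2) | e <- t]) => [e|].
  by rewrite mem_cat => /orP[/sE//|/mapP[e' /tE ? ->]].
rewrite big_cat big_map /=; congr (_ + _).
by rewrite -sumrN; apply: eq_bigr => e _; rewrite mulNr.
Qed.

HB.instance Definition _ :=
  GRing.isZmodClosed.Build A in_ideal_gen in_ideal_gen_zmod.

Lemma in_ideal_genM a x : x \in in_ideal_gen -> a * x \in in_ideal_gen.
Proof.
move=> /asboolP[s sE ->]; apply/asboolP.
exists [seq (a * e.1, e.2) | e <- s] => [e /mapP[e' /sE ? ->]//|].
by rewrite big_map mulr_sumr; apply: eq_bigr => e _; rewrite mulrA.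
Qed.

Definition quot_alg : Type := Quotient.quot in_ideal_gen.

HB.instance Definition _ := GRing.Zmodule.on quot_alg.

Definition quot_proj : A -> quot_alg := fun x => \pi x.

Lemma quot_projP x y : quot_proj x = quot_proj y <-> x - y \in in_ideal_gen.
Proof. by rewrite Quotient.idealrBE; split=> [/eqP|/eqP]. Qed.

Lemma quot_proj_surj (u : quot_alg) : exists x, u = quot_proj x.
Proof. by exists (repr u); rewrite /quot_proj reprK. Qed.

Lemma quot_projD x y : quot_proj (x + y) = quot_proj x + quot_proj y.
Proof. exact: Quotient.pi_add. Qed.

Definition quot_one : quot_alg := quot_proj 1.
Definition quot_mul (u v : quot_alg) : quot_alg :=
  quot_proj (repr u * repr v).
Definition quot_scale (a : K) (u : quot_alg) : quot_alg :=
  quot_proj (a *: repr u).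

Lemma repr_quot x : repr (quot_proj x) - x \in in_ideal_gen.
Proof. by apply/quot_projP; rewrite /quot_proj reprK. Qed.

Lemma quot_mulE x y : quot_mul (quot_proj x) (quot_proj y) = quot_proj (x * y).
Proof.
apply/quot_projP; set x' := repr _; set y' := repr _.
have -> : x' * y' - x * y = x' * (y' - y) + y * (x' - x).
  by rewrite !mulrBr addrA [y * x']mulrC subrK [y * x]mulrC.
by rewrite rpredD // in_ideal_genM // repr_quot.
Qed.

Lemma quot_scaleE a x : quot_scale a (quot_proj x) = quot_proj (a *: x).
Proof.
apply/quot_projP; rewrite -scalerBr -mulr_algl.
by rewrite in_ideal_genM // repr_quot.
Qed.

Fact quot_mulA : associative quot_mul.
Proof.
move=> u v w; have [x ->] := quot_proj_surj u; have [y ->] := quot_proj_surj v.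
by have [z ->] := quot_proj_surj w; rewrite !quot_mulE mulrA.
Qed.

Fact quot_mulC : commutative quot_mul.
Proof. by move=> u v; rewrite /quot_mul mulrC. Qed.

Fact quot_mul1 : left_id quot_one quot_mul.
Proof.
by move=> u; have [x ->] := quot_proj_surj u; rewrite quot_mulE mul1r.
Qed.

Fact quot_mulDl : left_distributive quot_mul +%R.
Proof.
move=> u v w; have [x ->] := quot_proj_surj u; have [y ->] := quot_proj_surj v.
have [z ->] := quot_proj_surj w.
by rewrite -quot_projD !quot_mulE -quot_projD mulrDl.
Qed.

HB.instance Definition _ := GRing.Zmodule_isComPzRing.Build quot_alg
  quot_mulA quot_mulC quot_mul1 quot_mulDl.

Fact quot_scaleA a b u : quot_scale a (quot_scale b u) = quot_scale (a * b) u.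
Proof. by have [x ->] := quot_proj_surj u; rewrite !quot_scaleE scalerA. Qed.

Fact quot_scale1 : left_id 1 quot_scale.
Proof.
by move=> u; have [x ->] := quot_proj_surj u; rewrite quot_scaleE scale1r.
Qed.

Fact quot_scaleDr : right_distributive quot_scale +%R.
Proof.
move=> a u v; have [x ->] := quot_proj_surj u; have [y ->] := quot_proj_surj v.
by rewrite -quot_projD !quot_scaleE -quot_projD scalerDr.
Qed.

Fact quot_scaleDl u : {morph quot_scale^~ u : a b / a + b}.
Proof.
move=> a b; have [x ->] := quot_proj_surj u.
by rewrite !quot_scaleE -quot_projD scalerDl.
Qed.

HB.instance Definition _ := GRing.Zmodule_isLmodule.Build K quot_alg
  quot_scaleA quot_scale1 quot_scaleDr quot_scaleDl.

End Quotient.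
End Ideals.

Section GeneratedSubalgebra.
Variables (K : comNzRingType) (A : comAlgType K) (E : set A).

Inductive subalg_gen : A -> Prop :=
| subalg_gen_in x : E x -> subalg_gen x
| subalg_gen1 : subalg_gen 1
| subalg_genD x y : subalg_gen x -> subalg_gen y -> subalg_gen (x + y)
| subalg_genM x y : subalg_gen x -> subalg_gen y -> subalg_gen (x * y)
| subalg_genZ a x : subalg_gen x -> subalg_gen (a *: x).

Definition in_subalg_gen : {pred A} := fun x => `[< subalg_gen x >].

Lemma in_subalg_gen_closed : GRing.subalg_closed in_subalg_gen.
Proof.
split=> [|a x y /asboolP ? /asboolP ?|x y /asboolP ? /asboolP ?]; apply/asboolP.
- exact: subalg_gen1.
- by apply: subalg_genD => //; exact: subalg_genZ.
- exact: subalg_genM.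
Qed.

HB.instance Definition _ :=
  GRing.isSubalgClosed.Build K A in_subalg_gen in_subalg_gen_closed.

Record subalg : predArgType :=
  Subalg { subalg_val :> A; _ : subalg_val \in in_subalg_gen }.

HB.instance Definition _ := [isSub for subalg_val].
HB.instance Definition _ := [Choice of subalg by <:].
HB.instance Definition _ := [SubChoice_isSubAlgebra of subalg by <:].
HB.instance Definition _ := [SubNzRing_isSubComNzRing of subalg by <:].

End GeneratedSubalgebra.

(* The semigroup generated by E, with neutral element. *)
Section GeneratedSubmonoid.
Variables (V : nmodType) (E : set V).

Inductive submonoid_gen : V -> Prop :=
| submonoid_gen_in x : E x -> submonoid_gen x
| submonoid_gen0 : submonoid_gen 0
| submonoid_genD x y :
    submonoid_gen x -> submonoid_gen y -> submonoid_gen (x + y).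

Definition in_submonoid_gen : {pred V} := fun x => `[< submonoid_gen x >].

Lemma in_submonoid_gen_closed : GRing.nmod_closed in_submonoid_gen.
Proof.
split=> [|x y /asboolP ? /asboolP ?]; apply/asboolP.
  exact: submonoid_gen0.
exact: submonoid_genD.
Qed.

Record submonoid : predArgType :=
  Submonoid { submonoid_val :> V; _ : submonoid_val \in in_submonoid_gen }.

HB.instance Definition _ := [isSub for submonoid_val].
HB.instance Definition _ := [Choice of submonoid by <:].
HB.instance Definition _ := GRing.SubChoice_isSubNmodule.Build V
  in_submonoid_gen submonoid in_submonoid_gen_closed.

End GeneratedSubmonoid.

(* The multiplication of {malg K[M]} in the library is only available when M
   has no invertible element but its neutral element. *)
Section MonoidAlgebra.
Import monalg.
Local Open Scope fset.
Variables (K : comNzRingType) (M : nmodType).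

Definition monoid_alg : Type := malg M K.

HB.instance Definition _ := GRing.Lmodule.on monoid_alg.

Implicit Types (g : monoid_alg).

Definition mon_one : monoid_alg := << 1 *g (0 : M) >>.

Definition mon_mul g1 g2 : monoid_alg :=
  \sum_(k1 <- msupp g1) \sum_(k2 <- msupp g2)
     << g1@_k1 * g2@_k2 *g (k1 + k2)%R >>.

Lemma mon_mullw (d1 d2 : {fset M}) g1 g2 :
  msupp g1 `<=` d1 -> msupp g2 `<=` d2 ->
  mon_mul g1 g2 = \sum_(k1 <- d1) \sum_(k2 <- d2)
     << g1@_k1 * g2@_k2 *g (k1 + k2)%R >>.
Proof.
move=> le_d1 le_d2; rewrite /mon_mul (big_fset_incl _ le_d1) /=.
  apply/eq_bigr=> k1 _; apply/big_fset_incl => // k _ /mcoeff_outdom ->.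
  by rewrite mulr0 monalgU0.
move=> k _ /mcoeff_outdom g1k.
by rewrite big1 => // k' _; rewrite g1k mul0r monalgU0.
Qed.

Fact mon_mulC : commutative mon_mul.
Proof.
move=> g1 g2; rewrite /mon_mul exchange_big; apply: eq_bigr => k1 _.
by apply: eq_bigr => k2 _; rewrite mulrC addrC.
Qed.

Lemma mon_mulUg c (k : M) g :
  mon_mul << c *g k >> g =
  \sum_(k' <- msupp g) << c * g@_k' *g (k + k')%R >>.
Proof.
rewrite (mon_mullw msuppU_le (fsubset_refl _)) big_seq_fset1.
by apply/eq_bigr => k' _; rewrite mcoeffUU.
Qed.

Lemma mon_mulUU c1 c2 (k1 k2 : M) :
  mon_mul << c1 *g k1 >> << c2 *g k2 >> = << c1 * c2 *g (k1 + k2)%R >>.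
Proof. by rewrite (mon_mullw msuppU_le msuppU_le) !big_seq_fset1 !mcoeffUU. Qed.

Fact mon_mul1 : left_id mon_one mon_mul.
Proof.
move=> g; rewrite mon_mulUg [RHS]monalgE.
by apply/eq_bigr=> k _; rewrite mul1r add0r.
Qed.

Fact mon_mulDl : left_distributive mon_mul +%R.
Proof.
move=> g1 g2 g.
rewrite [in RHS](mon_mullw (fsubsetUl _ (msupp g2)) (fsubset_refl (msupp g))).
rewrite [in RHS](mon_mullw (fsubsetUr (msupp g1) _) (fsubset_refl (msupp g))).
rewrite (mon_mullw (msuppD_le _ _) (fsubset_refl (msupp g))).
rewrite -big_split /=; apply/eq_bigr=> k1 _.
rewrite -big_split /=; apply/eq_bigr=> k2 _.
by rewrite mcoeffD mulrDl monalgUD.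
Qed.

Lemma mon_mulDr : right_distributive mon_mul +%R.
Proof. by move=> g g1 g2; rewrite !(mon_mulC g) mon_mulDl. Qed.

Lemma mon_mul0 : left_zero 0 mon_mul.
Proof. by move=> g; rewrite /mon_mul msupp0 big_seq_fset0. Qed.

Lemma mon_mul0r : right_zero 0 mon_mul.
Proof. by move=> g; rewrite mon_mulC mon_mul0. Qed.

Lemma mon_mul_suml I (r : seq I) (F : I -> monoid_alg) g :
  mon_mul (\sum_(i <- r) F i) g = \sum_(i <- r) mon_mul (F i) g.
Proof. exact: (big_morph (mon_mul^~ g) (fun _ _ => mon_mulDl _ _ _) (mon_mul0 _)). Qed.

Lemma mon_mul_sumr I (r : seq I) (F : I -> monoid_alg) g :
  mon_mul g (\sum_(i <- r) F i) = \sum_(i <- r) mon_mul g (F i).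
Proof. exact: (big_morph (mon_mul g) (fun _ _ => mon_mulDr _ _ _) (mon_mul0r _)). Qed.

Lemma mon_mulEl g1 g2 :
  mon_mul g1 g2 = \sum_(k <- msupp g1) mon_mul << g1@_k *g k >> g2.
Proof. by rewrite [in LHS](monalgE g1) mon_mul_suml. Qed.

Lemma mon_mulEr g1 g2 :
  mon_mul g1 g2 = \sum_(k <- msupp g2) mon_mul g1 << g2@_k *g k >>.
Proof. by rewrite [in LHS](monalgE g2) mon_mul_sumr. Qed.

Fact mon_mulA : associative mon_mul.
Proof.
move=> g1 g2 g3; rewrite (mon_mulEl g1 (mon_mul _ _)) (mon_mulEl g1 g2).
rewrite (mon_mul_suml (msupp g1)); apply: eq_bigr => k1 _.
rewrite (mon_mulEl g2) (mon_mulEr _ g2) (mon_mul_sumr (msupp g2)).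
rewrite (mon_mul_suml (msupp g2)); apply: eq_bigr => k2 _.
rewrite !(mon_mulEr _ g3) (mon_mul_sumr (msupp g3)).
by apply: eq_bigr => k3 _; rewrite !mon_mulUU mulrA addrA.
Qed.

Fact mon_one_neq0 : mon_one != 0.
Proof.
by apply/eqP=> /malgP/(_ 0) /eqP; rewrite mcoeffUU mcoeff0 oner_eq0.
Qed.

HB.instance Definition _ := GRing.Zmodule_isComNzRing.Build monoid_alg
  mon_mulA mon_mulC mon_mul1 mon_mulDl mon_one_neq0.

Lemma mon_scaleE (a : K) g : a *: g = mon_mul << a *g (0 : M) >> g.
Proof.
rewrite mon_mulUg; apply/malgP => k; rewrite mcoeffZ [in LHS](monalgE g).
rewrite !raddf_sum mulr_sumr; apply: eq_bigr => k' _ /=.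
by rewrite add0r !mcoeffU mulrnAr.
Qed.

Fact mon_scaleAl (a : K) g1 g2 : a *: (g1 * g2) = (a *: g1) * g2.
Proof. by rewrite !mon_scaleE; exact: mon_mulA. Qed.

HB.instance Definition _ := GRing.Lmodule_isLalgebra.Build K monoid_alg
  mon_scaleAl.
HB.instance Definition _ := GRing.Lalgebra_isComAlgebra.Build K monoid_alg.

End MonoidAlgebra.

(* Imported only here, because mpoly and monalg declare the same notations. *)
From mathcomp Require Import mpoly.

(* A commutative K-algebra, given by its ring and its scalar multiplication,
   with its homogeneous components.  The ring is not required to satisfy
   1 != 0, unlike an algType, so that any quotient is allowed. *)
Record gradedAlg (K : pzRingType) := GradedAlg {
  galg :> comPzRingType;
  gscale : K -> galg -> galg;
  gcomp : nat -> set galg }.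

Section Proj.
Local Open Scope classical_set_scope.
Variables (K : pzRingType) (A : gradedAlg K).
Implicit Types (a b f g h x y : A).

Definition homogeneous x : Prop := exists d, gcomp d x.

Record proj_prime (p : set A) : Prop := ProjPrime {
  proj_prime0 : p 0;
  proj_primeD : forall x y, p x -> p y -> p (x + y);
  proj_primeMl : forall x y, p y -> p (x * y);
  proj_prime1 : ~ p 1;
  proj_primeM : forall x y, p (x * y) -> p x \/ p y;
  proj_prime_homog : forall x, p x ->
    exists2 s : seq A,
      (forall y, y \in s -> homogeneous y /\ p y) & x = \sum_(y <- s) y;
  proj_prime_relevant : exists d y, [/\ (0 < d)%N, gcomp d y & ~ p y] }.

Definition Proj : Type := {p : set A | proj_prime p}.

Definition zariski_open (U : set Proj) : Prop :=
  exists2 E : set A, (forall x, E x -> homogeneous x) &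
    forall p : Proj, U p <-> exists2 x, E x & ~ sval p x.

(* The element a / f of the homogeneous localization A_(p), as the set of all
   the pairs (b, g) that represent it. *)
Definition hfrac (p : Proj) a f : set (A * A) :=
  [set u | [/\ exists d, gcomp d u.1 /\ gcomp d u.2, ~ sval p u.2 &
    exists h, [/\ homogeneous h, ~ sval p h & h * (a * u.2 - u.1 * f) = 0]]].

(* A section over U has value set0 outside U. *)
Definition psection := Proj -> set (A * A).

Definition structure_sheaf (U : set Proj) : set psection :=
  [set s | (forall p, ~ U p -> s p = set0) /\
    forall p, U p -> exists V : set Proj,
      [/\ zariski_open V, V p, (V `<=` U)%classic &
       exists d a f, [/\ gcomp d a, gcomp d f &
         forall q, V q -> ~ sval q f /\ s q = hfrac q a f]]].

Definition psec_add (s t : psection) : psection := fun p =>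
  [set u | exists v w, [/\ s p v, t p w &
    hfrac p (v.1 * w.2 + w.1 * v.2) (v.2 * w.2) u]].

Definition psec_mul (s t : psection) : psection := fun p =>
  [set u | exists v w, [/\ s p v, t p w & hfrac p (v.1 * w.1) (v.2 * w.2) u]].

Definition psec_scale (c : K) (s : psection) : psection := fun p =>
  [set u | exists2 v, s p v & hfrac p (gscale c v.1) v.2 u].

Definition psec_one (U : set Proj) : psection := fun p =>
  [set u | U p /\ hfrac p 1 1 u].

Definition psec_restr (V : set Proj) (s : psection) : psection := fun p =>
  [set u | V p /\ s p u].

End Proj.

(* Isomorphism of schemes over K: a homeomorphism, with an isomorphism of
   sheaves of K-algebras.  Such an isomorphism is automatically local on the
   stalks. *)
Definition proj_isomorphic (K : pzRingType) (A B : gradedAlg K) : Prop :=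
  exists (phi : Proj A -> Proj B)
         (phis : set (Proj B) -> psection B -> psection A),
  [/\ bijective phi,
      forall V, zariski_open V <-> zariski_open (phi @^-1` V)%classic &
      forall V, zariski_open V ->
      let OV := structure_sheaf V in let U := (phi @^-1` V)%classic in
      [/\ set_bij OV (structure_sheaf U) (phis V),
          forall s t, OV s -> OV t ->
            phis V (psec_add s t) = psec_add (phis V s) (phis V t),
          forall s t, OV s -> OV t ->
            phis V (psec_mul s t) = psec_mul (phis V s) (phis V t),
          (forall c s, OV s ->
            phis V (psec_scale c s) = psec_scale c (phis V s)) /\
          phis V (psec_one V) = psec_one U &
          forall W s, zariski_open W -> (W `<=` V)%classic -> OV s ->
            phis W (psec_restr W s) =
            psec_restr (phi @^-1` W)%classic (phis V s)]].

Section RationalFunctions.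
Variables (K : fieldType) (N : nat).

Definition ratfun : Type := {fraction {mpoly K[N]}}.

HB.instance Definition _ := GRing.Field.on ratfun.

Definition ratfunX (i : 'I_N) : ratfun := tofrac 'X_i.

Definition ratfun_scale (c : K) (x : ratfun) : ratfun := tofrac c%:MP * x.

Fact ratfun_scaleA a b x :
  ratfun_scale a (ratfun_scale b x) = ratfun_scale (a * b) x.
Proof. by rewrite /ratfun_scale mulrA -tofracM -mpolyCM. Qed.

Fact ratfun_scale0 x : ratfun_scale 0 x = 0.
Proof. by rewrite /ratfun_scale mpolyC0 tofrac0 mul0r. Qed.

Fact ratfun_scale1 : left_id 1 ratfun_scale.
Proof. by move=> x; rewrite /ratfun_scale mpolyC1 tofrac1 mul1r. Qed.

Fact ratfun_scaleDr : right_distributive ratfun_scale +%R.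
Proof. by move=> a x y; rewrite /ratfun_scale mulrDr. Qed.

Fact ratfun_scaleDl x : {morph ratfun_scale^~ x : a b / a + b}.
Proof. by move=> a b; rewrite /ratfun_scale mpolyCD tofracD mulrDl. Qed.

HB.instance Definition _ := GRing.Nmodule_isLSemiModule.Build K ratfun
  ratfun_scaleA ratfun_scale0 ratfun_scale1 ratfun_scaleDr ratfun_scaleDl.

Fact ratfun_scaleAl (a : K) (x y : ratfun) : a *: (x * y) = (a *: x) * y.
Proof. exact: mulrA. Qed.

HB.instance Definition _ := GRing.LSemiModule_isLSemiAlgebra.Build K ratfun
  ratfun_scaleAl.

Fact ratfun_scaleAr (a : K) (x y : ratfun) : a *: (x * y) = x * (a *: y).
Proof. by rewrite mulrC ratfun_scaleAl mulrC. Qed.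

HB.instance Definition _ := GRing.LSemiAlgebra_isSemiAlgebra.Build K ratfun
  ratfun_scaleAr.

End RationalFunctions.

Section InitialForms.
Variables (K : fieldType) (R : realDomainType) (N : nat) (w : 'I_N -> R).

Definition mweight (m : 'X_{1..N}) : R := \sum_(i < N) (m i)%:R * w i.

Definition initial_form (f : {mpoly K[N]}) : {mpoly K[N]} :=
  \sum_(m <- msupp f | all (fun m' => mweight m <= mweight m') (msupp f))
    f@_m *: 'X_[m].

Definition initial_forms (I : set {mpoly K[N]}) : set {mpoly K[N]} :=
  [set initial_form f | f in I]%classic.

(* This is S / in_w(I), as in_w(I) is generated by the initial forms. *)
Definition initial_quot (I : set {mpoly K[N]}) :=
  quot_alg (initial_forms I).

Definition initial_graded (I : set {mpoly K[N]}) : gradedAlg K :=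
  @GradedAlg K (initial_quot I : comPzRingType) *:%R
    (fun d => [set quot_proj (initial_forms I) f | f in
                 [set f : {mpoly K[N]} | f \is d.-homog]]%classic).

End InitialForms.

(* Polygons have vertex set 'I_N, labelled clockwise; arcs are sets of two
   vertices. *)
Section Polygon.
Variable N : nat.
Implicit Types (i j k l : 'I_N) (A B X : {set 'I_N}) (T : {set {set 'I_N}}).

Definition cyc3 i j k : bool :=
  [|| (i < j < k)%N, (j < k < i)%N | (k < i < j)%N].

Definition cyc4 i j k l : bool := cyc3 i j k && cyc3 i k l.

Definition crossing A B : bool :=
  [exists i, exists j, exists k, exists l,
     [&& cyc4 i j k l, A == [set i; k] & B == [set j; l]]].

Definition boundary : {set {set 'I_N}} := [set [set i; ordS i] | i : 'I_N].

Definition noncrossing_arcs T : bool :=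
  [forall A in T, #|A| == 2%N] &&
  [forall A in T, forall B in T, ~~ crossing A B].

Definition triangulation T : bool := maxset noncrossing_arcs T.

(* All the vertices lie on the boundary, so three pairwise joined vertices
   always span a triangle of T. *)
Definition triangle T X : bool :=
  (#|X| == 3%N) &&
  [forall A : {set 'I_N}, (A \subset X) && (#|A| == 2%N) ==> (A \in T)].

(* A and B are consecutive sides of the triangle X in clockwise order. *)
Definition next_side X A B : bool :=
  [exists x, exists y, exists z,
     [&& cyc3 x y z, X == [set x; y; z], A == [set x; y] & B == [set y; z]]].

End Polygon.

Section DualTree.
Variables (n : nat) (T : {set {set 'I_n}}).
Implicit Types (i j : 'I_n) (X Y : {set 'I_n.*2}).

(* The vertices 1', 1, 2', 2, ... of the 2n-gon are 0, 1, 2, 3, ... *)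
Fact hat_vertex'_subproof i : (i.*2 < n.*2)%N.
Proof. by rewrite ltn_double. Qed.
Definition hat_vertex' i : 'I_n.*2 := Ordinal (hat_vertex'_subproof i).

Fact hat_vertex_subproof i : (i.*2.+1 < n.*2)%N.
Proof. by rewrite ltn_Sdouble. Qed.
Definition hat_vertex i : 'I_n.*2 := Ordinal (hat_vertex_subproof i).

Definition hat_arc (A : {set 'I_n}) : {set 'I_n.*2} := hat_vertex @: A.

Definition hat_triangulation : {set {set 'I_n.*2}} :=
  (hat_arc @: T :|: boundary n.*2)%SET.

(* The vertices of the dual tree are the boundary edges (leaves) and the
   triangles; the edge that joins X and Y corresponds to the arc X :&: Y. *)
Definition dual_vertex X : bool :=
  (X \in boundary n.*2) || triangle hat_triangulation X.

Definition dual_edge X Y : bool :=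
  [&& dual_vertex X, dual_vertex Y, X != Y & #|X :&: Y| == 2%N].

Definition leaf i : {set 'I_n.*2} := [set hat_vertex' i; hat_vertex i].

Definition dual_path i j (s : seq {set 'I_n.*2}) : bool :=
  [&& path dual_edge (leaf i) s, last (leaf i) s == leaf j & uniq (leaf i :: s)].

(* Turns at X of a path that comes from U and goes on to Y: it turns left when
   the side through which it leaves X follows clockwise the side through which
   it enters X. *)
Definition turn_left (U X Y : {set 'I_n.*2}) : bool :=
  next_side X (U :&: X)%SET (X :&: Y)%SET.
Definition turn_right (U X Y : {set 'I_n.*2}) : bool :=
  next_side X (X :&: Y)%SET (U :&: X)%SET.

Definition passes (turn1 turn2 : {set 'I_n.*2} -> {set 'I_n.*2} ->
    {set 'I_n.*2} -> bool) i j (A : {set 'I_n}) : Prop :=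
  exists s U X Y V, [/\ dual_path i j s, infix [:: U; X; Y; V] (leaf i :: s),
    (X :&: Y)%SET = hat_arc A, turn1 U X Y & turn2 X Y V].

Definition sigma i j (A : {set 'I_n}) : int :=
  if `[< passes turn_left turn_right i j A >] then 1
  else if `[< passes turn_right turn_left i j A >] then -1 else 0.

Definition arc_of : finType := {A : {set 'I_n} | A \in T}.

Definition fvec (R : pzRingType) (A : {set 'I_n}) : {ffun arc_of -> R} :=
  [ffun a : arc_of => (val a == A)%:R].

Definition gvec (R : pzRingType) i j : {ffun arc_of -> R} :=
  \sum_(a : arc_of) fvec R (val a) *~ sigma i j (val a).

Definition gsemigroup : Type :=
  submonoid [set v : {ffun arc_of -> int} |
               exists i j, (i < j)%N /\ v = gvec int i j]%classic.

Definition semigroup_alg (K : comNzRingType) : comAlgType K :=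
  monoid_alg K gsemigroup.

Definition quadrilateral_weight (R : realDomainType)
    (w : {ffun arc_of -> R} -> R) : Prop :=
  forall a b c d : 'I_n, cyc4 a b c d ->
  [&& [set a; b] \in T, [set b; c] \in T, [set c; d] \in T,
      [set a; d] \in T & [set a; c] \in T] ->
  w (fvec R [set a; b] + fvec R [set c; d]) <
  w (fvec R [set a; d] + fvec R [set b; c]).

End DualTree.

Section Pluecker.
Variables (K : fieldType) (n : nat).

Definition pl_index : finType := {ij : 'I_n * 'I_n | (ij.1 < ij.2)%N}.

Definition pl_ring : comAlgType K := {mpoly K[#|pl_index|]}.

Definition pl (i j : 'I_n) : pl_ring :=
  if insub (i, j) is Some a then 'X_(enum_rank (a : pl_index))
  else if insub (j, i) is Some a then - 'X_(enum_rank (a : pl_index))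
  else 0.

Definition pl_ideal : set pl_ring :=
  ideal_gen [set f | exists i j k l, cyc4 i j k l /\
    f = pl i j * pl k l - pl i k * pl j l + pl i l * pl j k]%classic.

Definition pl_weight (T : {set {set 'I_n}}) (R : realDomainType)
    (w : {ffun arc_of T -> R} -> R) (u : 'I_#|pl_index|) : R :=
  w (gvec T R (val (enum_val u)).1 (val (enum_val u)).2).

Definition initial_pl_quot T R w :=
  initial_quot (@pl_weight T R w) pl_ideal.

Definition groebner_central_fiber T R w : gradedAlg K :=
  initial_graded (@pl_weight T R w) pl_ideal.

End Pluecker.

(* Mutation of 2m x m exchange matrices: rows are indexed by V + V, columns by
   the first copy of V. *)
Section Mutation.
Variables (F : fieldType) (V : finType).

Definition mutate_matrix (k : V) (b : V + V -> V -> int) : V + V -> V -> int :=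
  fun i j => if (i == inl k) || (j == k) then - b i j
             else b i j + Num.sg (b i k) * Num.max (b i k * b (inl k) j) 0.

Definition mutate_cluster (k : V) (b : V + V -> V -> int) (x : V + V -> F) :
    V + V -> F :=
  fun i => if i == inl k then
             (\prod_(l | 0 < b l k) x l ^+ `|b l k|%N +
              \prod_(l | b l k < 0) x l ^+ `|b l k|%N) / x (inl k)
           else x i.

Definition seed : Type := ((V + V -> F) * (V + V -> V -> int))%type.

Definition mutate (s : seed) (k : V) : seed :=
  (mutate_cluster k s.2 s.1, mutate_matrix k s.2).

End Mutation.

Section PrincipalCoefficients.
Variables (K : fieldType) (n : nat) (T : {set {set 'I_n}}).

Let V : finType := arc_of T.

Definition frozen (a : V) : bool := val a \in boundary n.

Definition arrows (a b : V) : nat :=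
  if frozen a && frozen b then 0%N
  else #|[set X | triangle T X && next_side X (val a) (val b)]|.

(* The block of frozen rows and frozen columns is 0, since arrows between frozen
   arcs are dropped. *)
Definition exchange_matrix (a b : V) : int := (arrows a b)%:Z - (arrows b a)%:Z.

Definition exchange_matrix_prin (u : V + V) (b : V) : int :=
  match u with
  | inl a => exchange_matrix a b
  | inr a => (a == b)%:R
  end.

Definition prin_field : fieldType := ratfun K #|{: V + V}|.

(* The initial cluster consists of the indeterminates: those of index inl a are
   the x_a, those of index inr a the t_a. *)
Definition prin_seed0 : seed prin_field V :=
  (fun u => ratfunX K (enum_rank u), exchange_matrix_prin).

Definition prin_seeds : set (seed prin_field V) :=
  [set foldl (@mutate _ _) prin_seed0 ks | ks in
     [set ks : seq V | all (fun k => ~~ frozen k) ks]]%classic.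

Definition cluster_vars : set (ratfun K #|{: V + V}|) :=
  [set x | exists2 s, prin_seeds s & exists a, x = s.1 (inl a)]%classic.

Definition coef_vars : set (ratfun K #|{: V + V}|) :=
  [set x | exists a, x = prin_seed0.1 (inr a)]%classic.

(* The K[t]-subalgebra generated by the cluster variables. *)
Definition prin_alg : comAlgType K :=
  subalg (coef_vars `|` cluster_vars)%classic.

(* The K-span of the products of t_i's and exactly d cluster variables. *)
Inductive prin_comp : nat -> set (ratfun K #|{: V + V}|) :=
| prin_comp0 d : prin_comp d 0
| prin_compD d x y : prin_comp d x -> prin_comp d y -> prin_comp d (x + y)
| prin_compZ d (c : K) x : prin_comp d x -> prin_comp d (c *: x)
| prin_comp1 : prin_comp 0 1
| prin_comp_coef d t x : coef_vars t -> prin_comp d x -> prin_comp d (t * x)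
| prin_comp_var d y x :
    cluster_vars y -> prin_comp d x -> prin_comp d.+1 (y * x).

(* The fiber over t = 0 is Proj of the quotient of prin_alg by the ideal
   generated by the t_a. *)
Definition prin_at0 : set prin_alg := [set z | coef_vars (val z)]%classic.

Definition principal_central_fiber : gradedAlg K :=
  @GradedAlg K (quot_alg prin_at0 : comPzRingType) *:%R
    (fun d => [set quot_proj prin_at0 z | z in
                 [set z : prin_alg | prin_comp d (val z)]]%classic).

End PrincipalCoefficients.

(* Main.v *)
From HB Require Import structures.
From mathcomp Require Import finmap boolp classical_sets.
From mathcomp Require Import all_boot all_order all_algebra.
From mathcomp Require monalg.
From mathcomp Require Import mpoly fraction.
From mathcomp Require Import complex reals.
From mathcomp Require Import zify ring lra.
Require Import Defs.

(** Let J_T be the ideal of S generated by binomials read off from the tree dual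
    to T: for vertices i, j, k, l in clockwise order, p_ik p_jl - p_il p_jk when
    no arc of T joins the boundary interval [i, j) to [k, l), and
    p_ik p_jl - p_ij p_kl when no arc of T joins [j, k) to [l, i).  Exactly one of
    the two conditions holds for each quadruple ([sep_or], [sep_excl]): it tells
    which of the two groupings the tree imposes on its four leaves.  All three
    algebras of the theorem are shown to be S / J_T.

    The common tool is [tree_kernel]: a ring morphism on S which kills the
    binomials of J_T and is injective on the span of the noncrossing monomials
    has kernel exactly J_T.  Indeed uncrossing rewrites every polynomial, modulo
    J_T, into noncrossing monomials ([straighten]).  What makes the second
    hypothesis available is [gsum_inj]: distinct noncrossing monomials have
    distinct total g-vectors.  A noncrossing monomial is a multicurve in the
    polygon.  Its number of intersections with an arc of T is a linear function
    of its g-vector; the numbers of intersections of all other arcs follow from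
    these by the tropical Ptolemy relation ([cutsum_ptolemy]); and the
    multiplicity of each arc in the multicurve is a second difference of these
    numbers ([cutsum_recover]).

    Semigroup algebra.  Sending p_ij to the monomial of exponent g_ij kills J_T,
    because g_ik + g_jl = g_il + g_jk holds when no arc joins [i, j) to [k, l)
    ([gvec_additive]): the shear coordinate of each arc has this property.

    Initial ideal.  In the other case, the weight of p_ik p_jl is smaller than
    the weight of p_il p_jk ([tree_additive_lt]), so that the binomials of J_T are
    initial forms of the Pluecker relations.  Conversely, there are plane vectors
    over a field of rational functions whose determinants along the arcs of T are
    independent variables ([det2_exists]).  The determinant of the vectors i and j
    has the monomial x^(g_ij) as its leading part for the weight ([lead_arcs]), so
    the leading part of the equation f = 0, for f in I_(2,n), says that the initial
    form of f vanishes at x^(g_ij), hence belongs to J_T ([initial_ideal]).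

    Principal coefficients.  After division by monomials in t, determinants as
    above give functions x_ij, equal to the initial variables on T, with
      x_ik x_jl = t^alpha x_ij x_kl + t^beta x_il x_jk
    ([xvar_rel]), where one of the two coefficients is 1 and the other is divisible
    by some t_a.  Mutation carries a triangulation to its flip ([seed_lab_mutate]),
    and flips reach every arc ([seed_reach]), so the cluster variables are exactly
    the x_ij ([cluster_varsP]).  At t = 0 the displayed relation becomes a binomial
    of J_T, and the part of x_ij of degree 0 in t is x^(g_ij), whence the kernel of
    p_ij |-> x_ij at t = 0 is J_T ([prin_eval0_ker]).  This identifies the graded
    algebras, and an isomorphism of graded algebras induces one of their Proj
    ([graded_iso_proj]). *)

Set Implicit Arguments.
Unset Strict Implicit.
Unset Printing Implicit Defensive.
Import Order.TTheory GRing.Theory Num.Theory.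

(** * Deciding statements on the order of a few points *)

(** Formulas whose atoms compare two entries of a sequence of numbers. *)
Inductive oform :=
| OLe of nat & nat | OLt of nat & nat | ONot of oform | OAnd of oform & oform
| OOr of oform & oform | OEqb of oform & oform | OTrue | OFalse.

Fixpoint oeval (e : seq nat) f : bool :=
  match f with
  | OLe i j => nth 0 e i <= nth 0 e j
  | OLt i j => nth 0 e i < nth 0 e j
  | ONot f => ~~ oeval e f
  | OAnd f g => oeval e f && oeval e g
  | OOr f g => oeval e f || oeval e g
  | OEqb f g => oeval e f == oeval e g
  | OTrue => true
  | OFalse => false
  end.

(** Evaluation on a prefix of the sequence, which may be undecided: this is what
    lets the search below stop before all the points are placed. *)
Fixpoint oeval3 (e : seq nat) f : option bool :=
  match f with
  | OLe i j => if onth e i is Some a then if onth e j is Some b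
                then Some (a <= b) else None else None
  | OLt i j => if onth e i is Some a then if onth e j is Some b
                then Some (a < b) else None else None
  | ONot f => if oeval3 e f is Some a then Some (~~ a) else None
  | OAnd f g =>
      match oeval3 e f with
      | Some false => Some false
      | Some true => oeval3 e g
      | None => if oeval3 e g is Some false then Some false else None
      end
  | OOr f g =>
      match oeval3 e f with
      | Some true => Some true
      | Some false => oeval3 e g
      | None => if oeval3 e g is Some true then Some true else None
      end
  | OEqb f g => if oeval3 e f is Some a then if oeval3 e g is Some b
                then Some (a == b) else None else None
  | OTrue => Some true
  | OFalse => Some false
  end.

(** The ranks are spread over the odd numbers, so that a further point can be
    placed on, between, below or above those already present. *)
Definition olevel (e : seq nat) x : nat :=
  (count (fun y => y < x) (undup e)).*2.+1.

(** Tries all the relative positions of d further points, up to ties. *)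
Fixpoint ocheck (d : nat) (e : seq nat) f : bool :=
  match oeval3 e f with
  | Some r => r
  | None => if d is d'.+1 then
      all (fun v => ocheck d' (rcons (map (olevel e) e) v) f)
          (iota 0 (size (undup e)).*2.+1)
      else false
  end.

Lemma oeval3_sound e e' f r : oeval3 e f = Some r -> oeval (e ++ e') f = r.
Proof.
have Someb (a b : bool) : Some a = Some b -> a = b by case.
have onthP k c : onth e k = Some c -> nth 0 (e ++ e') k = c.
  move=> h; rewrite nth_cat; case: ltnP => [_|hk]; last first.
    by rewrite onth_default in h.
  exact: onth_nth h.
elim: f r => [i j|i j|f IH|f IHf g IHg|f IHf g IHg|f IHf g IHg| |] r /=.
- case Ei: (onth e i) => [a|//]; case Ej: (onth e j) => [b|//] /Someb <-.
  by rewrite (onthP _ _ Ei) (onthP _ _ Ej).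
- case Ei: (onth e i) => [a|//]; case Ej: (onth e j) => [b|//] /Someb <-.
  by rewrite (onthP _ _ Ei) (onthP _ _ Ej).
- by case Ef: (oeval3 e f) => [a|//] /Someb <-; rewrite (IH _ Ef).
- case Ef: (oeval3 e f) => [[]|].
  + by move=> /IHg ->; rewrite (IHf _ Ef).
  + by move=> /Someb <-; rewrite (IHf _ Ef).
  + by case Eg: (oeval3 e g) => [[]|//] // /Someb <-; rewrite (IHg _ Eg) andbF.
- case Ef: (oeval3 e f) => [[]|].
  + by move=> /Someb <-; rewrite (IHf _ Ef).
  + by move=> /IHg ->; rewrite (IHf _ Ef).
  + by case Eg: (oeval3 e g) => [[]|//] // /Someb <-; rewrite (IHg _ Eg) orbT.
- case Ef: (oeval3 e f) => [a|//]; case Eg: (oeval3 e g) => [b|//] /Someb <-.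
  by rewrite (IHf _ Ef) (IHg _ Eg).
- exact: Someb.
- exact: Someb.
Qed.

(** The truth of a formula only depends on the order type of the points, so it
    suffices to test one sequence of each order type. *)
Definition osame (e c : seq nat) : Prop := size e = size c /\
  forall i j, i < size e -> j < size e ->
    (nth 0 e i <= nth 0 e j) = (nth 0 c i <= nth 0 c j).

Lemma onthSome (e : seq nat) i : i < size e -> onth e i = Some (nth 0 e i).
Proof. by move=> h; rewrite onthE (nth_map 0). Qed.

Lemma oeval3_same e c f : osame e c -> oeval3 e f = oeval3 c f.
Proof.
case=> sz le; elim: f => [i j|i j|f IH|f IHf g IHg|f IHf g IHg|f IHf g IHg| |] //=;
  rewrite ?IH ?IHf ?IHg //.
- have [hi|hi] := ltnP i (size e); last by rewrite !onth_default // -sz.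
  have [hj|hj] := ltnP j (size e); last first.
    rewrite (onth_default hj) (_ : onth c j = None); last by rewrite onth_default -?sz.
    by case: (onth e i); case: (onth c i).
  by rewrite (onthSome hi) (onthSome hj) !(@onthSome c) -?sz // le.
- have [hi|hi] := ltnP i (size e); last by rewrite !onth_default // -sz.
  have [hj|hj] := ltnP j (size e); last first.
    rewrite (onth_default hj) (_ : onth c j = None); last by rewrite onth_default -?sz.
    by case: (onth e i); case: (onth c i).
  by rewrite (onthSome hi) (onthSome hj) !(@onthSome c) -?sz // !ltnNge le.
Qed.

Lemma olevel_lt e x y : x \in e -> x < y -> (olevel e x).+1 < olevel e y.
Proof.
move=> xe xy; rewrite /olevel ltnS -doubleS ltn_Sdouble.
have /(perm_to_rem)/permP h : x \in undup e by rewrite mem_undup.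
rewrite !h /= ltnn xy add0n add1n ltnS.
by apply: sub_count => z /ltn_trans; apply.
Qed.

Lemma olevel_le e x y : x \in e -> y \in e -> (olevel e x <= olevel e y) = (x <= y).
Proof.
move=> xe ye; case: (ltngtP x y) => [xy|yx|->]; last by rewrite leqnn.
  by apply: ltnW; apply: ltnW; exact: olevel_lt.
by apply/negbTE; rewrite -ltnNge; apply: ltnW; exact: olevel_lt.
Qed.

(** Any real position of a new point x is realized by one of the finitely many
    values tried: the level of a point equal to x, or else the value just above
    the highest level below x. *)
Lemma osame_rcons e c x : osame e c ->
  exists2 v, v < (size (undup c)).*2.+1 &
    osame (rcons e x) (rcons (map (olevel c) c) v).
Proof.
case=> sz le.
have lt i j : i < size e -> j < size e ->
    (nth 0 e i < nth 0 e j) = (nth 0 c i < nth 0 c j).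
  by move=> hi hj; rewrite !ltnNge le.
have cin i : i < size e -> nth 0 c i \in c by rewrite sz; apply: mem_nth.
have lvl_lt y : y \in c -> olevel c y < (size (undup c)).*2.
  move=> yc; rewrite /olevel -doubleS leq_double ltn_neqAle count_size andbT.
  by rewrite -all_count; apply/allPn; exists y; rewrite ?mem_undup ?ltnn.
pose v := if x \in e then olevel c (nth 0 c (index x e))
  else \max_(i < size e | nth 0 e i < x) (olevel c (nth 0 c i)).+1.
have vlt i : i < size e -> (nth 0 e i < x) = (olevel c (nth 0 c i) < v).
  move=> hi; rewrite /v; case: ifP => [xe|xe].
    have hx : index x e < size e by rewrite index_mem.
    by rewrite [RHS]ltnNge olevel_le ?cin // -ltnNge -lt // nth_index.
  apply/idP/idP => [hix|].
    exact: (@leq_bigmax_cond _ (fun i : 'I__ => nth 0 e i < x)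
      (fun i => (olevel c (nth 0 c i)).+1) (Ordinal hi)).
  apply: contraTT; rewrite -!leqNgt => hix; apply/bigmax_leqP => j hj.
  apply: ltnW; apply: olevel_lt; first exact: cin.
  by rewrite -lt //; apply: leq_trans hix.
have vle i : i < size e -> (nth 0 e i <= x) = (olevel c (nth 0 c i) <= v).
  move=> hi; rewrite leq_eqVlt vlt // [RHS]leq_eqVlt; congr orb.
  rewrite /v; case: ifP => [xe|xe].
    have hx : index x e < size e by rewrite index_mem.
    rewrite -{1}(nth_index 0 xe) !eqn_leq !le // !olevel_le //; exact: cin.
  rewrite (_ : (_ == x) = false); last first.
    by apply/negbTE; apply: contraFN xe => /eqP <-; rewrite mem_nth.
  apply/esym/negbTE; rewrite neq_ltn; case: (ltnP (nth 0 e i) x) => hix.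
    by move: (hix); rewrite vlt // /v xe => ->.
  apply/orP; right; rewrite ltnS; apply/bigmax_leqP => j hj.
  apply: olevel_lt; first exact: cin.
  by rewrite -lt //; apply: leq_trans hix.
exists v.
  rewrite ltnS /v; case: ifP => [xe|_].
    by apply: ltnW; apply: lvl_lt; apply: cin; rewrite index_mem.
  by apply/bigmax_leqP => i _; apply: lvl_lt; apply: cin.
split; first by rewrite !size_rcons size_map sz.
move=> i j; rewrite size_rcons !ltnS !nth_rcons size_map -sz => hi hj.
case: (ltngtP i (size e)) hi => // hi _; case: (ltngtP j (size e)) hj => // hj _.
- by rewrite !(nth_map 0) -?sz // olevel_le ?cin // le.
- by rewrite (nth_map 0) -?sz // vle.
- by rewrite (nth_map 0) -?sz // leqNgt vlt // -leqNgt.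
- by rewrite !leqnn.
Qed.

Lemma ocheck_sound d e c f : osame e c -> ocheck d c f ->
  forall l, size l = d -> oeval (e ++ l) f.
Proof.
have ocheckE d' c' : ocheck d' c' f = match oeval3 c' f with
  Some r => r | None => if d' is d''.+1 then
      all (fun v => ocheck d'' (rcons (map (olevel c') c') v) f)
          (iota 0 (size (undup c')).*2.+1) else false end by case: d'.
elim: d e c => [|d IH] e c ec; rewrite ocheckE; case Ef: (oeval3 c f) => [r|] //.
- by move=> rT l _; rewrite (@oeval3_sound _ _ _ r) // (oeval3_same _ ec).
- by move=> rT l _; rewrite (@oeval3_sound _ _ _ r) // (oeval3_same _ ec).
move=> /allP h [//|x l] /= [sl].
have [v vlt same] := osame_rcons x ec.
by rewrite -cat_rcons; apply: (IH _ _ same) => //; apply: h; rewrite mem_iota.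
Qed.

Lemma ocheckP e f : ocheck (size e) [::] f -> oeval e f.
Proof. by move=> /(@ocheck_sound _ [::]) h; apply: (h _ e). Qed.

Lemma implyE (b c : bool) : ~~ b || c -> b -> c. Proof. by case: b. Qed.

Ltac omem x l := match l with
  | nil => constr:(false) | x :: _ => constr:(true) | _ :: ?l' => omem x l' end.
Ltac oapp x l := match l with nil => constr:(x :: nil) | ?y :: ?l' => let m := oapp x l' in constr:(y :: m) end.
Ltac oadd x l := match omem x l with true => l | false => oapp x l end.
Ltac oidx x l := match l with
  | x :: _ => constr:(0) | _ :: ?l' => let i := oidx x l' in constr:(S i) end.
Ltac oatoms t l := match t with
  | leq (S ?a) ?b => let l := oadd a l in oadd b l
  | leq ?a ?b => let l := oadd a l in oadd b l
  | negb ?b => oatoms b l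
  | andb ?a ?b => let l := oatoms a l in oatoms b l
  | orb ?a ?b => let l := oatoms a l in oatoms b l
  | addb ?a ?b => let l := oatoms a l in oatoms b l
  | @eq_op _ ?a ?b =>
     match type of a with
     | bool => let l := oatoms a l in oatoms b l
     | nat => let l := oadd a l in oadd b l
     | ordinal _ => let l := oadd (nat_of_ord a) l in oadd (nat_of_ord b) l
     | _ => let l := oadd (nat_of_ord a) l in oadd (nat_of_ord b) l
     end
  | true => l
  | false => l
  end.
Ltac oform t l := match t with
  | leq (S ?a) ?b => let i := oidx a l in let j := oidx b l in constr:(OLt i j)
  | leq ?a ?b => let i := oidx a l in let j := oidx b l in constr:(OLe i j)
  | negb ?b => let f := oform b l in constr:(ONot f)
  | andb ?a ?b => let f := oform a l in let g := oform b l in constr:(OAnd f g)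
  | orb ?a ?b => let f := oform a l in let g := oform b l in constr:(OOr f g)
  | addb ?a ?b => let f := oform a l in let g := oform b l in constr:(ONot (OEqb f g))
  | @eq_op _ ?a ?b =>
     match type of a with
     | bool => let f := oform a l in let g := oform b l in constr:(OEqb f g)
     | nat => let i := oidx a l in let j := oidx b l in constr:(OAnd (OLe i j) (OLe j i))
     | _ => let i := oidx (nat_of_ord a) l in let j := oidx (nat_of_ord b) l in
            constr:(OAnd (OLe i j) (OLe j i))
     end
  | true => constr:(OTrue)
  | false => constr:(OFalse)
  end.

(** Half-open and closed clockwise intervals [i, j), (i, j] and [i, j]; for i =
    j the two half-open ones are empty. *)
Definition in_co (x i j : nat) : bool :=
  [|| (i <= x < j), (j < i <= x) | (x < j < i)].
Definition in_oc (x i j : nat) : bool := [|| i < x <= j, j < i < x | x <= j < i].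
Definition in_cc (x i j : nat) : bool := [|| i <= x <= j, j < i <= x | x <= j < i].

Definition crosses (i j x y : nat) : bool :=
  [|| (i < x < j) && ((y < i) || (j < y)), (i < y < j) && ((x < i) || (j < x)),
    (j < x < i) && ((y < j) || (i < y)) | (j < y < i) && ((x < j) || (i < x))].

(** The side of vertex i with respect to the arc pq turned clockwise by half a
    step. After this turn no vertex lies on the arc, and it meets ij exactly
    when i and j are on different sides. *)
Definition hsep (p q i : nat) : bool := (p < i <= q) || (q < i <= p).

Definition joins (p q x y : nat) : bool := (p == x) && (q == y) || (p == y) && (q == x).

Lemma addbE a b : a (+) b = ~~ (a == b). Proof. by case: a; case: b. Qed.
Lemma eqnE' (a b : nat) : (a == b) = (a <= b) && (b <= a). Proof. exact: eqn_leq. Qed.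
Lemma eqoE n (a b : 'I_n) : (a == b) = (a <= b) && (b <= a). Proof. exact: eqn_leq. Qed.

Ltac ounfold := unfold cyc4, cyc3, crosses, in_co, in_cc, in_oc, hsep, joins in *.
Ltac orevert :=
  repeat match goal with
  | H : ?b = false |- is_true ?g =>
      let l := oatoms b (@nil nat) in
      let H' := fresh in pose proof (negbT H) as H'; clear H; revert H'; apply implyE
  | H : @eq bool ?b ?c |- is_true ?g =>
      let l := oatoms b (@nil nat) in let l := oatoms c l in
      let H' := fresh in pose proof (introT eqP H) as H'; clear H; revert H'; apply implyE
  | H : ~ is_true ?b |- is_true ?g =>
      let l := oatoms b (@nil nat) in
      let H' := fresh in pose proof (introN idP H) as H'; clear H; revert H'; apply implyE
  | H : is_true ?b |- is_true ?g =>
      let l := oatoms b (@nil nat) in revert H; apply implyE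
  end.
Ltac ogoal := match goal with
  | |- is_true _ => idtac
  | |- _ = false => apply/negbTE
  | |- @eq bool _ _ => apply/eqP
  | |- @eq nat _ _ => apply/eqP
  | |- @eq _ _ _ => apply/eqP
  | |- ~ _ => apply/negP
  | |- False => cut (is_true false); [by [] | idtac]
  end.
(** Proves a goal that follows from hypotheses which, like the goal, are boolean
    combinations of comparisons of numbers or ordinals. The search is run by
    reflection. *)
Ltac order_solve :=
  intros; ounfold; ogoal; orevert;
  rewrite ?addbE ?eqoE ?eqnE';
  match goal with |- is_true ?g =>
    let l := oatoms g (@nil nat) in
    let f := oform g l in
    change (is_true (oeval l f)); apply: (@ocheckP l f); exact (erefl true <: is_true (ocheck (size l) [::] f))
  end.

(** * Triangulations of a polygon *)

Lemma ord_neqE n (i j : 'I_n) : (i != j) = (nat_of_ord i != nat_of_ord j)%N.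
Proof. by []. Qed.

Lemma set2_eq (U : finType) (a b c d : U) : [set a; b] = [set c; d] ->
  (a = c /\ b = d) \/ (a = d /\ b = c).
Proof.
move=> e.
have /set2P ha : a \in [set c; d] by rewrite -e set21.
have /set2P hb : b \in [set c; d] by rewrite -e set22.
have /set2P hc : c \in [set a; b] by rewrite e set21.
have /set2P hd : d \in [set a; b] by rewrite e set22.
by intuition (subst; auto).
Qed.

(** Number of clockwise steps from p to q. *)
Definition cdist n (p q : 'I_n) : nat := if (p <= q)%N then (q - p)%N else (q + n - p)%N.

Lemma cdist_lt n (p r u : 'I_n) : cyc3 p r u -> (cdist p r < cdist p u)%N.
Proof.
move=> c; have hp := ltn_ord p; have hr := ltn_ord r; have hu := ltn_ord u.
by move: c; rewrite /cdist /cyc3; case: (leqP p r); case: (leqP p u); lia.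
Qed.

Lemma cdist_ltr n (p r q : 'I_n) : cyc3 p r q -> (cdist r q < cdist p q)%N.
Proof.
move=> c; have hp := ltn_ord p; have hr := ltn_ord r; have hu := ltn_ord q.
by move: c; rewrite /cdist /cyc3; case: (leqP r q); case: (leqP p q); lia.
Qed.

Lemma crossesE n (i j x y : 'I_n) : crosses i j x y = cyc4 i x j y || cyc4 i y j x.
Proof. order_solve. Qed.

Section Arcs.
Variables (n : nat) (T : {set {set 'I_n}}).
Hypothesis T_tri : triangulation T.
Implicit Types p q r s i j k l x y : 'I_n.

Definition is_arc p q : bool := [set p; q] \in T.
(** The arcs of T that join [i, j) to [k, l) are dual to the edges of the tree
    that separate the leaves i, l from the leaves j, k. *)
Definition sep i j k l : bool :=
  [exists x, exists y, [&& is_arc x y, in_co x i j & in_co y k l]].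

Lemma arc_sym p q : is_arc p q = is_arc q p. Proof. by rewrite /is_arc setUC. Qed.

Lemma arc_neq p q : is_arc p q -> p != q.
Proof.
move: T_tri => /maxsetp/andP[/forall_inP h _] /h; rewrite cards2.
by case: (p != q).
Qed.

Lemma arc_cross p q r s : is_arc p r -> is_arc q s -> cyc4 p q r s = false.
Proof.
move: T_tri => /maxsetp/andP[_ /forall_inP h] /h/forall_inP h' /h'.
apply: contraNF => c; apply/existsP; exists p; apply/existsP; exists q.
by apply/existsP; exists r; apply/existsP; exists s; rewrite c !eqxx.
Qed.

(** A triangulation is a maximal noncrossing set, so it contains every arc that
    it does not cross. *)
Lemma arc_max p q : p != q -> (forall r s, is_arc r s -> cyc4 p r q s = false) -> is_arc p q.
Proof.
move=> pq h.
have h1 B : B \in T -> crossing [set p; q] B = false.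
  move=> BT; apply/negbTE/negP=> /'exists_'exists_'exists_existsP[i [j [k [l]]]].
  case/and3P=> c /eqP e1 /eqP e2; rewrite e2 in BT.
  have h1 := h _ _ BT; rewrite setUC in BT; have h2 := h _ _ BT.
  case: (set2_eq e1) => -[e3 e4]; subst; first by rewrite h1 in c.
  order_solve.
have h2 B : B \in T -> crossing B [set p; q] = false.
  move=> BT; apply/negbTE/negP=> /'exists_'exists_'exists_existsP[i [j [k [l]]]].
  case/and3P=> c /eqP e2 /eqP e1; rewrite e2 in BT.
  have h1' := h _ _ BT; rewrite setUC in BT; have h2 := h _ _ BT.
  case: (set2_eq e1) => -[e3 e4]; subst; order_solve.
case/maxsetP: T_tri => /andP[/forall_inP c2 /forall_inP c] /(_ ([set p; q] |: T)).
rewrite /is_arc => <-; rewrite ?setU11 ?subsetUr //.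
apply/andP; split; apply/forall_inP=> A; rewrite !inE => /orP[/eqP->|AT].
- by rewrite cards2 pq.
- exact: c2.
- apply/forall_inP=> B; rewrite !inE => /orP[/eqP->|BT]; last by rewrite h1.
  apply/negP=> /'exists_'exists_'exists_existsP[i [j [k [l]]]].
  case/and3P=> + /eqP e1 /eqP e2.
  by case: (set2_eq e1) => -[? ?]; case: (set2_eq e2) => -[? ?]; subst; order_solve.
- apply/forall_inP=> B; rewrite !inE => /orP[/eqP->|BT]; first by rewrite h2.
  by move: (c _ AT) => /forall_inP; apply.
Qed.

Lemma arc_next p q : p != q -> (forall x, ~~ cyc3 p x q) -> is_arc p q.
Proof. by move=> pq h; apply: arc_max => // r s _; rewrite /cyc4 (negPf (h r)). Qed.

(** The third vertex of the triangle on one side of pq is the farthest r from p,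
    on that side, that is joined to p: an arc crossing rq would have to end at
    p, beyond r. *)
Lemma arc_triangle p q x : is_arc p q -> cyc3 p x q ->
  exists r, [/\ cyc3 p r q, is_arc p r & is_arc r q].
Proof.
move=> pq pxq.
pose p' := ordS p.
have p'E : nat_of_ord p' = if p.+1 == n then 0%N else p.+1.
  rewrite /=; case: eqP => [->|/eqP h]; first by rewrite modnn.
  by rewrite modn_small //; have := ltn_ord p; lia.
have c0 : cyc3 p p' q && is_arc p p'.
  have hx := ltn_ord x; have hq := ltn_ord q; have hp := ltn_ord p.
  apply/andP; split.
    by move: p'E pxq; rewrite /cyc3; case: eqP; lia.
  apply: arc_next => [|y].
    by rewrite ord_neqE; move: p'E pxq; rewrite /cyc3; case: eqP; lia.
  have hy := ltn_ord y.
  by move: p'E pxq; rewrite /cyc3; case: eqP; lia.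
case: (@arg_maxnP _ p' (fun r => cyc3 p r q && is_arc p r) (cdist p) c0).
move=> r /andP[prq pr] rmax; exists r; split=> //.
apply: arc_max => [|u v uv]; first by order_solve.
apply/negbTE/negP => c.
have hc1 := arc_cross pq uv; have hc2 := arc_cross pr uv.
rewrite arc_sym in uv; have hc3 := arc_cross pq uv; have hc4 := arc_cross pr uv.
(* An arc that crosses rq crosses neither pq nor pr, so it comes from p. *)
have vp : v = p by order_solve.
subst v; have puq : cyc3 p u q by order_solve.
have /cdist_lt h : cyc3 p r u by order_solve.
have /= := rmax u; rewrite puq uv => /(_ isT).
by rewrite leqNgt h.
Qed.

Definition ncross i j : nat := #|[set u : 'I_n * 'I_n | is_arc u.1 u.2 & crosses i j u.1 u.2]|.

Lemma ncross_lt i p q j i' j' : is_arc p q -> crosses i j p q ->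
  crosses i' j' p q = false ->
  (forall u v, crosses u v p q = false -> crosses i' j' u v -> crosses i j u v) ->
  (ncross i' j' < ncross i j)%N.
Proof.
move=> pq c1 c2 h; apply/proper_card/properP; split.
  apply/subsetP=> -[u v]; rewrite !inE /= => /andP[uv cuv]; rewrite uv /=.
  apply: h => //; rewrite crossesE; rewrite (arc_cross uv pq).
  by rewrite arc_sym in pq; rewrite (arc_cross uv pq).
by exists (p, q); rewrite !inE /= ?pq ?c1 ?c2.
Qed.

(** Induction on the number of arcs of T crossed by ij: if pq is one of them,
    the four sides of the quadrilateral i p j q cross fewer, for they do not
    cross pq. *)
Lemma arc_ind (P : 'I_n -> 'I_n -> Prop) :
  (forall p q, P p q -> P q p) ->
  (forall p q, is_arc p q -> P p q) ->
  (forall i p j q, cyc4 i p j q -> is_arc p q ->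
     P i p -> P p j -> P j q -> P i q -> P i j) ->
  forall i j, i != j -> P i j.
Proof.
move=> Psym PE Pstep i j; have [m] := ubnP (ncross i j).
elim: m i j => // m IH i j hm ij.
case: (boolP (is_arc i j)) => [/PE//|nE].
have [p [q [pq c]]] : exists p q, is_arc p q /\ cyc4 i p j q.
  apply: contrapT => h; move/negP: nE; apply; apply: arc_max => // r s rs.
  by apply/negbTE/negP => c; apply: h; exists r, s.
have hc : crosses i j p q by rewrite crossesE c.
apply: (Pstep i p j q) => //; (apply: IH; last by order_solve).
all: rewrite ltnS in hm; apply: leq_trans hm; apply: (ncross_lt pq) => // [|u v].
all: order_solve.
Qed.

Lemma sepP i j k l : reflect (exists x y, [/\ is_arc x y, in_co x i j & in_co y k l])
  (sep i j k l).
Proof.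
apply: (iffP 'exists_existsP) => [[x [y /and3P h]]|[x [y /and3P h]]]; by exists x, y.
Qed.

(** An arc from [i, j) to [k, l) crosses any arc from [j, k) to [l, i). *)
Lemma sep_excl i j k l : cyc4 i j k l -> sep i j k l -> sep j k l i = false.
Proof.
move=> c /sepP[x [y [xy xi yk]]]; apply/negbTE/sepP => -[u [v [uv uj vl]]].
by have := arc_cross xy uv; order_solve.
Qed.

(** The arc between the first and the last vertex belongs to the boundary. *)
Lemma arc_root p q : nat_of_ord p = 0%N -> nat_of_ord q = n.-1 -> p != q -> is_arc p q.
Proof.
move=> p0 q1 pq; rewrite arc_sym; apply: arc_next; first by rewrite eq_sym.
by move=> x; have := ltn_ord x; rewrite /cyc3 p0 q1; lia.
Qed.

Definition two_of (a b c d : bool) :=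
  [|| a && b, a && c, a && d, b && c, b && d | c && d].

Definition inside (x y z : nat) : bool := (x < z <= y)%N.

(** Among the arcs xy with x < y such that (x, y] contains at least two of the
    four points, take the shortest. Since neither of the other sides of the
    triangle below it has this property, (x, y] contains exactly two of the
    points, which are thus consecutive, and xy is the arc to be found. *)
Lemma sep_or i j k l : cyc4 i j k l -> sep i j k l || sep j k l i.
Proof.
move=> c.
have n_gt0 : (0 < n)%N by have := ltn_ord i; lia.
have n1 : (n.-1 < n)%N by lia.
pose p0 := Ordinal n_gt0; pose p1 := Ordinal n1.
(* The points are counted in the half-open interval that starts after the first
   end. *)
pose P (u : 'I_n * 'I_n) := [&& is_arc u.1 u.2, (u.1 < u.2)%N &
  two_of (inside u.1 u.2 i) (inside u.1 u.2 j) (inside u.1 u.2 k) (inside u.1 u.2 l)].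
have P0 : P (p0, p1).
  have le0 z : (p0 <= z)%N by [].
  have le1 (z : 'I_n) : (z <= p1)%N by have := ltn_ord z; rewrite /=; lia.
  have lt01 : (p0 < p1)%N.
    by have := ltn_ord i; have := ltn_ord j; move: c; rewrite /cyc4 /cyc3 /=; lia.
  apply/and3P; split=> //=; first by apply: arc_root => //; rewrite ord_neqE ltn_eqF.
  rewrite /inside -!/(nat_of_ord p1) !le1 !andbT -[0%N]/(nat_of_ord p0).
  have := (le0 i, le0 j, le0 k, le0 l); clearbody p0 p1.
  move=> [] [] [] h1 h2 h3 h4; clear -c h1 h2 h3 h4; rewrite /two_of; order_solve.
(* The arc between the first and the last vertex contains at least three of the
   points, so that a shortest arc exists. *)
case: (@arg_minnP _ (p0, p1) P (fun u => u.2 - u.1) P0) => -[x y] /and3P[/= xy ltxy two].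
move=> umin; rewrite /two_of /inside in two.
have [z xzy] : exists z, cyc3 x z y.
  have h : [|| cyc3 x i y, cyc3 x j y, cyc3 x k y | cyc3 x l y].
    clear -c two; order_solve.
  by case/or4P: h => h; eexists; exact: h.
have [r [xry xr ry]] := arc_triangle xy xzy.
have h1 : ~~ P (x, r).
  by apply/negP => /umin /=; clear -ltxy xry; rewrite /cyc3 in xry; lia.
have h2 : ~~ P (r, y).
  by apply/negP => /umin /=; clear -ltxy xry; rewrite /cyc3 in xry; lia.
have lt1 : (x < r)%N by clear -ltxy xry; order_solve.
have lt2 : (r < y)%N by clear -ltxy xry; order_solve.
rewrite /P /= xr lt1 /two_of /inside /= in h1.
rewrite /P /= ry lt2 /two_of /inside /= in h2.
have : [|| in_co x i j && in_co y k l, in_co y i j && in_co x k l,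
           in_co x j k && in_co y l i | in_co y j k && in_co x l i].
  clear -lt1 lt2 h1 h2 two c; order_solve.
case/or4P => /andP[a b]; apply/orP.
- by left; apply/sepP; exists x, y.
- by left; apply/sepP; exists y, x; rewrite arc_sym.
- by right; apply/sepP; exists x, y.
- by right; apply/sepP; exists y, x; rewrite arc_sym.
Qed.
End Arcs.

(** * Paths in the dual tree *)

Lemma ordSE n (i : 'I_n) : nat_of_ord (ordS i) = if i.+1 == n then 0 else i.+1.
Proof.
rewrite /=; case: eqP => [->|/eqP h]; first by rewrite modnn.
by rewrite modn_small //; have := ltn_ord i; lia.
Qed.

Lemma cards3_neq (U : finType) (x y z : U) : x != y -> y != z -> x != z ->
  #|[set x; y; z]| = 3.
Proof.
move=> xy yz xz; rewrite setUC cardsU1 cards2 xy !inE negb_or.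
by rewrite ![z == _]eq_sym xz yz.
Qed.

Section DualPath.
Variables (M : nat) (H : {set {set 'I_M}}).
Implicit Types (p q r a b c d x y z : 'I_M) (X Y Z U V : {set 'I_M}).
Local Notation hE p q := ([set p; q] \in H).
Hypothesis hE_neq : forall p q, hE p q -> p != q.
Hypothesis hE_cross : forall p q r s, hE p r -> hE q s -> cyc4 p q r s = false.
Hypothesis hE_next : forall p, hE p (ordS p).
Hypothesis hE_triangle : forall p q x, hE p q -> cyc3 p x q ->
  exists r, [/\ cyc3 p r q, hE p r & hE r q].

Lemma hE_sym p q : hE p q = hE q p. Proof. by rewrite setUC. Qed.

Definition dvert X := (X \in boundary M) || triangle H X.
Definition dedge X Y := [&& dvert X, dvert Y, X != Y & #|X :&: Y| == 2].

(** X lies on one closed side of the arc pq, namely on the clockwise interval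
    [p, q]. *)
Definition within p q X := [forall x in X, in_cc x p q].

Lemma withinP p q X : reflect (forall x, x \in X -> in_cc x p q) (within p q X).
Proof. exact: forall_inP. Qed.

(** Any two vertices of a triangle, or of a boundary edge, are joined by an arc.
    *)
Lemma dvert_clique X x y : dvert X -> x \in X -> y \in X -> x != y -> hE x y.
Proof.
case/orP => [/imsetP[z _ ->]|/andP[_ /forallP h]] xX yX xy.
  move: xX yX xy; rewrite !inE => /orP[] /eqP -> /orP[] /eqP ->; rewrite ?eqxx //.
  by rewrite hE_sym.
have /implyP -> // := h [set x; y].
by rewrite cards2 xy subUset !sub1set xX yX.
Qed.

Lemma dvert_card X : dvert X -> #|X| = 2 \/ #|X| = 3.
Proof.
case/orP => [/imsetP[z _ ->]|/andP[/eqP]]; last by right.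
by left; rewrite cards2 (hE_neq (hE_next z)).
Qed.

(** Arcs do not cross, so a triangle lies on one side of each arc. *)
Lemma dvert_side p q X : hE p q -> dvert X -> within p q X \/ within q p X.
Proof.
move=> pq dX; have pqn := hE_neq pq; case: (boolP (within p q X)) => [|/forall_inPn[u uX hu]]; first by left.
right; apply/withinP => v vX; apply: contraT => hv.
have uv : hE u v.
  apply: (dvert_clique dX) => //; apply: contraNneq hv => <-; clear -hu pqn; order_solve.
have c := hE_cross pq uv; rewrite hE_sym in uv; have c' := hE_cross pq uv.
by clear -hu hv c c' pqn; order_solve.
Qed.

Lemma dvert_third p q X : dvert X -> #|X| = 3 -> p \in X -> q \in X -> p != q ->
  within p q X -> exists r, [/\ cyc3 p r q, X = [set p; r; q], hE p r & hE r q].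
Proof.
move=> dX X3 pX qX pq /withinP wX.
have : #|X :\: [set p; q]| == 1.
  by rewrite cardsDS ?subUset ?sub1set ?pX ?qX // X3 cards2 pq.
case/cards1P => r rE; have : r \in X :\: [set p; q] by rewrite rE set11.
rewrite !inE negb_or -andbA => /and3P[rp rq rX]; exists r; split.
- by have := wX _ rX; clear -rp rq pq; order_solve.
- apply/eqP; rewrite eq_sym eqEcard X3 !subUset !sub1set pX qX rX /=.
  by rewrite cards3_neq // eq_sym.
- by apply: (dvert_clique dX) => //; rewrite eq_sym.
- by apply: (dvert_clique dX).
Qed.

Lemma third_uniq p q r s : cyc3 p r q -> cyc3 p s q -> hE p r -> hE r q ->
  hE p s -> hE s q -> r = s.
Proof.
move=> pr ps Epr Erq Eps Esq.
have c1 := hE_cross Eps Erq; have c2 := hE_cross Epr Esq.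
by clear -pr ps c1 c2; order_solve.
Qed.

(** There is only one triangle on each side of an arc. *)
Lemma dvert_opposite p q X V : dvert X -> #|X| = 3 -> p \in X -> q \in X -> p != q ->
  within p q X -> dvert V -> p \in V -> q \in V -> V != X -> within q p V.
Proof.
move=> dX X3 pX qX pq wX dV pV qV VX.
have pqE : hE p q by exact: (dvert_clique dX).
have [wV|//] := dvert_side pqE dV.
have [V2|V3] := dvert_card dV.
  have -> : V = [set p; q].
    by apply/eqP; rewrite eq_sym eqEcard V2 subUset !sub1set pV qV cards2 pq.
  apply/withinP => x; rewrite !inE => /orP[]/eqP->; clear -pq; order_solve.
have [r [c1 e1 h1 h2]] := dvert_third dX X3 pX qX pq wX.
have [s [c2 e2 h3 h4]] := dvert_third dV V3 pV qV pq wV.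
by move: VX; rewrite e1 e2 (third_uniq c1 c2 h1 h2 h3 h4) eqxx.
Qed.

(** In the dual tree, a path can only cross the arc pq through the triangle X.
    *)
Lemma path_stays p q X V s : dvert X -> #|X| = 3 -> p \in X -> q \in X -> p != q ->
  within p q X -> path dedge V s -> X \notin V :: s -> dvert V -> within q p V ->
  forall Z, Z \in V :: s -> within q p Z.
Proof.
move=> dX X3 pX qX pq wX; have pqE : hE p q by exact: (dvert_clique dX).
elim: s V => [|V' s IH] V /=; first by move=> _ _ _ wV Z; rewrite inE => /eqP->.
case/andP => /and4P[dV dV' VV' /eqP I2] Vs.
rewrite inE negb_or => /andP[XV Xs] _ wV.
have wV' : within q p V'.
  have [wV'|//] := dvert_side pqE dV'.
  have Ipq : V :&: V' = [set p; q].
    apply/eqP; rewrite eqEcard I2 cards2 pq andbT; apply/subsetP => x.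
    rewrite inE => /andP[/(withinP _ _ _ wV) h1 /(withinP _ _ _ wV') h2].
    by rewrite !inE; clear -h1 h2 pq; order_solve.
  have /setIP[_ pV'] : p \in V :&: V' by rewrite Ipq !inE eqxx.
  have /setIP[_ qV'] : q \in V :&: V' by rewrite Ipq !inE eqxx orbT.
  apply: (dvert_opposite dX) => //.
  by move: Xs; rewrite inE negb_or eq_sym => /andP[].
move=> Z; rewrite inE => /orP[/eqP->//|]; exact: IH.
Qed.

Definition bleaf x : {set 'I_M} := [set x; ordS x].

Lemma bleaf_dvert x : dvert (bleaf x).
Proof. by apply/orP; left; apply: imset_f. Qed.

Lemma within_bleaf p q x : in_co x p q -> within p q (bleaf x).
Proof.
move=> h; apply/withinP => y; rewrite !inE => /orP[]/eqP->.
  by clear -h; order_solve.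
have := ordSE x; have := ltn_ord q; have := ltn_ord p.
by move: h; rewrite /in_co /in_cc; case: eqP; lia.
Qed.

Lemma bleaf_within p q z x : cyc3 p z q -> within q p (bleaf x) -> in_co x q p.
Proof.
move=> c /withinP h; have h1 := h x; rewrite !inE eqxx in h1.
have h2 := h (ordS x); rewrite !inE eqxx orbT in h2.
move: (h1 isT) (h2 isT) => {h h1 h2} h1 h2.
have := ordSE x; have := ltn_ord q; have := ltn_ord p; have := ltn_ord z.
have := ltn_ord x.
by move: h1 h2 c; rewrite /in_co /in_cc /cyc3; case: eqP; lia.
Qed.

Lemma set3_dvert p r q : cyc3 p r q -> hE p r -> hE r q -> hE p q ->
  dvert [set p; r; q] /\ #|[set p; r; q]| = 3.
Proof.
move=> c pr rq pq.
have X3 : #|[set p; r; q]| = 3.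
  by rewrite cards3_neq //; exact: hE_neq.
split=> //; apply/orP; right; rewrite /triangle X3 eqxx /=.
apply/forallP => A; apply/implyP => /andP[sA /cards2P[x [y [xy AE]]]].
move: sA; rewrite {}AE subUset !sub1set !inE => /andP[].
move=> /orP[/orP[]|] /eqP hx /orP[/orP[]|] /eqP hy; subst x y; rewrite ?eqxx // in xy *.
all: by rewrite // hE_sym.
Qed.

(** Follow, from triangle to triangle, the side that has the leaf behind it. The
    interval [p, q] shrinks at each step, and the vertices of the path, which
    stay inside these intervals, are distinct. *)
Lemma path_to_leaf p q X x : hE p q -> in_co x p q ->
  dvert X -> #|X| = 3 -> p \in X -> q \in X -> within q p X ->
  exists V s, [/\ path dedge X (V :: s), last V s = bleaf x, uniq (V :: s),
    X :&: V = [set p; q] & forall Z, Z \in V :: s -> within p q Z].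
Proof.
have [m] := ubnP (cdist p q); elim: m p q X => // m IH p q X hm pq xpq dX X3 pX qX wX.
have pqn := hE_neq pq; have qpn := pqn; rewrite eq_sym in qpn.
have qpE := pq; rewrite hE_sym in qpE.
have edge V : dvert V -> within p q V -> p \in V -> q \in V -> dedge X V /\ X :&: V = [set p; q].
  move=> dV wV pV qV.
  have e : X :&: V = [set p; q].
    apply/eqP; rewrite eqEsubset !subUset !sub1set !inE pX pV qX qV !andbT.
    apply/subsetP => z /setIP[/(withinP _ _ _ wX) h1 /(withinP _ _ _ wV) h2].
    by rewrite !inE; clear -h1 h2 pqn; order_solve.
  split=> //; rewrite /dedge dX dV e cards2 pqn /= andbT.
  apply: contra_eqN X3 => /eqP XV; rewrite -(setIid X) {2}XV e cards2 pqn //.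
case: (pselect (exists z, cyc3 p z q)) => [[z /(hE_triangle pq)[r [prq pr rq]]]|nz].
  pose Y := [set p; r; q].
  have [dY Y3] := set3_dvert prq pr rq pq.
  have pY : p \in Y by rewrite !inE eqxx.
  have rY : r \in Y by rewrite !inE eqxx orbT.
  have qY : q \in Y by rewrite !inE eqxx !orbT.
  have wY : within p q Y.
    apply/withinP => y; rewrite !inE => /orP[/orP[]|]/eqP->; clear -prq; order_solve.
  have [eXY iXY] := edge _ dY wY pY qY.
  have rpE := pr; rewrite hE_sym in rpE; have qrE := rq; rewrite hE_sym in qrE.
  have [h|h] : in_co x p r \/ in_co x r q.
    by apply/orP; clear -prq xpq; order_solve.
  - case: (IH p r Y) => // [||V [s [ps ls us iYV ws]]].
    + by rewrite ltnS in hm; apply: leq_trans hm; apply: cdist_lt.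
    + apply/withinP => y; rewrite !inE => /orP[/orP[]|]/eqP->; clear -prq; order_solve.
    exists Y, (V :: s); split=> //; first by rewrite /= eXY.
      rewrite cons_uniq us andbT; apply/negP => /ws /withinP/(_ q qY).
      by clear -prq; order_solve.
    move=> Z; rewrite inE => /orP[/eqP->//|/ws /withinP wZ].
    by apply/withinP => y /wZ; clear -prq; order_solve.
  - case: (IH r q Y) => // [||V [s [ps ls us iYV ws]]].
    + by rewrite ltnS in hm; apply: leq_trans hm; apply: cdist_ltr.
    + apply/withinP => y; rewrite !inE => /orP[/orP[]|]/eqP->; clear -prq; order_solve.
    exists Y, (V :: s); split=> //; first by rewrite /= eXY.
      rewrite cons_uniq us andbT; apply/negP => /ws /withinP/(_ p pY).
      by clear -prq; order_solve.
    move=> Z; rewrite inE => /orP[/eqP->//|/ws /withinP wZ].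
    by apply/withinP => y /wZ; clear -prq; order_solve.
have {nz} nz z : cyc3 p z q = false by apply/negbTE/negP => h; apply: nz; exists z.
have wL := within_bleaf xpq.
have xp : x = p by move: (nz x) xpq; clear -pqn; order_solve.
have Sq : ordS x = q.
  move: wL => /withinP/(_ (ordS x)); rewrite !inE eqxx orbT => /(_ isT).
  have := nz (ordS x); have := hE_neq (hE_next x); rewrite xp.
  by clear -pqn; order_solve.
have LE : bleaf x = [set p; q] by rewrite /bleaf Sq xp.
have [e i] : dedge X (bleaf x) /\ X :&: bleaf x = [set p; q].
  by apply: edge; rewrite ?bleaf_dvert // LE !inE eqxx ?orbT.
exists (bleaf x), [::]; split => //=; first by rewrite e.
by move=> Z; rewrite inE => /eqP->.
Qed.
End DualPath.

(** * The triangulation of the polygon with 2n vertices *)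

Section HatVertices.
Variable n : nat.
Implicit Types i j k l : 'I_n.
Local Notation hv := (@hat_vertex n).
Local Notation hv' := (@hat_vertex' n).

Lemma hv_inj : injective hv.
Proof. by move=> i j /(congr1 val) /= h; apply: val_inj => /=; lia. Qed.

Lemma hat_arc2 i j : hat_arc [set i; j] = [set hv i; hv j].
Proof. by rewrite /hat_arc imsetU1 imset_set1. Qed.

Lemma hv_ordS i : ordS (hv' i) = hv i.
Proof. by apply: ord_inj; rewrite ordSE /=; case: (_.+1 =P _); have := ltn_ord i; lia. Qed.

Lemma hv'_ordS i : ordS (hv i) = hv' (ordS i).
Proof.
apply: ord_inj; transitivity (ordS i).*2 => //; rewrite !ordSE /=.
by case: (_.+1 =P _); case: (_.+1 =P _); have := ltn_ord i; lia.
Qed.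

Lemma cyc3_ordS (N : nat) (x y : 'I_N) : cyc3 x y (ordS x) = false.
Proof. by have := ltn_ord y; have := ltn_ord x; rewrite /cyc3 ordSE; case: (_.+1 =P _); lia. Qed.

Lemma hv_cyc3 i j k : cyc3 (hv i) (hv j) (hv k) = cyc3 i j k.
Proof. by rewrite /cyc3 /= !ltnS !ltn_double. Qed.

Lemma hv_cyc4 i j k l : cyc4 (hv i) (hv j) (hv k) (hv l) = cyc4 i j k l.
Proof. by rewrite /cyc4 !hv_cyc3. Qed.

Lemma cyc3_between i j : i != j -> (exists k, cyc3 i k j) \/ j = ordS i.
Proof.
move=> ij; case: (eqVneq j (ordS i)) => [->|jS]; [by right|left].
exists (ordS i); move: ij jS; rewrite /cyc3 !ord_neqE !ordSE.
by have := ltn_ord i; have := ltn_ord j; case: (_.+1 =P _); lia.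
Qed.

Lemma ordS_pred_cyc (N : nat) (x y z : 'I_N) : x != y -> z != y -> y = ordS x ->
  z = ordS y -> x != z -> cyc3 x y z.
Proof.
rewrite !ord_neqE => h1 h2 e1 e2; move: h1 h2; rewrite e2 e1.
rewrite /cyc3 !ordSE; have := ltn_ord x; do 2 case: (_.+1 =P _) => ? ; lia.
Qed.

Lemma hv_case (p : 'I_n.*2) : (exists i, p = hv' i) \/ (exists i, p = hv i).
Proof.
have h : p./2 < n by have := ltn_ord p; lia.
case: (boolP (odd p)) => o; [right|left]; exists (Ordinal h); apply: ord_inj => /=.
  by rewrite -[LHS]odd_double_half o.
by rewrite -[LHS]odd_double_half (negPf o).
Qed.

Lemma ordS_surj (N : nat) (x : 'I_N) : exists y, x = ordS y.
Proof. by exists (ord_pred x); rewrite ord_predK. Qed.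

End HatVertices.

Section HatTriangulation.
Variables (n : nat) (T : {set {set 'I_n}}).
Hypothesis T_tri : triangulation T.
Hypothesis n_gt2 : 2 < n.
Implicit Types i j k l : 'I_n.
Local Notation H := (hat_triangulation T).
Local Notation hv := (@hat_vertex n).
Local Notation hv' := (@hat_vertex' n).
Local Notation hE p q := ([set p; q] \in H).

Lemma arc_ordS i : is_arc T i (ordS i).
Proof.
apply: (arc_next T_tri) => [|x].
  by rewrite ord_neqE ordSE; case: (_.+1 =P _); have := ltn_ord i; lia.
by have := ltn_ord x; have := ltn_ord i; rewrite /cyc3 ordSE; case: (_.+1 =P _); lia.
Qed.

Lemma hEP p q : hE p q ->
  (exists i j, [/\ is_arc T i j, p = hv i & q = hv j]) \/ q = ordS p \/ p = ordS q.
Proof.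
rewrite inE => /orP[/imsetP[A AT e]|/imsetP[x _ /set2_eq]]; last first.
  by case=> -[-> ->]; right; [left|right].
left; have /cards2P[i [j [ij AE]]] : #|A| == 2.
  by move: T_tri => /maxsetp/andP[/forall_inP h _]; exact: h.
have Eij : is_arc T i j by rewrite /is_arc -AE.
move: e; rewrite AE hat_arc2 => /set2_eq[] [-> ->]; first by exists i, j.
by exists j, i; rewrite arc_sym.
Qed.

Lemma hE_arc i j : is_arc T i j -> hE (hv i) (hv j).
Proof. by move=> h; rewrite inE -hat_arc2 imset_f. Qed.

Lemma hE_ordS p : hE p (ordS p).
Proof. by rewrite inE; apply/orP; right; apply/imsetP; exists p. Qed.

Lemma hE_neq p q : hE p q -> p != q.
Proof.
case/hEP => [[i [j [/(arc_neq T_tri) ij -> ->]]]|]; first by rewrite (inj_eq (@hv_inj n)).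
have n2 : 2 < n.*2 by lia.
by case=> ->; rewrite ord_neqE ordSE; case: (_.+1 =P _); lia.
Qed.

Lemma hE_cross p q r s : hE p r -> hE q s -> cyc4 p q r s = false.
Proof.
case/hEP => [[i [j [ij -> ->]]]|[->|->]].
- case/hEP => [[k [l [kl -> ->]]]|[->|->]].
  + by rewrite hv_cyc4; exact: arc_cross ij kl.
  + have h := cyc3_ordS q (hv i); have h' := cyc3_ordS q (hv j).
    by move: (ordS q) h h' => s'; order_solve.
  + have h := cyc3_ordS s (hv i); have h' := cyc3_ordS s (hv j).
    by move: (ordS s) h h' => s'; order_solve.
- by rewrite /cyc4 cyc3_ordS.
- move=> _; have h := cyc3_ordS r s.
  by move: (ordS r) h => s'; order_solve.
Qed.

(** A triangle of the large polygon is a triangle of T, or has one of the new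
    vertices between i - 1 and i as its tip. *)
Lemma hE_triangle p q x : hE p q -> cyc3 p x q ->
  exists r, [/\ cyc3 p r q, hE p r & hE r q].
Proof.
move=> pq; have pqn := hE_neq pq; case/hEP: (pq) => [[i [j [ij pE qE]]]|[->|pE]].
- case: (cyc3_between (arc_neq T_tri ij)) => [[k /(arc_triangle T_tri ij)[r [c h1 h2]]] _|jE _].
    by exists (hv r); rewrite pE qE hv_cyc3 c !hE_arc.
  have qE' : q = ordS (ordS p) by rewrite pE hv'_ordS hv_ordS -jE.
  have h1 : hE p (ordS p) := hE_ordS p.
  have h2 : hE (ordS p) q by rewrite qE' hE_ordS.
  exists (ordS p); split=> //.
  by apply: ordS_pred_cyc => //; [exact: hE_neq|rewrite eq_sym; exact: hE_neq].
- by rewrite cyc3_ordS.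
- case: (hv_case q) => -[k qE] _.
  + have [k' kE] := ordS_surj k; exists (hv k').
    have qS : q = ordS (hv k') by rewrite qE kE hv'_ordS.
    have pS : p = hv k by rewrite pE qE hv_ordS.
    have h1 : hE p (hv k') by rewrite pS hE_arc // kE arc_sym arc_ordS.
    have h2 : hE (hv k') q by rewrite qS hE_ordS.
    split=> //; suff : cyc3 (hv k') q p by order_solve.
    apply: ordS_pred_cyc => //; last by rewrite eq_sym hE_neq.
    by rewrite hE_neq.
  + have pS : p = hv' (ordS k) by rewrite pE qE hv'_ordS.
    exists (ordS p); have h1 : hE p (ordS p) := hE_ordS p.
    have h2 : hE (ordS p) q by rewrite pS hv_ordS qE hE_arc // arc_sym arc_ordS.
    split=> //; suff : cyc3 q p (ordS p) by order_solve.
    apply: ordS_pred_cyc => //; by rewrite eq_sym ?hE_neq.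
Qed.
End HatTriangulation.

(** * The turns of a path and the position of its leaves *)

Section SigmaFormula.
Variables (n : nat) (T : {set {set 'I_n}}).
Hypothesis T_tri : triangulation T.
Hypothesis n_gt2 : 2 < n.
Implicit Types i j k l : 'I_n.
Implicit Types a b c d x y z : 'I_n.*2.
Implicit Types U V X Y Z : {set 'I_n.*2}.
Local Notation H := (hat_triangulation T).
Local Notation hv := (@hat_vertex n).
Local Notation hv' := (@hat_vertex' n).
Local Notation hE p q := ([set p; q] \in H).

Let Hn := hE_neq T_tri n_gt2.
Let Hc := hE_cross T_tri n_gt2.
Let Hs := @hE_ordS n T.
Let Ht := hE_triangle T_tri n_gt2.

Lemma leafE i : leaf i = bleaf (hv' i).
Proof. by rewrite /leaf /bleaf hv_ordS. Qed.

Lemma dual_edge_sym : ssrbool.symmetric (dual_edge T).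
Proof. by move=> X Y; rewrite /dual_edge setIC eq_sym andbCA. Qed.

(** The path could only come back through X, which it avoids. *)
Lemma leaf_behind a b c X V s i : cyc3 b c a -> dual_vertex T X -> #|X| = 3 ->
  a \in X -> b \in X -> within b a X -> dual_edge T X V -> X :&: V = [set a; b] ->
  path (dual_edge T) V s -> X \notin V :: s -> last V s = leaf i ->
  in_co (hv' i) a b.
Proof.
move=> cbca dX X3 aX bX wX /and4P[_ dV XV _] iXV Vs Xs ls.
have ba : b != a by order_solve.
have /setIP[_ bV] : b \in X :&: V by rewrite iXV !inE eqxx orbT.
have /setIP[_ aV] : a \in X :&: V by rewrite iXV !inE eqxx.
have wV : within a b V.
  by apply: (dvert_opposite Hn Hc Hs dX X3 bX aX ba wX); rewrite // eq_sym.
have wL : within a b (leaf i).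
  rewrite -ls; apply: (path_stays Hn Hc Hs dX X3 bX aX ba wX Vs Xs dV wV).
  exact: mem_last.
by rewrite leafE in wL; apply: (bleaf_within cbca wL).
Qed.

(** The two ends of a path that visits U, X, Y, V avoid X and Y respectively,
    since a path has no repeated vertex. *)
Lemma dual_path_split i j s U X Y V : dual_path T i j s ->
  infix [:: U; X; Y; V] (leaf i :: s) ->
  [/\ dual_edge T X Y, dual_edge T X U, dual_edge T Y V,
    exists r, [/\ path (dual_edge T) U r, X \notin U :: r & last U r = leaf i] &
    exists r, [/\ path (dual_edge T) V r, Y \notin V :: r & last V r = leaf j]].
Proof.
move=> /and3P[ps /eqP ls us] /infixP[s1 [s2 e]].
have /and5P[_ XU XY YV Vs2] : [&& sorted (dual_edge T) (rcons s1 U), dual_edge T U X,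
    dual_edge T X Y, dual_edge T Y V & path (dual_edge T) V s2].
  have : sorted (dual_edge T) (leaf i :: s) by [].
  rewrite e; case: (s1) => [|f s1'] /=; first by move/and4P=> [-> -> -> ->].
  by rewrite cat_path rcons_path /= => /and5P[-> -> -> -> ->].
have us' : uniq (s1 ++ [:: U, X, Y, V & s2]) by rewrite -e.
split=> //; first by rewrite dual_edge_sym.
- exists (rev s1); split.
  + have : sorted (dual_edge T) (leaf i :: s) by [].
    rewrite e -cat_rcons => /= so.
    have : sorted (dual_edge T) (rcons s1 U).
      move: so; case: (s1) => [//|f s1' /=]; by rewrite cat_path => /andP[].
    by rewrite -rev_sorted rev_rcons /=;
      apply: sub_path => x y /=; rewrite dual_edge_sym.
  + move: us'; rewrite cat_uniq /= !inE !negb_or mem_rev => /and5P[_ /and5P[_ h _ _ _]].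
    by rewrite eq_sym => /andP[-> _] _ _; rewrite h.
  + have : last U (rev s1) = head U (rcons s1 U).
      by case: (s1) => [//|f s1'] /=; rewrite rev_cons last_rcons.
    move=> ->; have : head U (leaf i :: s) = leaf i by [].
    by rewrite e -cat_rcons; case: (s1).
- exists s2; split=> //.
    move: us'; rewrite cat_uniq /= => /and3P[_ _]; rewrite !inE !negb_or.
    by move=> /and4P[_ _ /andP[-> ->]].
  by rewrite -ls -[last (leaf i) s]/(last (leaf i) (leaf i :: s)) e last_cat.
Qed.

(** Paths to the two leaves, glued along the edge XY, form a path without
    repetition since they lie behind disjoint intervals. *)
Lemma dual_path_exists X Y p q r s i j : dual_edge T X Y -> #|X| = 3 -> #|Y| = 3 ->
  hE p q -> hE r s -> cyc4 p q r s ->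
  p \in X -> q \in X -> within q p X -> r \in Y -> s \in Y -> within s r Y ->
  in_co (hv' i) p q -> in_co (hv' j) r s ->
  exists t U V, [/\ dual_path T i j t, infix [:: U; X; Y; V] (leaf i :: t),
    U :&: X = [set p; q] & Y :&: V = [set r; s]].
Proof.
move=> /and4P[dX dY XnY XYi] X3 Y3 pq rs c4 pX qX wX rY sY wY li lj.
have [U [u [pu lu uu iU wU]]] := path_to_leaf Hn Hs Ht pq li dX X3 pX qX wX.
have [V [v [pv lv uv iV wV]]] := path_to_leaf Hn Hs Ht rs lj dY Y3 rY sY wY.
have ne Z : dvert H Z -> exists z, z \in Z.
  move=> dZ; apply/set0Pn; rewrite -card_gt0.
  by case: (dvert_card Hn Hs dZ) => ->.
have Xv : X \notin V :: v.
  apply/negP => /wV /withinP/(_ _ pX); clear -c4; order_solve.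
have Yu : Y \notin U :: u.
  apply/negP => /wU /withinP/(_ _ rY); clear -c4; order_solve.
have out p' q' Z : p' != q' -> #|Z| = 3 -> within q' p' Z -> ~ within p' q' Z.
  move=> h Z3 /withinP w1 /withinP w2; have : #|Z| <= #|[set p'; q']|.
    apply: subset_leq_card; apply/subsetP => z zZ; have := w1 z zZ; have := w2 z zZ.
    by rewrite !inE; clear -h; order_solve.
  by rewrite Z3 cards2; case: (_ == _).
have Xu : X \notin U :: u by apply/negP => /wU; apply: out wX => //; exact: Hn.
have Yv : Y \notin V :: v by apply/negP => /wV; apply: out wY => //; exact: Hn.
have uvd : ~~ has (mem (U :: u)) (V :: v).
  apply/hasPn => Z Zv; apply/negP => Zu.
  have dZ : dvert H Z.
    move: pv Zv => /= /andP[/and4P[_ dV _ _] +].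
    rewrite inE => + /orP[/eqP->//|]; elim: (v) (V) => [//|V' v' IH] V0 /=.
    by move=> /andP[/and4P[_ dV' _ _] /IH h]; rewrite inE => /orP[/eqP->|].
  have [z zZ] := ne _ dZ.
  have := withinP _ _ _ (wU _ Zu) _ zZ; have := withinP _ _ _ (wV _ Zv) _ zZ.
  by clear -c4; order_solve.
pose full := rev u ++ [:: U, X, Y, V & v].
have fullE : full = leaf i :: behead full.
  have : head U full = leaf i.
    rewrite leafE -lu /full; case/lastP: (u) => [//|u' z].
    by rewrite rev_rcons last_rcons.
  by rewrite /full; case: (rev u) => [|f u'] /= ->.
exists (behead full), U, V; rewrite -fullE; split=> //; last 1 first.
- by rewrite setIC.
- rewrite /dual_path; rewrite -fullE; apply/and3P; split.
  + suff : sorted (dual_edge T) full by rewrite fullE.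
    have : sorted (dual_edge T) (rev (X :: U :: u)).
      rewrite rev_sorted; apply: (@sub_sorted _ (dual_edge T)) => [x y|//].
      by rewrite dual_edge_sym.
    rewrite /full !rev_cons -!cats1 -!catA /= => so.
    have XYe : dual_edge T X Y by apply/and4P; split.
    have /andP[YV pv'] : dual_edge T Y V && path (dual_edge T) V v by [].
    case E: (rev u) so => [|f u'] /=; first by move=> /andP[-> _]; rewrite XYe YV pv'.
    by rewrite !cat_path /= => /and4P[-> -> -> _]; rewrite XYe YV pv'.
  + suff : last U full = leaf j by rewrite fullE => /= ->.
    by rewrite /full last_cat /= lv leafE.
  + rewrite /full -cat_rcons -rev_cons cat_uniq rev_uniq uu /=.
    rewrite !mem_rev (negPf Xu) (negPf Yu) /= !inE (negPf XnY) /=.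
    rewrite inE in Xv; rewrite inE in Yv; rewrite (negPf Xv) (negPf Yv) /=.
    move: uv => /= ->; rewrite andbT.
    apply: contra uvd => h; apply/hasP; move: h => /orP[h|/hasP[z zv zu]].
      by exists V; rewrite ?mem_head // -mem_rev.
    by exists z; [rewrite inE zv orbT|rewrite /= -mem_rev].
- by apply/infixP; exists (rev u), v.
Qed.

Lemma next_side_left (N : nat) (p q r : 'I_N) (S : {set 'I_N}) : cyc3 p q r ->
  next_side [set p; q; r] S [set q; r] = (S == [set p; q]).
Proof.
move=> c; apply/idP/eqP => [/'exists_'exists_existsP[x [y [z]]]|->]; last first.
  by apply/'exists_'exists_existsP; exists p, q, r; rewrite c !eqxx.
move=> /and4P[c' /eqP e /eqP-> /eqP/set2_eq h].
have : x \in [set p; q; r] by rewrite e !inE eqxx.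
rewrite !inE => /orP[/orP[]|] /eqP xE; case: h => -[? ?]; subst; first by [].
all: by exfalso; clear -c c'; order_solve.
Qed.

Lemma next_side_right (N : nat) (p q r : 'I_N) (S : {set 'I_N}) : cyc3 p q r ->
  next_side [set p; q; r] [set q; r] S = (S == [set r; p]).
Proof.
move=> c; apply/idP/eqP => [/'exists_'exists_existsP[x [y [z]]]|->]; last first.
  apply/'exists_'exists_existsP; exists q, r, p; rewrite !eqxx !andbT.
  apply/andP; split; first by clear -c; order_solve.
  by rewrite -setUA setUC.
move=> /and4P[c' /eqP e /eqP/set2_eq h /eqP->].
have : z \in [set p; q; r] by rewrite e !inE eqxx !orbT.
rewrite !inE => /orP[/orP[]|] /eqP xE; case: h => -[? ?]; subst; first by [].
all: by exfalso; clear -c c'; order_solve.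
Qed.

Variables (a b c d : 'I_n.*2) (A : {set 'I_n}).
Hypothesis quad : cyc4 a b c d.
Hypothesis AE : hat_arc A = [set b; d].
Hypotheses (ab : hE a b) (bc : hE b c) (cd : hE c d) (da : hE d a) (bd : hE b d).

Let Xa := [set a; b; d].
Let Xc := [set c; d; b].

Let dXa : dual_vertex T Xa /\ #|Xa| = 3.
Proof.
apply: (set3_dvert Hn) => //; last by rewrite setUC.
by clear -quad; order_solve.
Qed.
Let dXc : dual_vertex T Xc /\ #|Xc| = 3.
Proof.
apply: (set3_dvert Hn) => //; rewrite 1?[[set _; b]]setUC //.
by clear -quad; order_solve.
Qed.

Let third X : dual_vertex T X -> b \in X -> d \in X -> X = Xa \/ X = Xc.
Proof.
move=> dX bX dX'; have bdn := Hn bd.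
have X3 : #|X| = 3.
  have [X2|//] := dvert_card Hn Hs dX.
  have XE : [set b; d] = X.
    by apply/eqP; rewrite eqEcard X2 subUset !sub1set bX dX' cards2 bdn.
  case/orP: dX => [/imsetP[x _]|/andP[/eqP]]; last by rewrite X2.
  rewrite -XE => /set2_eq[] [? ?]; subst.
    by have := cyc3_ordS x c; clear -quad; move: (ordS x) quad; order_solve.
  by have := cyc3_ordS x a; clear -quad; move: (ordS x) quad; order_solve.
have bd' := bd; rewrite setUC in bd'.
case: (dvert_side Hn Hc Hs bd dX) => [w|w].
  have [r [h -> h1 h2]] := dvert_third Hs dX X3 bX dX' bdn w; right.
  rewrite (third_uniq Hc h _ h1 h2 bc cd) /Xc; last by clear -quad; order_solve.
  by apply/setP => x; rewrite !inE; do 3 case: eqP.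
rewrite eq_sym in bdn.
have [r [h -> h1 h2]] := dvert_third Hs dX X3 dX' bX bdn w; left.
rewrite (third_uniq Hc h _ h1 h2 da ab) /Xa; last by clear -quad; order_solve.
by apply/setP => x; rewrite !inE; do 3 case: eqP.
Qed.

Let iac : Xa :&: Xc = [set b; d].
Proof.
  apply/setP => x; rewrite !inE; clear -quad.
  case: (x =P b) => [->|_]; rewrite ?orbT ?eqxx // orbF.
  case: (x =P d) => [->|_]; rewrite ?orbT ?orbF ?eqxx // .
  case: (x =P a) => [->|//]; rewrite andTb; apply/negbTE; order_solve.
Qed.

(** Only the triangles Xa and Xc contain bd, so that the path crosses the edge
    dual to bd from Xa to Xc or from Xc to Xa. *)
Lemma passesP (t1 t2 : {set 'I_n.*2} -> {set 'I_n.*2} -> {set 'I_n.*2} -> bool) i j :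
  passes T t1 t2 i j A <-> exists s U V,
   [/\ dual_path T i j s, infix [:: U; Xa; Xc; V] (leaf i :: s), t1 U Xa Xc & t2 Xa Xc V] \/
   [/\ dual_path T i j s, infix [:: U; Xc; Xa; V] (leaf i :: s), t1 U Xc Xa & t2 Xc Xa V].
Proof.
split=> [[s [U [X [Y [V [ds is0 e h1 h2]]]]]]|[s [U [V [[ds is0 h1 h2]|[ds is0 h1 h2]]]]]].
- have [/and4P[dX dY XnY _] _ _ _ _] := dual_path_split ds is0.
  rewrite AE in e.
  have /setIP[bX bY] : b \in X :&: Y by rewrite e !inE eqxx.
  have /setIP[dX' dY'] : d \in X :&: Y by rewrite e !inE eqxx orbT.
  exists s, U, V.
  case: (third dX bX dX') (third dY bY dY') => [?|?] [?|?]; subst X Y.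
  + by rewrite eqxx in XnY.
  + by left.
  + by right.
  + by rewrite eqxx in XnY.
- by exists s, U, Xa, Xc, V; rewrite AE.
- by exists s, U, Xc, Xa, V; rewrite AE setIC.
Qed.

Let Tl : forall U V, (turn_left U Xa Xc = (U :&: Xa == [set a; b])) *
  (turn_right Xa Xc V = (Xc :&: V == [set c; d])) *
  (turn_left U Xc Xa = (U :&: Xc == [set c; d])) *
  (turn_right Xc Xa V = (Xa :&: V == [set a; b])).
Proof.
move=> U V; rewrite /turn_left /turn_right [Xc :&: Xa]setIC iac.
rewrite !next_side_left; [|by clear -quad; order_solve..].
by rewrite [[set b; d]]setUC !next_side_left //; clear -quad; order_solve.
Qed.

Let Tr : forall U V, (turn_right U Xa Xc = (U :&: Xa == [set d; a])) *
  (turn_left Xa Xc V = (Xc :&: V == [set b; c])) *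
  (turn_right U Xc Xa = (U :&: Xc == [set b; c])) *
  (turn_left Xc Xa V = (Xa :&: V == [set d; a])).
Proof.
move=> U V; rewrite /turn_left /turn_right [Xc :&: Xa]setIC iac.
rewrite !next_side_right; [|by clear -quad; order_solve..].
by rewrite [[set b; d]]setUC !next_side_right //; clear -quad; order_solve.
Qed.

Let eac : dual_edge T Xa Xc.
Proof.
rewrite /dual_edge dXa.1 dXc.1 iac cards2 (Hn bd) andbT /=.
apply/eqP => /setP/(_ a); rewrite !inE eqxx /=; clear -quad; order_solve.
Qed.

Let wi (p q r : 'I_n.*2) : cyc3 p q r -> (within p r [set p; q; r] * within q p [set p; q; r] *
  within r q [set p; q; r])%type.
Proof.
by move=> h; split; [split|]; apply/withinP => x; rewrite !inE => /orP[/orP[]|] /eqP ->;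
  clear -h; order_solve.
Qed.

(** Turning left then right at the diagonal bd means entering and leaving the
    quadrilateral through the opposite sides ab and cd, in some order, and
    turning right then left through da and bc. Paths through these sides exist
    exactly when one leaf is behind each of them. *)
Lemma passes_opp (t1 t2 : {set 'I_n.*2} -> {set 'I_n.*2} -> {set 'I_n.*2} -> bool)
    (p q r s : 'I_n.*2) i j :
  cyc4 p q r s -> hE p q -> hE r s ->
  (forall U V, (t1 U Xa Xc = (U :&: Xa == [set p; q])) *
     (t2 Xa Xc V = (Xc :&: V == [set r; s])) *
     (t1 U Xc Xa = (U :&: Xc == [set r; s])) *
     (t2 Xc Xa V = (Xa :&: V == [set p; q])))%type ->
  (p == a) && (q == b) && (r == c) && (s == d) \/
  (p == d) && (q == a) && (r == b) && (s == c) ->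
  passes T t1 t2 i j A <->
  in_co (hv' i) p q && in_co (hv' j) r s || in_co (hv' i) r s && in_co (hv' j) p q.
Proof.
move=> c4 pq rs t pE.
have [Xap [Xaq [Xcr [Xcs [wa wc]]]]] :
    p \in Xa /\ q \in Xa /\ r \in Xc /\ s \in Xc /\ within q p Xa /\ within s r Xc.
  have c1 : cyc3 a b d by clear -quad; order_solve.
  have c2 : cyc3 c d b by clear -quad; order_solve.
  by case: pE => /andP[/andP[/andP[/eqP-> /eqP->] /eqP->] /eqP->];
    rewrite !inE !eqxx ?orbT ?(wi c1) ?(wi c2).
have [xa [xc [h1 h2]]] : exists xa xc, cyc3 q xa p /\ cyc3 s xc r.
  by case: pE => /andP[/andP[/andP[/eqP-> /eqP->] /eqP->] /eqP->];
    [exists d, b|exists b, d]; clear -quad; split; order_solve.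
have eca : dual_edge T Xc Xa by rewrite dual_edge_sym.
rewrite passesP; split.
- case=> [s' [U [V [[ds is0]|[ds is0]]]]]; rewrite !(t U V) => /eqP e1 /eqP e2; rewrite setIC in e1.
  + have [_ e3 e4 [r1 [p1 n1 l1]] [r2 [p2 n2 l2]]] := dual_path_split ds is0.
    rewrite (leaf_behind h1 dXa.1 dXa.2 Xap Xaq wa e3 e1 p1 n1 l1).
    by rewrite (leaf_behind h2 dXc.1 dXc.2 Xcr Xcs wc e4 e2 p2 n2 l2).
  + have [_ e3 e4 [r1 [p1 n1 l1]] [r2 [p2 n2 l2]]] := dual_path_split ds is0.
    rewrite (leaf_behind h2 dXc.1 dXc.2 Xcr Xcs wc e3 e1 p1 n1 l1).
    by rewrite (leaf_behind h1 dXa.1 dXa.2 Xap Xaq wa e4 e2 p2 n2 l2) orbT.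
- case/orP => /andP[l1 l2].
  + have [s' [U [V [ds is0 e1 e2]]]] := dual_path_exists eac dXa.2 dXc.2 pq rs c4
      Xap Xaq wa Xcr Xcs wc l1 l2.
    by exists s', U, V; left; rewrite !(t U V) e1 e2 !eqxx.
  + have c4' : cyc4 r s p q by clear -c4; order_solve.
    have [s' [U [V [ds is0 e1 e2]]]] := dual_path_exists eca dXc.2 dXa.2 rs pq c4'
      Xcr Xcs wc Xap Xaq wa l1 l2.
    by exists s', U, V; right; rewrite !(t U V) e1 e2 !eqxx.
Qed.

Definition opposite (p q r s x y : nat) : bool :=
  in_co x p q && in_co y r s || in_co x r s && in_co y p q.

Lemma sigmaE i j : sigma T i j A =
  if opposite a b c d (hv' i) (hv' j) then 1%R
  else if opposite d a b c (hv' i) (hv' j) then (-1)%R else 0%R.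
Proof.
have h1 : passes T (@turn_left n) (@turn_right n) i j A <-> opposite a b c d (hv' i) (hv' j).
  by apply: passes_opp => //; left; rewrite !eqxx.
have h2 : passes T (@turn_right n) (@turn_left n) i j A <-> opposite d a b c (hv' i) (hv' j).
  apply: passes_opp => //; first by clear -quad; order_solve.
  by right; rewrite !eqxx.
by rewrite /sigma (asbool_equiv_eq h1) (asbool_equiv_eq h2) !asboolb.
Qed.
End SigmaFormula.

(** * Shear coordinates *)

(** The sign with which the path between two leaves crosses the quadrilateral a
    b c d, when the leaf preceding a vertex x of the polygon is represented by x
    itself; this is why the intervals are open on the left. *)
Definition shear (a b c d x y : nat) : int :=
  if in_oc x a b && in_oc y c d || in_oc x c d && in_oc y a b then 1%R
  else if in_oc x d a && in_oc y b c || in_oc x b c && in_oc y d a then (-1)%R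
  else 0%R.

Section Quadrants.
Variables (a b c d : nat).
Hypothesis c4 :
  [|| a < b < c, b < c < a | c < a < b] && [|| a < c < d, c < d < a | d < a < c].

Lemma quadrant_excl x :
  [|| [&& in_oc x a b, ~~ in_oc x b c, ~~ in_oc x c d & ~~ in_oc x d a],
      [&& ~~ in_oc x a b, in_oc x b c, ~~ in_oc x c d & ~~ in_oc x d a],
      [&& ~~ in_oc x a b, ~~ in_oc x b c, in_oc x c d & ~~ in_oc x d a] |
      [&& ~~ in_oc x a b, ~~ in_oc x b c, ~~ in_oc x c d & in_oc x d a]].
Proof. order_solve. Qed.

(** The shear coordinate is additive on a quadruple of leaves unless a side of
    the quadrilateral separates i, l from j, k. *)
Lemma shear_additive i j k l :
  [|| i < j < k, j < k < i | k < i < j] && [|| i < k < l, k < l < i | l < i < k] ->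
  (forall p q, (p == a) && (q == b) || (p == b) && (q == c) || (p == c) && (q == d)
   || (p == d) && (q == a) ->
     ~~ (in_co p i j && in_co q k l) && ~~ (in_co q i j && in_co p k l)) ->
  (shear a b c d i k + shear a b c d j l = shear a b c d i l + shear a b c d j k)%R.
Proof.
move=> c2 h.
have := h a b; rewrite !eqxx /= => /(_ isT); have := h b c; rewrite !eqxx /= orbT => /(_ isT).
have := h c d; rewrite !eqxx /= ?orbT => /(_ isT).
have := h d a; rewrite !eqxx /= ?orbT => /(_ isT).
move=> {h} h1 h2 h3 h4.
have : [|| [&& in_oc i a b == in_oc j a b, in_oc i b c == in_oc j b c,
    in_oc i c d == in_oc j c d & in_oc i d a == in_oc j d a],
   [&& in_oc k a b == in_oc l a b, in_oc k b c == in_oc l b c,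
    in_oc k c d == in_oc l c d & in_oc k d a == in_oc l d a],
  [&& in_oc i a b, in_oc j b c, in_oc k c d & in_oc l d a],
  [&& in_oc i b c, in_oc j c d, in_oc k d a & in_oc l a b],
  [&& in_oc i c d, in_oc j d a, in_oc k a b & in_oc l b c] |
  [&& in_oc i d a, in_oc j a b, in_oc k b c & in_oc l c d]] by order_solve.
have hi := quadrant_excl i; have hj := quadrant_excl j.
have hk := quadrant_excl k; have hl := quadrant_excl l.
rewrite /shear; clear -hi hj hk hl.
case/or3P => [/and4P[/eqP-> /eqP-> /eqP-> /eqP->]|/and4P[/eqP-> /eqP-> /eqP-> /eqP->]|].
- by rewrite GRing.addrC.
- by [].
move: hi hj hk hl.
case: (in_oc i a b); case: (in_oc i b c); case: (in_oc i c d); case: (in_oc i d a) => //= _.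
all: case: (in_oc j a b); case: (in_oc j b c); case: (in_oc j c d); case: (in_oc j d a) => //= _.
all: case: (in_oc k a b); case: (in_oc k b c); case: (in_oc k c d); case: (in_oc k d a) => //= _.
all: by case: (in_oc l a b); case: (in_oc l b c); case: (in_oc l c d); case: (in_oc l d a).
Qed.
End Quadrants.

Section GVectors.
Variables (n : nat) (T : {set {set 'I_n}}).
Hypothesis T_tri : triangulation T.
Hypothesis n_gt2 : 2 < n.
Implicit Types i j k l : 'I_n.
Local Notation H := (hat_triangulation T).
Local Notation hv := (@hat_vertex n).
Local Notation hv' := (@hat_vertex' n).
Local Notation hE p q := ([set p; q] \in H).

(** An arc of T, boundary edges included, is a diagonal of the larger
    triangulation, hence has a quadrilateral around it. *)
Lemma hat_quad i j : is_arc T i j -> exists a c : 'I_n.*2,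
  [/\ cyc4 a (hv i) c (hv j), hE a (hv i), hE (hv i) c, hE c (hv j) & hE (hv j) a].
Proof.
move=> ij; have h1 := hE_arc ij; have h2 : hE (hv j) (hv i) by rewrite setUC.
have next x y : x != y -> cyc3 (hv x) (ordS (hv x)) (hv y).
  rewrite ord_neqE /cyc3 ordSE /= => xy; have := ltn_ord x; have := ltn_ord y.
  by case: (_.+1 =P _); lia.
have ij' := arc_neq T_tri ij.
have [c [c1 c2 c3]] := hE_triangle T_tri n_gt2 h1 (next _ _ ij').
rewrite eq_sym in ij'.
have [a [a1 a2 a3]] := hE_triangle T_tri n_gt2 h2 (next _ _ ij').
by exists a, c; split=> //; clear -c1 a1; order_solve.
Qed.

Lemma sigma_shear i j A (a b c d : 'I_n.*2) : cyc4 a b c d -> hat_arc A = [set b; d] ->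
  hE a b -> hE b c -> hE c d -> hE d a -> hE b d ->
  sigma T i j A = shear a b c d (hv i) (hv j).
Proof.
move=> c4 AE ab bc cd da bd; by rewrite (sigmaE T_tri n_gt2 c4 AE).
Qed.

Lemma arc_ends A : A \in T -> exists i j, [/\ A = [set i; j], is_arc T i j & i != j].
Proof.
move=> AT; have /cards2P[i [j [ij AE]]] : #|A| == 2.
  by move: T_tri => /maxsetp/andP[/forall_inP h _]; exact: h.
by exists i, j; rewrite /is_arc -AE.
Qed.

Lemma sigma_sym i j A : A \in T -> sigma T i j A = sigma T j i A.
Proof.
move=> /arc_ends[b [d [-> bd _]]]; have [a [c [c4 ab bc cd da]]] := hat_quad bd.
rewrite !(sigma_shear _ _ c4 (hat_arc2 _ _)) ?hE_arc // /shear.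
by rewrite orbC [X in _ = if _ then _ else if X then _ else _]orbC ![_ && in_oc (hv j) _ _]andbC.
Qed.

(** For an arc ij of T the path from leaf i to leaf j turns around i, crosses
    ij, then turns around j, so that it changes direction at ij only. *)
Lemma sigma_arc i j A : A \in T -> is_arc T i j -> sigma T i j A = (A == [set i; j])%:R%R.
Proof.
move=> /arc_ends[b [d [-> bd bdn]]] ij; have ijn := arc_neq T_tri ij.
have hij := hE_arc ij.
case: eqP => [/set2_eq h|ne].
  have bd' : is_arc T i j by [].
  have -> : [set b; d] = [set i; j] by case: h => -[-> ->] //; rewrite setUC.
  have [a [c [c4 ab bc cd da]]] := hat_quad ij.
  rewrite (sigma_shear _ _ c4 (hat_arc2 _ _)) // /shear.
  by rewrite (_ : in_oc _ _ _ && _) //; clear -c4; order_solve.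
have [a [c [c4 ab bc cd da]]] := hat_quad bd.
rewrite (sigma_shear _ _ c4 (hat_arc2 _ _)) ?hE_arc // /shear.
have hji : hE (hv j) (hv i) by rewrite setUC.
have C p q := hE_cross T_tri n_gt2 (p := p) (q := q).
have := (C _ _ _ _ ab hij, C _ _ _ _ ab hji, C _ _ _ _ bc hij, C _ _ _ _ bc hji).
have := (C _ _ _ _ cd hij, C _ _ _ _ cd hji, C _ _ _ _ da hij, C _ _ _ _ da hji).
have hbd := hE_arc bd.
have := (C _ _ _ _ hbd hij, C _ _ _ _ hbd hji).
move=> [r1 r2] [] [] [] r3 r4 r5 r6 [] [] [] r7 r8 r9 r10.
have ne' : ~~ ((hv b == hv i) && (hv d == hv j)) && ~~ ((hv b == hv j) && (hv d == hv i)).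
  rewrite !(inj_eq (@hv_inj n)) -negb_or; apply/negP => /orP[]/andP[/eqP e1 /eqP e2]; apply: ne.
    by rewrite e1 e2.
  by rewrite e1 e2 setUC.
rewrite -(inj_eq (@hv_inj n)) in ijn.
have : ~~ (in_oc (hv i) a (hv b) && in_oc (hv j) c (hv d) ||
  in_oc (hv i) c (hv d) && in_oc (hv j) a (hv b)) &&
  ~~ (in_oc (hv i) (hv d) a && in_oc (hv j) (hv b) c ||
  in_oc (hv i) (hv b) c && in_oc (hv j) (hv d) a).
  move: (hv i) (hv j) (hv b) (hv d) c4 ne' ijn r1 r2 r3 r4 r5 r6 r7 r8 r9 r10.
  clear => I J B D; order_solve.
by case/andP => /negPf-> /negPf->.
Qed.

(** Apply the additivity of the shear in the quadrilateral of A. A side which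
    separates i, l from j, k is either an arc of T, which is excluded, or a
    boundary edge of the large polygon, which separates at most one leaf from
    the others. *)
Lemma sigma_additive i j k l A : A \in T -> cyc4 i j k l -> ~~ sep T i j k l ->
  (sigma T i k A + sigma T j l A = sigma T i l A + sigma T j k A)%R.
Proof.
move=> /arc_ends[b [d [-> bd bdn]]] ijkl nsep.
have [a [c [c4 ab bc cd da]]] := hat_quad bd.
have hbd := hE_arc bd.
rewrite !(sigma_shear _ _ c4 (hat_arc2 _ _)) //.
apply: shear_additive => //; first by rewrite -hv_cyc4 in ijkl.
have N (p q : 'I_n.*2) : hE p q -> ~~ (in_co p (hv i) (hv j) && in_co q (hv k) (hv l)).
  move=> pq; apply/negP => /andP[h1 h2]; move: (hEP T_tri pq).
  case=> [[p' [q' [pq' pE qE]]]|].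
    move/negP: nsep; apply; apply/sepP; exists p', q'; split=> //.
      by move: h1; rewrite pE /in_co /= !ltnS !leq_double !ltn_double.
    by move: h2; rewrite qE /in_co /= !ltnS !leq_double !ltn_double.
  have S (x y : 'I_n.*2) : cyc3 x y (ordS x) = false := cyc3_ordS x y.
  have h : cyc4 (hv i) (hv j) (hv k) (hv l) by rewrite hv_cyc4.
  case=> [qE|pE].
    have := S p (hv j); rewrite -qE; clear -h1 h2 h.
    by move: (hv i) (hv j) (hv k) (hv l) h1 h2 h => I J K L; order_solve.
  have := S q (hv l); rewrite -pE; clear -h1 h2 h.
  by move: (hv i) (hv j) (hv k) (hv l) h1 h2 h => I J K L; order_solve.
have N' (p q : 'I_n.*2) : hE p q -> ~~ (in_co p (hv i) (hv j) && in_co q (hv k) (hv l))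
   && ~~ (in_co q (hv i) (hv j) && in_co p (hv k) (hv l)).
  by move=> pq; rewrite N // N // setUC.
by move=> p q /orP[/orP[/orP[]|]|] /andP[/eqP-> /eqP->]; exact: N'.
Qed.
End GVectors.

(** * Functions additive along the dual tree *)

Local Open Scope ring_scope.

Section Additive.
Variables (n : nat) (T : {set {set 'I_n}}).
Hypothesis T_tri : triangulation T.
Implicit Types i j k l p q : 'I_n.

(** This is the four-point condition satisfied by any linear combination of the
    functions which tell, for an edge of the dual tree, whether the path from i
    to j uses it. *)
Definition tree_additive (V : zmodType) (s : 'I_n -> 'I_n -> V) : Prop :=
  (forall i j, s i j = s j i) /\
  forall i j k l, cyc4 i j k l -> ~~ sep T i j k l -> s i k + s j l = s i l + s j k.

Lemma arc_sep i p j q : cyc4 i p j q -> is_arc T p q ->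
  sep T i p j q = ~~ sep T p j q i.
Proof.
move=> c pq; have := sep_or T_tri c; case: (boolP (sep T i p j q)) => /= [h _|_ ->//].
by rewrite (sep_excl T_tri c h).
Qed.

(** In a quadrilateral i p j q with diagonal pq in T, one of the two forms of
    additivity expresses s_ij by the sides and s_pq, so that an additive
    function is determined by its values on T. *)
Lemma tree_additive_eq (V : zmodType) (s s' : 'I_n -> 'I_n -> V) :
  tree_additive s -> tree_additive s' -> (forall i j, is_arc T i j -> s i j = s' i j) ->
  forall i j, i != j -> s i j = s' i j.
Proof.
move=> [ssym sadd] [s'sym s'add] ss'; apply: (arc_ind T_tri) => //.
  by move=> p q h; rewrite ssym h s'sym.
move=> i p j q c pq h1 h2 h3 h4; apply: (addIr (s p q)); rewrite {2}(ss' _ _ pq).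
case: (boolP (sep T i p j q)) => h; last by rewrite sadd // s'add // h4 h2.
have c' : cyc4 p j q i by clear -c; order_solve.
have h' : ~~ sep T p j q i by rewrite arc_sep in h.
rewrite (ssym i j) (s'sym i j) [s j i + _]addrC [s' j i + _]addrC sadd // s'add //.
by rewrite (ssym p i) (s'sym p i) h1 h3.
Qed.

Lemma sep_witness i j k l x y : is_arc T x y -> in_co x i j -> in_co y k l -> sep T i j k l.
Proof. by move=> xy xi yk; apply/sepP; exists x, y. Qed.

(** The difference s_il + s_jk - s_ik - s_jl adds up when [i, j) or [k, l) is
    cut in two. Cutting reduces to the case where i, j and k, l are neighbours;
    then ik is the only arc joining the two intervals, and additivity allows j
    and l to be replaced by the other vertices b and d of the triangles along
    ik, where the inequality is the hypothesis. *)
Lemma tree_additive_lt (R : realDomainType) (s : 'I_n -> 'I_n -> R) :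
  tree_additive s ->
  (forall a b c d, cyc4 a b c d -> is_arc T a b -> is_arc T b c -> is_arc T c d -> is_arc T a d -> is_arc T a c ->
     s a b + s c d < s a d + s b c) ->
  forall i j k l, cyc4 i j k l -> sep T i j k l -> s i k + s j l < s i l + s j k.
Proof.
move=> [ssym sadd] spos i j k l.
have [m] := ubnP (cdist i j + cdist k l)%N; elim: m i j k l => // m IH i j k l hm c.
have le i' j' k' l' : (cdist i' j' + cdist k' l' < m)%N -> cyc4 i' j' k' l' ->
    s i' k' + s j' l' <= s i' l' + s j' k'.
  move=> h c'; case: (boolP (sep T i' j' k' l')) => hs; first by rewrite ltW ?IH.
  by rewrite sadd.
rewrite ltnS in hm.
case/sepP => [x [y [xy xi yk]]].
case: (pselect (exists j', cyc3 i j' j)) => [[j' h]|nj].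
  have lt1 := cdist_lt h; have lt2 := cdist_ltr h.
  have c1 : cyc4 i j' k l by clear -c h; order_solve.
  have c2 : cyc4 j' j k l by clear -c h; order_solve.
  have m1 : (cdist i j' + cdist k l < m)%N by apply: leq_trans hm; rewrite ltn_add2r.
  have m2 : (cdist j' j + cdist k l < m)%N by apply: leq_trans hm; rewrite ltn_add2r.
  have /orP[hx|hx] : in_co x i j' || in_co x j' j by clear -xi h; order_solve.
    have := IH _ _ _ _ m1 c1 (sep_witness xy hx yk); have := le _ _ _ _ m2 c2.
    by clear; lra.
  have := IH _ _ _ _ m2 c2 (sep_witness xy hx yk); have := le _ _ _ _ m1 c1.
  by clear; lra.
case: (pselect (exists l', cyc3 k l' l)) => [[l' h]|nl].
  have lt1 := cdist_lt h; have lt2 := cdist_ltr h.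
  have c1 : cyc4 i j k l' by clear -c h; order_solve.
  have c2 : cyc4 i j l' l by clear -c h; order_solve.
  have m1 : (cdist i j + cdist k l' < m)%N by apply: leq_trans hm; rewrite ltn_add2l.
  have m2 : (cdist i j + cdist l' l < m)%N by apply: leq_trans hm; rewrite ltn_add2l.
  have /orP[hy|hy] : in_co y k l' || in_co y l' l by clear -yk h; order_solve.
    have := IH _ _ _ _ m1 c1 (sep_witness xy xi hy); have := le _ _ _ _ m2 c2.
    by clear; lra.
  have := IH _ _ _ _ m2 c2 (sep_witness xy xi hy); have := le _ _ _ _ m1 c1.
  by clear; lra.
have {xi} xi : x = i.
  have : ~~ cyc3 i x j by apply/negP => ?; apply: nj; exists x.
  by clear -xi; order_solve.
have {yk} yk : y = k.
  have : ~~ cyc3 k y l by apply/negP => ?; apply: nl; exists y.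
  by clear -yk; order_solve.
subst x y; have ki := xy; rewrite arc_sym in ki.
have cj : cyc3 i j k by clear -c; order_solve.
have cl : cyc3 k l i by clear -c; order_solve.
have [b [cb ib bk]] := arc_triangle T_tri xy cj.
have [d [cd kd di]] := arc_triangle T_tri ki cl.
have cibkd : cyc4 i b k d by clear -cb cd; order_solve.
rewrite arc_sym in di.
have st := spos _ _ _ _ cibkd ib bk kd di xy.
have sib : sep T i b k d.
  by apply: (sep_witness xy); clear -cibkd; order_solve.
have e0 : s b d + s k i = s b i + s k d.
  apply: sadd; first by clear -cibkd; order_solve.
  by rewrite (sep_excl T_tri cibkd sib).
have {nj} nj z : cyc3 i z j = false by apply/negbTE/negP => ?; apply: nj; exists z.
have {nl} nl z : cyc3 k z l = false by apply/negbTE/negP => ?; apply: nl; exists z.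
have Ejb : s i d + s j k - (s i k + s j d) = s i d + s b k - (s i k + s b d).
  case: (eqVneq j b) => [->//|jb].
  have cjb : cyc4 j b k d by have := nj b; clear -cibkd c jb; order_solve.
  suff /(sadd _ _ _ _ cjb) : ~~ sep T j b k d by clear; lra.
  apply/sepP => -[u [v [uv uj vk]]].
  have := arc_cross T_tri ib uv; rewrite arc_sym in uv; have := arc_cross T_tri ib uv.
  by have := nj b; clear -cibkd c uj vk jb; order_solve.
have Eld : s i l + s j k - (s i k + s j l) = s i d + s j k - (s i k + s j d).
  case: (eqVneq l d) => [->//|ld].
  have cld : cyc4 i j l d.
    by have := nl d; have := nj b; clear -cibkd c ld; order_solve.
  suff /(sadd _ _ _ _ cld) : ~~ sep T i j l d by clear; lra.
  apply/sepP => -[u [v [uv uj vk]]].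
  have := arc_cross T_tri kd uv; rewrite arc_sym in uv; have := arc_cross T_tri kd uv.
  by have := nl d; have := nj b; clear -cibkd c uj vk ld; order_solve.
rewrite (ssym k i) (ssym b i) in e0; rewrite (ssym j k) in Eld Ejb *.
by rewrite (ssym b k) in Ejb st; move: e0 Eld Ejb st; clear; lra.
Qed.
End Additive.

(** * Noncrossing multisets of arcs and their g-vectors *)

Definition src n (u : pl_index n) : 'I_n := (val u).1.
Definition tgt n (u : pl_index n) : 'I_n := (val u).2.
Arguments src : simpl never.
Arguments tgt : simpl never.

Lemma src_lt_tgt n (u : pl_index n) : (src u < tgt u)%N. Proof. exact: (valP u). Qed.

Section GVec.
Variables (n : nat) (T : {set {set 'I_n}}).
Hypothesis T_tri : triangulation T.
Hypothesis n_gt2 : (2 < n)%N.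
Implicit Types i j k l p q : 'I_n.

Lemma gvecE (R : pzRingType) i j (a : arc_of T) :
  gvec T R i j a = (sigma T i j (val a))%:~R.
Proof.
rewrite /gvec sum_ffunE (bigD1 a) //= big1 => [|b ba].
  by rewrite addr0 ffunMzE /fvec ffunE eqxx.
by rewrite ffunMzE /fvec ffunE val_eqE eq_sym (negPf ba) mul0rz.
Qed.

(** On the arcs of T the g-vectors are the standard basis. *)
Lemma gvec_arc (R : pzRingType) i j : is_arc T i j -> gvec T R i j = fvec T R [set i; j].
Proof.
move=> ij; apply/ffunP => a; rewrite gvecE (sigma_arc T_tri n_gt2) ?(valP a) //.
by rewrite /fvec ffunE; case: eqP.
Qed.

Lemma gvec_additive (R : pzRingType) : tree_additive T (gvec T R).
Proof.
split=> [i j|i j k l c h]; apply/ffunP => a.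
  apply: etrans (gvecE R i j a) _; apply: etrans _ (esym (gvecE R j i a)).
  by rewrite (sigma_sym T_tri n_gt2 i j (valP a)).
rewrite ffunE [RHS]ffunE.
apply: etrans (congr2 +%R (gvecE R i k a) (gvecE R j l a)) _.
apply: etrans _ (esym (congr2 +%R (gvecE R i l a) (gvecE R j k a))).
by rewrite -!intrD (sigma_additive T_tri n_gt2 (valP a) c h).
Qed.

(** The number of intersections of ij with the arc pq turned by half a step. *)
Definition cut p q i j : int := (hsep p q i (+) hsep p q j : nat)%:Z.

Lemma cut_additive p q : is_arc T p q -> tree_additive T (cut p q).
Proof.
move=> pq; split=> [i j|i j k l c h]; rewrite /cut; first by rewrite addbC.
have h1 : ~~ (in_co p i j && in_co q k l).
  by apply: contra h => /andP[]; apply: sep_witness.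
have h2 : ~~ (in_co q i j && in_co p k l).
  by apply: contra h => /andP[]; apply: sep_witness => //; rewrite arc_sym.
have : ((hsep p q i == hsep p q j) || (hsep p q k == hsep p q l)) ||
       ((hsep p q i != hsep p q l) && (hsep p q j != hsep p q k)) && false.
  by clear -c h1 h2; order_solve.
by case: (hsep p q i); case: (hsep p q j); case: (hsep p q k); case: (hsep p q l).
Qed.

(** Both sides are additive in ij and agree on T. *)
Lemma tree_additive_expand (V : zmodType) (s : 'I_n -> 'I_n -> V) (S : {set 'I_n} -> V) :
  tree_additive T s -> (forall i j, s i j = S [set i; j]) ->
  forall i j, i != j -> s i j = \sum_(a : arc_of T) S (val a) *~ gvec T int i j a.
Proof.
move=> sadd sS; have [gsym gadd] := gvec_additive int.
apply: (tree_additive_eq T_tri sadd); last first.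
  move=> i j ij; rewrite sS (bigD1 (Sub [set i; j] ij : arc_of T)) //= big1 => [|a].
    by rewrite gvec_arc // ffunE eqxx mulr1z addr0.
  by rewrite gvec_arc // ffunE -val_eqE => /negPf->; rewrite mulr0z.
split=> [i j|i j k l c h]; first by apply: eq_bigr => a _; rewrite gsym.
rewrite -!big_split /=; apply: eq_bigr => a _; rewrite -!mulrzDr.
by have /ffunP/(_ a) := gadd _ _ _ _ c h; rewrite !ffunE => ->.
Qed.

(** The same number as a function of the set of ends, so that it can be
    evaluated on the elements of T. *)
Definition cut_set p q (B : {set 'I_n}) : int :=
  ([exists x in B, hsep p q x] && [exists x in B, ~~ hsep p q x] : nat)%:Z.

Lemma cut_setE p q i j : cut p q i j = cut_set p q [set i; j].
Proof.
rewrite /cut /cut_set; congr (Posz (nat_of_bool _)).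
have ex (P : pred 'I_n) : [exists x in [set i; j], P x] = P i || P j.
  apply/exists_inP/orP => [[x /set2P[]-> ->]|[]]; [by left|by right|..].
    by exists i; rewrite ?set21.
  by exists j; rewrite ?set22.
by rewrite !ex; case: (hsep p q i); case: (hsep p q j).
Qed.

(** The weights form a multicurve: no two arcs of positive weight cross. *)
Definition noncrossing_weights (mu : pl_index n -> nat) : Prop :=
  forall u v, (0 < mu u)%N -> (0 < mu v)%N ->
    cyc4 (src u) (src v) (tgt u) (tgt v) = false.

(** The g-vector of the monomial of exponents mu. *)
Definition gsum (mu : pl_index n -> nat) : {ffun arc_of T -> int} :=
  \sum_u gvec T int (src u) (tgt u) *+ mu u.

(** The number of intersections of the multicurve mu with the arc pq turned by
    half a step. *)
Definition cutsum p q (mu : pl_index n -> nat) : int :=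
  \sum_u cut p q (src u) (tgt u) *+ mu u.

Lemma pl_neq (u : pl_index n) : (src u) != (tgt u).
Proof. by rewrite ord_neqE ltn_eqF // src_lt_tgt. Qed.

(** For pq in T the number of intersections is additive on the tree, hence a
    linear function of the g-vector. *)
Lemma cutsum_arc p q mu : is_arc T p q ->
  cutsum p q mu = \sum_(a : arc_of T) cut_set p q (val a) *~ gsum mu a.
Proof.
move=> pq; rewrite /cutsum.
under eq_bigr => u _ do
  rewrite (tree_additive_expand (cut_additive pq) (cut_setE p q) (pl_neq u)) -sumrMnl.
rewrite exchange_big; apply: eq_bigr => a _ /=.
rewrite /gsum sum_ffunE mulrz_sumr; apply: eq_bigr => u _.
by rewrite ffunMnE !mulrzz mulrnAr.
Qed.

Lemma cut_oc p q i j : p != q -> cut p q i j = (in_oc i p q (+) in_oc j p q : nat)%:Z.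
Proof. by move=> pq; rewrite /cut; congr (Posz (nat_of_bool _)); order_solve. Qed.

Definition joins_across (a b c d x y : nat) : bool :=
  in_oc x a b && in_oc y c d || in_oc x c d && in_oc y a b.

(** Resolving the crossing of ij and pq in either way loses two intersections
    with xy when xy runs between the two sides that are not used, and none
    otherwise. *)
Lemma cut_ptolemy i p j q x y : cyc4 i p j q ->
  cut i j x y + cut p q x y = cut i p x y + cut j q x y + (joins_across p j q i x y : nat)%:Z *+ 2 /\
  cut i j x y + cut p q x y = cut p j x y + cut i q x y + (joins_across i p j q x y : nat)%:Z *+ 2.
Proof.
move=> c.
have := quadrant_excl c x; have := quadrant_excl c y.
have sp z : (in_oc z i j = in_oc z i p || in_oc z p j) /\
  (in_oc z p q = in_oc z p j || in_oc z j q).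
  by split; order_solve.
have /and5P[/and3P[n1 n2 n3] n4 n5 n6 _] : [&& [&& i != j, p != q & i != p], j != q, p != j, q != i & true].
  by order_solve.
have csym : cut i q x y = cut q i x y by rewrite /cut /hsep ![(_ < _ <= i)%N || _]orbC.
rewrite csym !cut_oc // /joins_across (sp x).1 (sp x).2 (sp y).1 (sp y).2; clear.
case: (in_oc x i p); case: (in_oc x p j); case: (in_oc x j q); case: (in_oc x q i) => //=.
all: case: (in_oc y i p); case: (in_oc y p j); case: (in_oc y j q); case: (in_oc y q i) => //=.
Qed.

(** The multicurve cannot have arcs of both kinds that lose intersections, since
    these would cross. *)
Lemma cutsum_ptolemy i p j q mu : noncrossing_weights mu -> cyc4 i p j q ->
  cutsum i j mu + cutsum p q mu =
    Num.max (cutsum i p mu + cutsum j q mu) (cutsum p j mu + cutsum i q mu).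
Proof.
move=> nmu c.
pose J1 := \sum_(u : pl_index n) ((joins_across p j q i (src u) (tgt u) : nat)%:Z *+ 2) *+ mu u.
pose J2 := \sum_(u : pl_index n) ((joins_across i p j q (src u) (tgt u) : nat)%:Z *+ 2) *+ mu u.
have e1 : cutsum i j mu + cutsum p q mu = cutsum i p mu + cutsum j q mu + J1.
  rewrite /cutsum -!big_split; apply: eq_bigr => u _ /=.
  by rewrite -!mulrnDl (cut_ptolemy _ _ c).1.
have e2 : cutsum i j mu + cutsum p q mu = cutsum p j mu + cutsum i q mu + J2.
  rewrite /cutsum -!big_split; apply: eq_bigr => u _ /=.
  by rewrite -!mulrnDl (cut_ptolemy _ _ c).2.
have J1_ge0 : 0 <= J1 by apply: sumr_ge0 => u _; rewrite !mulrn_wge0.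
have J2_ge0 : 0 <= J2 by apply: sumr_ge0 => u _; rewrite !mulrn_wge0.
suff : J1 = 0 \/ J2 = 0.
  case=> J0; rewrite J0 addr0 in e1 e2.
    by rewrite e1 max_l // -e1 e2 lerDl.
  by rewrite e2 max_r // -e2 e1 lerDl.
case: (pselect (exists2 u, (0 < mu u)%N & joins_across p j q i (src u) (tgt u))).
  move=> [u mu0 ju]; right; apply: big1 => v _.
  case: (posnP (mu v)) => [->|mv0]; first by rewrite mulr0n.
  case: (boolP (joins_across i p j q (src v) (tgt v))) => [jv|_]; last by rewrite mul0rn.
  have := nmu _ _ mu0 mv0; have := nmu _ _ mv0 mu0.
  have h1 := src_lt_tgt u; have h2 := src_lt_tgt v; move: ju jv h1 h2.
  by rewrite /joins_across; clear -c => *; exfalso; order_solve.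
move=> h; left; apply: big1 => v _.
case: (posnP (mu v)) => [->|mv0]; first by rewrite mulr0n.
case: (boolP (joins_across p j q i (src v) (tgt v))) => [jv|_]; last by rewrite mul0rn.
by case: h; exists v.
Qed.

(** Induction on the crossings with T: both multicurves satisfy the same Ptolemy
    relations, with the same initial values. *)
Lemma cutsum_inj mu nu : noncrossing_weights mu -> noncrossing_weights nu ->
  gsum mu = gsum nu -> forall p q, cutsum p q mu = cutsum p q nu.
Proof.
move=> nmu nnu e p q; case: (eqVneq p q) => [->|].
  have h x : hsep q q x = false by order_solve.
  by rewrite /cutsum !big1 // => u _; rewrite /cut !h mul0rn.
have csym i j m : cutsum i j m = cutsum j i m.
  by apply: eq_bigr => u _; rewrite /cut /hsep ![(_ < _ <= i)%N || _]orbC.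
move: p q; apply: (arc_ind T_tri).
- by move=> i j h; rewrite csym h csym.
- by move=> i j ij; rewrite !cutsum_arc // e.
move=> i p j q c pq h1 h2 h3 h4; apply: (addIr (cutsum p q mu)).
rewrite {2}(cutsum_arc mu pq) e -(cutsum_arc nu pq).
by rewrite (cutsum_ptolemy nmu c) (cutsum_ptolemy nnu c) h1 h2 h3 h4.
Qed.

Lemma cut_level p q (x y : 'I_n) : (x < y)%N ->
  cut p q x y = ((x <= p < y)%N (+) (x <= q < y)%N : nat)%:Z.
Proof. by move=> xy; rewrite /cut; congr (Posz (nat_of_bool _)); order_solve. Qed.

Lemma level_step (i' i x y : 'I_n) : (x < y)%N -> ordS i' = i ->
  ((x <= i < y)%N : nat)%:Z = ((x <= i' < y)%N : nat)%:Z + (x == i : nat)%:Z - (y == i : nat)%:Z.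
Proof.
move=> xy <-; rewrite !eqoE ordSE; have hx := ltn_ord x; have hy := ltn_ord y.
have hi := ltn_ord i'; move: xy hx hy hi; move: (nat_of_ord x) (nat_of_ord y) (nat_of_ord i').
by clear => a b c; case: (_.+1 =P _); lia.
Qed.

(** Moving one end of pq from j' to the next vertex j changes the intersection
    with xy only if xy ends at j; so the double difference in both ends only
    sees the arc ij, with the value 2. *)
Lemma cutsum_recover mu u (i' j' : 'I_n) : ordS i' = (src u) -> ordS j' = (tgt u) ->
  (mu u)%:Z *+ 2 = cutsum i' j' mu + cutsum (src u) (tgt u) mu
     - cutsum (src u) j' mu - cutsum i' (tgt u) mu.
Proof.
move=> iE jE; rewrite /cutsum -big_split /= -sumrB -sumrB (bigD1 u) //= big1 => [|v vu].
  rewrite -!mulrnDl -!mulrnBl addr0 !cut_level ?src_lt_tgt //.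
  have ij := src_lt_tgt u; move: (src u) (tgt u) iE jE ij => i j iE jE ij.
  transitivity ((2%:R : int) *+ mu u).
    by rewrite -[LHS]mulr_natr -[RHS]mulr_natr (natz (mu u)) mulrC.
  congr (_ *+ _); have := level_step ij iE; have := level_step ij jE.
  rewrite !eqxx ij leqnn ltnn (ltnW ij) /= [j == i]eq_sym [i == j]ltn_eqF //.
  by case: (i <= i' < j)%N; case: (i <= j' < j)%N; clear; lia.
rewrite -!mulrnDl -!mulrnBl !cut_level ?src_lt_tgt //.
have ne : ((src v) == (src u)) && ((tgt v) == (tgt u)) = false.
  apply: contraNF vu => /andP[/eqP e1 /eqP e2]; apply/eqP/val_inj.
  by rewrite [LHS]surjective_pairing [RHS]surjective_pairing; congr pair.
have := src_lt_tgt v; have := src_lt_tgt u.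
move: (src u) (tgt u) (src v) (tgt v) iE jE ne => i j x y iE jE ne ij xy.
have := level_step xy iE; have := level_step xy jE.
have e1 : (x == j) && (y == i) = false by clear -ij xy; order_solve.
have e2 : (x == i) && (x == j) = false by clear -ij xy; order_solve.
have e3 : (y == i) && (y == j) = false by clear -ij xy; order_solve.
move: ne e1 e2 e3.
by case: (x == i); case: (x == j); case: (y == i); case: (y == j) => //= _ _ _ _;
  case: (x <= i < y)%N; case: (x <= i' < y)%N => //=;
  case: (x <= j < y)%N; case: (x <= j' < y)%N => //=; rewrite mul0rn.
Qed.

Lemma gsum_inj mu nu : noncrossing_weights mu -> noncrossing_weights nu ->
  gsum mu = gsum nu -> mu =1 nu.
Proof.
move=> nmu nnu /(cutsum_inj nmu nnu) e u.
have [i' iE] := ordS_surj (src u); have [j' jE] := ordS_surj (tgt u).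
have := cutsum_recover mu (esym iE) (esym jE).
rewrite !e -(cutsum_recover nu (esym iE) (esym jE)); clear; lia.
Qed.
End GVec.

(** * Ideals, and evaluation of the Pluecker coordinates *)

Section Ideal.
Variables (K : comNzRingType) (A : comAlgType K) (E : set A).
Local Notation I := (in_ideal_gen E).

Lemma ideal_gen_sub x : E x -> x \in I.
Proof. by move=> Ex; apply/asboolP; exists [:: (1, x)] => [e|]; rewrite ?big_seq1 ?mul1r // inE => /eqP->. Qed.

Lemma ideal_genD x y : x \in I -> y \in I -> x + y \in I.
Proof. exact: rpredD. Qed.

Lemma ideal_genN x : (- x \in I) = (x \in I).
Proof. exact: rpredN. Qed.

Lemma ideal_genM x y : y \in I -> x * y \in I.
Proof. exact: in_ideal_genM. Qed.

Lemma ideal_genZ (c : K) y : y \in I -> c *: y \in I.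
Proof. by move=> h; rewrite -mulr_algl ideal_genM. Qed.

Lemma ideal_gen_ind (P : A -> Prop) : P 0 -> (forall x y, P x -> P y -> P (x + y)) ->
  (forall x y, E y -> P (x * y)) -> forall x, x \in I -> P x.
Proof.
move=> P0 PD PM x /asboolP[s sE ->].
elim: s sE => [|e s IH] sE; first by rewrite big_nil.
rewrite big_cons; apply: PD; first by apply: PM; apply: sE; rewrite mem_head.
by apply: IH => e' e's; apply: sE; rewrite inE e's orbT.
Qed.

Lemma ideal_gen_le (E' : set A) : (forall x, E x -> x \in in_ideal_gen E') ->
  forall x, x \in I -> x \in in_ideal_gen E'.
Proof.
move=> h; apply: ideal_gen_ind => [|x y|x y /h]; [exact: rpred0|exact: rpredD|exact: in_ideal_genM].
Qed.

Lemma ideal_gen_ker (B : pzRingType) (chi : {rmorphism A -> B}) :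
  (forall x, E x -> chi x = 0) -> forall x, x \in I -> chi x = 0.
Proof.
move=> h; apply: ideal_gen_ind => [|x y hx hy|x y /h hy]; first exact: rmorph0.
  by rewrite rmorphD hx hy addr0.
by rewrite rmorphM hy mulr0.
Qed.
End Ideal.

Section Pluecker.
Variables (K : fieldType) (n : nat).
Implicit Types i j k l : 'I_n.
Local Notation S := (pl_ring K n).
Local Notation N := #|pl_index n|.

(** The Pluecker coordinate of an unordered pair. *)
Definition pla i j : S :=
  if insub (i, j) is Some a then 'X_(enum_rank (a : pl_index n))
  else if insub (j, i) is Some a then 'X_(enum_rank (a : pl_index n)) else 0.

Lemma pl_lt i j : (i < j)%N -> pl K i j = pla i j.
Proof. by move=> ij; rewrite /pl /pla insubT. Qed.

Lemma plaE (u : pl_index n) : pla (src u) (tgt u) = 'X_(enum_rank u).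
Proof. by rewrite /pla /src /tgt -surjective_pairing valK. Qed.

Lemma pl_index_of i j : (i < j)%N -> exists u : pl_index n, src u = i /\ tgt u = j.
Proof. by move=> ij; exists (Sub (i, j) ij). Qed.

Section Eval.
Variables (B : comAlgType K) (H : 'I_n -> 'I_n -> B).

(** The algebra morphism that maps p_ij to H i j, for i < j. *)
Definition pl_eval : S -> B :=
  mmap (GRing.in_alg B) (fun u => H (src (enum_val u)) (tgt (enum_val u))).
HB.instance Definition _ := GRing.RMorphism.on pl_eval.

Lemma pl_evalX (m : 'X_{1..N}) : pl_eval 'X_[m] =
  \prod_(u : pl_index n) H (src u) (tgt u) ^+ m (enum_rank u).
Proof.
rewrite /pl_eval mmapX /mmap1 (reindex (@enum_rank (pl_index n))) /=; last first.
  by exists enum_val => u _; rewrite ?enum_rankK ?enum_valK.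
by apply: eq_bigr => u _; rewrite enum_rankK.
Qed.

Lemma pl_evalZ c f : pl_eval (c *: f) = c *: pl_eval f.
Proof. by rewrite /pl_eval mmapZ mulr_algl. Qed.

Lemma pl_eval_pla i j : (i < j)%N -> pl_eval (pla i j) = H i j.
Proof.
move=> /pl_index_of[u [<- <-]]; rewrite plaE pl_evalX (bigD1 u) //= big1 => [|v vu].
  by rewrite mnm1E eqxx expr1 mulr1.
by rewrite mnm1E (inj_eq enum_rank_inj) eq_sym (negPf vu).
Qed.
End Eval.
End Pluecker.

(** * Straightening modulo the binomials of the tree *)

Definition chord (n i j : nat) : nat := (j - i) * (n - (j - i)).

(** The function d (n - d) of the distance d is strictly concave, so uncrossing
    two chords decreases the sum of its values; it is the measure for which
    straightening terminates. *)
Lemma chord_lt n i j k l : (i < j)%N -> (j < k)%N -> (k < l)%N -> (l < n)%N ->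
  (chord n i l + chord n j k < chord n i k + chord n j l)%N /\
  (chord n i j + chord n k l < chord n i k + chord n j l)%N.
Proof.
move=> ij jk kl ln; rewrite /chord.
have [a aE] : exists a, j = (i + a.+1)%N :> nat by exists (j - i.+1)%N; lia.
have [b bE] : exists b, k = (j + b.+1)%N :> nat by exists (k - j.+1)%N; lia.
have [c cE] : exists c, l = (k + c.+1)%N :> nat by exists (l - k.+1)%N; lia.
have [e eE] : exists e, n = (a.+1 + b.+1 + c.+1 + e.+1)%N :> nat.
  by exists (n - (a.+1 + b.+1 + c.+1).+1)%N; lia.
clear ij jk kl ln; subst.
have -> : (i + a.+1 + b.+1 + c.+1 - i = a.+1 + b.+1 + c.+1)%N by lia.
have -> : (i + a.+1 + b.+1 - (i + a.+1) = b.+1)%N by lia.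
have -> : (i + a.+1 + b.+1 - i = a.+1 + b.+1)%N by lia.
have -> : (i + a.+1 + b.+1 + c.+1 - (i + a.+1) = b.+1 + c.+1)%N by lia.
have -> : (i + a.+1 - i = a.+1)%N by lia.
have -> : (i + a.+1 + b.+1 + c.+1 - (i + a.+1 + b.+1) = c.+1)%N by lia.
have -> : (a.+1 + b.+1 + c.+1 + e.+1 - (a.+1 + b.+1 + c.+1) = e.+1)%N by lia.
have -> : (a.+1 + b.+1 + c.+1 + e.+1 - b.+1 = a.+1 + c.+1 + e.+1)%N by lia.
have -> : (a.+1 + b.+1 + c.+1 + e.+1 - (a.+1 + b.+1) = c.+1 + e.+1)%N by lia.
have -> : (a.+1 + b.+1 + c.+1 + e.+1 - (b.+1 + c.+1) = a.+1 + e.+1)%N by lia.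
have -> : (a.+1 + b.+1 + c.+1 + e.+1 - a.+1 = b.+1 + c.+1 + e.+1)%N by lia.
have -> : (a.+1 + b.+1 + c.+1 + e.+1 - c.+1 = a.+1 + b.+1 + e.+1)%N by lia.
by split; nia.
Qed.

Section Straightening.
Variables (K : fieldType) (n : nat) (T : {set {set 'I_n}}).
Hypothesis T_tri : triangulation T.
Implicit Types i j k l : 'I_n.
Local Notation S := (pl_ring K n).
Local Notation N := #|pl_index n|.

(** The generators of J_T. *)
Definition tree_binomial : set S := [set f | exists i j k l,
  [/\ (i < j)%N, (j < k)%N & (k < l)%N] /\
  (~~ sep T i j k l /\ f = pla K i k * pla K j l - pla K i l * pla K j k \/
   ~~ sep T j k l i /\ f = pla K i k * pla K j l - pla K i j * pla K k l)]%classic.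

Local Notation J := (in_ideal_gen tree_binomial).

Definition expo (m : 'X_{1..N}) (u : pl_index n) : nat := m (enum_rank u).

Definition total_chord (m : 'X_{1..N}) : nat :=
  \sum_(v < N) m v * chord n (src (enum_val v)) (tgt (enum_val v)).

Lemma total_chordD m1 m2 : total_chord (m1 + m2) = (total_chord m1 + total_chord m2)%N.
Proof.
by rewrite /total_chord -big_split /=; apply: eq_bigr => v _; rewrite mnmDE mulnDl.
Qed.

Lemma total_chordU (u : pl_index n) : total_chord U_(enum_rank u) = chord n (src u) (tgt u).
Proof.
rewrite /total_chord (bigD1 (enum_rank u)) //= big1 => [|v vu].
  by rewrite mnm1E eqxx mul1n addn0 enum_rankK.
by rewrite mnm1E eq_sym (negPf vu).
Qed.

(** A crossing pair of factors can be replaced by the sides of the quadrilateral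
    selected by the tree, which decreases the total of the chords. *)
Lemma straighten_mon m : exists m', noncrossing_weights (expo m') /\
  ('X_[m] - 'X_[m'] : S) \in J.
Proof.
have [d] := ubnP (total_chord m); elim: d m => // d IH m hm; rewrite ltnS in hm.
case: (pselect (noncrossing_weights (expo m))) => [nc|].
  by exists m; split=> //; rewrite subrr rpred0.
move=> /existsNP[a /existsNP[b /not_implyP[ma /not_implyP[mb /Bool.not_false_is_true c]]]].
have ia := src_lt_tgt a; have ib := src_lt_tgt b.
have /and3P[ij jk kl] : [&& (src a < src b)%N, (src b < tgt a)%N & (tgt a < tgt b)%N].
  by clear -c ia ib; order_solve.
have ab : enum_rank a != enum_rank b.
  by rewrite (inj_eq enum_rank_inj); apply: contraTneq ij => ->; rewrite ltnn.
(* The monomial without the crossing pair of factors. *)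
pose m0 := (m - (U_(enum_rank a) + U_(enum_rank b)))%MM.
have mE : m = (m0 + (U_(enum_rank a) + U_(enum_rank b)))%MM.
  rewrite /m0 addmC addmBA; last first.
    apply/mnm_lepP => v; rewrite mnmDE !mnm1E.
    case: eqP => [<-|_]; first by rewrite eq_sym (negPf ab) addn0.
    by case: eqP => [<-|_].
  by rewrite addmC addmK.
have step (u v : pl_index n) : (chord n (src u) (tgt u) + chord n (src v) (tgt v) <
      chord n (src a) (tgt a) + chord n (src b) (tgt b))%N ->
    tree_binomial (pla K (src a) (tgt a) * pla K (src b) (tgt b) -
       pla K (src u) (tgt u) * pla K (src v) (tgt v)) ->
    exists m', noncrossing_weights (expo m') /\ ('X_[m] - 'X_[m'] : S) \in J.
  move=> lt bin; pose m1 := (m0 + (U_(enum_rank u) + U_(enum_rank v)))%MM.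
  have /IH[m' [nc m'J]] : (total_chord m1 < d)%N.
    by apply: leq_trans hm; rewrite mE !total_chordD !total_chordU ltn_add2l.
  exists m'; split=> //; rewrite -(subrK 'X_[m1] 'X_[m]) -addrA rpredD //.
  rewrite mE !mpolyXD -mulrBr ideal_genM // ideal_gen_sub // -!plaE.
  exact: bin.
have [lt1 lt2] := chord_lt ij jk kl (ltn_ord (tgt b)).
have := sep_or T_tri c.
case: (boolP (sep T (src a) (src b) (tgt a) (tgt b))) => [s _|s _].
  have [u [uE1 uE2]] := pl_index_of ij; have [v [vE1 vE2]] := pl_index_of kl.
  apply: (step u v); first by rewrite uE1 uE2 vE1 vE2.
  exists (src a), (src b), (tgt a), (tgt b); split=> //; right.
  by rewrite (sep_excl T_tri c s) uE1 uE2 vE1 vE2.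
have [u [uE1 uE2]] := pl_index_of (ltn_trans ij (ltn_trans jk kl)).
have [v [vE1 vE2]] := pl_index_of jk.
apply: (step u v); first by rewrite uE1 uE2 vE1 vE2.
exists (src a), (src b), (tgt a), (tgt b); split=> //; left.
by rewrite s uE1 uE2 vE1 vE2.
Qed.

Definition nc_supported (r : S) : Prop := forall m, r@_m != 0 -> noncrossing_weights (expo m).

Lemma straighten (f : S) : exists r, nc_supported r /\ f - r \in J.
Proof.
elim/mpolyind: f => [|c m f _ _ [r [nc rJ]]].
  by exists 0; split=> [m|]; rewrite ?subrr ?rpred0 // mcoeff0 eqxx.
have [m' [nc' m'J]] := straighten_mon m.
exists (c *: 'X_[m'] + r); split=> [m1|].
  rewrite mcoeffD mcoeffZ mcoeffX; case: (m' =P m1) => [<- //|_].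
  by rewrite mulr0 add0r; apply: nc.
by rewrite opprD addrACA -scalerBr rpredD // ideal_genZ.
Qed.

(** An element of the kernel is congruent to a combination of noncrossing
    monomials in the kernel, which is 0. *)
Lemma tree_kernel (B : pzRingType) (chi : {rmorphism S -> B}) :
  (forall f, tree_binomial f -> chi f = 0) ->
  (forall r, nc_supported r -> chi r = 0 -> r = 0) ->
  forall f, chi f = 0 <-> f \in J.
Proof.
move=> kill sepa f; split; last exact: ideal_gen_ker.
move=> f0; have [r [nc frJ]] := straighten f.
have /eqP := ideal_gen_ker kill frJ; rewrite rmorphB f0 sub0r oppr_eq0 => /eqP r0.
by rewrite (sepa r nc r0) subr0 in frJ.
Qed.

Lemma tree_binomial_eval (B : comAlgType K) (H : 'I_n -> 'I_n -> B) :
  (forall i j, H i j = H j i) ->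
  (forall i j k l, cyc4 i j k l -> ~~ sep T i j k l -> H i k * H j l = H i l * H j k) ->
  forall f, tree_binomial f -> pl_eval H f = 0.
Proof.
move=> Hsym Hmul f [i [j [k [l [[ij jk kl] h]]]]].
have [ik jl il] : [/\ (i < k)%N, (j < l)%N & (i < l)%N].
  by rewrite (ltn_trans ij jk) (ltn_trans jk kl) (ltn_trans ij (ltn_trans jk kl)).
have c : cyc4 i j k l by clear -ij jk kl; order_solve.
case: h => -[s ->]; rewrite rmorphB !rmorphM /= !pl_eval_pla //.
  by rewrite (Hmul _ _ _ _ c s) subrr.
have c' : cyc4 j k l i by clear -ij jk kl; order_solve.
rewrite mulrC (Hsym i k) (Hmul _ _ _ _ c' s) (Hsym j i).
by rewrite subrr.
Qed.
End Straightening.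

(** * Initial forms and leading parts *)

Section Weights.
Variables (K : fieldType) (R : realDomainType) (L : nat) (om : 'I_L -> R).
Local Notation wt := (mweight om).
Implicit Types (p q f : {mpoly K[L]}) (m d : 'X_{1..L}) (c : R).

Lemma mweightD m1 m2 : wt (m1 + m2)%MM = wt m1 + wt m2.
Proof.
by rewrite /mweight -big_split; apply: eq_bigr => i _; rewrite mnmDE natrD mulrDl.
Qed.

Lemma mweightU i : wt U_(i)%MM = om i.
Proof.
rewrite /mweight (bigD1 i) //= big1 => [|j ji]; first by rewrite mnm1E eqxx mul1r addr0.
by rewrite mnm1E eq_sym (negPf ji) mul0r.
Qed.

Definition wt_eq c p := forall m, p@_m != 0 -> wt m = c.
Definition wt_gt c p := forall m, p@_m != 0 -> c < wt m.

Lemma wt_eq0 c : wt_eq c 0. Proof. by move=> m; rewrite mcoeff0 eqxx. Qed.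
Lemma wt_gt0 c : wt_gt c 0. Proof. by move=> m; rewrite mcoeff0 eqxx. Qed.

Lemma mcoeffD_neq0 p q m : (p + q)@_m != 0 -> p@_m != 0 \/ q@_m != 0.
Proof.
rewrite mcoeffD; case: (eqVneq p@_m 0) => [->|]; last by left.
by rewrite add0r; right.
Qed.

Lemma mcoeffM_neq0 p q m : (p * q)@_m != 0 ->
  exists m1 m2, [/\ p@_m1 != 0, q@_m2 != 0 & m = (m1 + m2)%MM].
Proof.
rewrite -mcoeff_msupp => /msuppM_le /allpairsP[[m1 m2] /= [h1 h2 ->]].
by exists m1, m2; rewrite -!mcoeff_msupp.
Qed.

Lemma wt_eqD c p q : wt_eq c p -> wt_eq c q -> wt_eq c (p + q).
Proof. by move=> hp hq m /mcoeffD_neq0[/hp|/hq]. Qed.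
Lemma wt_gtD c p q : wt_gt c p -> wt_gt c q -> wt_gt c (p + q).
Proof. by move=> hp hq m /mcoeffD_neq0[/hp|/hq]. Qed.

Lemma wt_eqM c c' p q : wt_eq c p -> wt_eq c' q -> wt_eq (c + c') (p * q).
Proof. by move=> hp hq m /mcoeffM_neq0[m1 [m2 [/hp <- /hq <- ->]]]; rewrite mweightD. Qed.
Lemma wt_gtM c c' p q : wt_gt c p -> wt_gt c' q -> wt_gt (c + c') (p * q).
Proof.
by move=> hp hq m /mcoeffM_neq0[m1 [m2 [/hp h1 /hq h2 ->]]]; rewrite mweightD ltrD.
Qed.
Lemma wt_gtMeq c c' p q : wt_gt c p -> wt_eq c' q -> wt_gt (c + c') (p * q).
Proof.
by move=> hp hq m /mcoeffM_neq0[m1 [m2 [/hp h1 /hq <- ->]]]; rewrite mweightD ltrD2r.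
Qed.

Lemma wt_eqX m : wt_eq (wt m) 'X_[m].
Proof. by move=> m'; rewrite mcoeffX; case: (m =P m') => [->//|_]; rewrite eqxx. Qed.

Lemma wt_eq_gt c p : wt_eq c p -> wt_gt c p -> p = 0.
Proof.
move=> h1 h2; apply/mpolyP => m; rewrite mcoeff0; apply/eqP/contraT => hm.
by have := h2 m hm; rewrite (h1 m hm) ltxx.
Qed.

Lemma initial_form_coeff f m : (initial_form om f)@_m =
  if all (fun m' => wt m <= wt m') (msupp f) then f@_m else 0.
Proof.
rewrite /initial_form raddf_sum /=.
under eq_bigr => m' _ do rewrite mcoeffZ mcoeffX.
case: (boolP (m \in msupp f)) => hm; last first.
  rewrite big1_seq => [|m' /andP[_ hm']]; first by rewrite memN_msupp_eq0 // if_same.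
  by case: eqP hm hm' => [->|_ _ _]; [move=> /negPf->|rewrite mulr0].
rewrite big_mkcond (bigD1_seq m) //= eqxx mulr1 big1 ?addr0 // => m' hm'.
by rewrite (negPf hm') mulr0 if_same.
Qed.

Lemma initial_formE p q c : p != 0 -> wt_eq c p -> wt_gt c q -> initial_form om (p + q) = p.
Proof.
move=> p0 hp hq; apply/(mpolyP (initial_form om (p + q)) p) => m; rewrite initial_form_coeff.
have ge m' : (p + q)@_m' != 0 -> c <= wt m'.
  by move=> /mcoeffD_neq0[/hp->//|/hq/ltW].
have pc m' : wt m' = c -> q@_m' = 0.
  by move=> e; apply/eqP/contraT => /hq; rewrite e ltxx.
have [m1 hm1] : exists m1, p@_m1 != 0.
  by exists (mlead p); rewrite -mcoeff_msupp mlead_supp.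
have hm1' : (p + q)@_m1 != 0 by rewrite mcoeffD (pc _ (hp _ hm1)) addr0.
case: (eqVneq (wt m) c) => [mc|mc].
  have -> : all (fun m' => wt m <= wt m') (msupp (p + q)).
    by apply/allP => m'; rewrite mcoeff_msupp mc; exact: ge.
  by rewrite mcoeffD (pc _ mc) addr0.
have -> : p@_m = 0 by apply/eqP/contraT => /hp e; rewrite e eqxx in mc.
case: ifP => // /allP h; apply/eqP/contraT => /ge.
have := h m1; rewrite mcoeff_msupp hm1' (hp _ hm1) => /(_ isT) h1 h2.
by rewrite eq_le h1 h2 in mc.
Qed.

Lemma initial_form_split f : exists c, wt_eq c (initial_form om f) /\
  wt_gt c (f - initial_form om f).
Proof.
case: (eqVneq f 0) => [->|f0].
  exists 0; have -> : initial_form om (0 : {mpoly K[L]}) = 0.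
    by apply/mpolyP => m; rewrite initial_form_coeff mcoeff0 if_same.
  by split; [exact: wt_eq0|rewrite subrr; exact: wt_gt0].
have [m1 hm1] : exists m1, m1 \in msupp f by exists (mlead f); rewrite mlead_supp.
have [m0 m0f min] : exists2 m0, m0 \in msupp f & forall m, m \in msupp f -> wt m0 <= wt m.
  elim: (msupp f) m1 hm1 => [//|a s IH] _ _.
  case: s IH => [_|b s IH].
    by exists a; rewrite ?mem_head // => m; rewrite inE => /eqP->.
  have [m0 m0s m0min] := IH b (mem_head _ _).
  case: (leP (wt a) (wt m0)) => [am|/ltW am].
    exists a; rewrite ?mem_head // => m; rewrite inE => /orP[/eqP->//|/m0min].
    exact: le_trans.
  exists m0; first by rewrite inE m0s orbT.
  by move=> m; rewrite inE => /orP[/eqP->//|/m0min].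
exists (wt m0); split=> m; rewrite ?mcoeffB initial_form_coeff.
  case: ifP; rewrite ?eqxx // => /allP/(_ _ m0f) h; rewrite -mcoeff_msupp => /min h'.
  by apply/eqP; rewrite eq_le h h'.
case: ifP => [_|/negbT/allPn[m' /min h1]]; first by rewrite subrr eqxx.
by rewrite -ltNge => h2 _; apply: le_lt_trans h2.
Qed.

Local Notation F := (ratfun K L).
Local Notation "p %:F" := (tofrac p : F).

(** The rational function y is q plus terms of weight larger than c, and q is
    homogeneous of weight c. Both are Laurent polynomials, with a monomial of
    exponent d as a common denominator. *)
Definition lead c (y q : F) : Prop := exists d (N Q : {mpoly K[L]}),
  [/\ y * 'X_[d]%:F = N%:F, q * 'X_[d]%:F = Q%:F, wt_eq (c + wt d) Q &
      wt_gt (c + wt d) (N - Q)].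

Lemma monX_neq0 d : 'X_[d]%:F != 0.
Proof.
rewrite tofrac_eq0; apply/eqP => /mpolyP/(_ d)/eqP.
by rewrite mcoeffX mcoeff0 eqxx oner_eq0.
Qed.

Lemma leadM c c' (y y' q q' : F) : lead c y q -> lead c' y' q' -> lead (c + c') (y * y') (q * q').
Proof.
move=> [d [N [Q [e1 e2 h1 h2]]]] [d' [N' [Q' [e1' e2' h1' h2']]]].
have wE : c + c' + wt (d + d')%MM = (c + wt d) + (c' + wt d') by rewrite mweightD addrACA.
exists (d + d')%MM, (N * N'), (Q * Q'); split.
- by rewrite mpolyXD rmorphM mulrACA e1 e1' rmorphM.
- by rewrite mpolyXD rmorphM mulrACA e2 e2' rmorphM.
- by rewrite wE; apply: wt_eqM.
have -> : N * N' - Q * Q' = (N - Q) * (N' - Q') + (N - Q) * Q' + (N' - Q') * Q by ring.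
rewrite wE; apply: wt_gtD; first by apply: wt_gtD; [exact: wt_gtM|exact: wt_gtMeq].
by rewrite addrC; apply: wt_gtMeq.
Qed.

Lemma leadD c (y y' q q' : F) : lead c y q -> lead c y' q' -> lead c (y + y') (q + q').
Proof.
move=> [d [N [Q [e1 e2 h1 h2]]]] [d' [N' [Q' [e1' e2' h1' h2']]]].
have wE : c + wt (d + d')%MM = (c + wt d) + wt d' by rewrite mweightD addrA.
have wE' : c + wt (d + d')%MM = (c + wt d') + wt d by rewrite mweightD [wt d + _]addrC addrA.
exists (d + d')%MM, (N * 'X_[d'] + N' * 'X_[d]), (Q * 'X_[d'] + Q' * 'X_[d]); split.
- by rewrite mpolyXD !rmorphD !rmorphM /= -e1 -e1'; ring.
- by rewrite mpolyXD !rmorphD !rmorphM /= -e2 -e2'; ring.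
- apply: wt_eqD; first by rewrite wE; apply: wt_eqM => //; exact: wt_eqX.
  by rewrite wE'; apply: wt_eqM => //; exact: wt_eqX.
rewrite opprD addrACA -!mulrBl.
apply: wt_gtD; first by rewrite wE; apply: wt_gtMeq => //; exact: wt_eqX.
by rewrite wE'; apply: wt_gtMeq => //; exact: wt_eqX.
Qed.

Lemma lead_lt c c' (y q : F) : c' < c -> lead c y q -> lead c' y 0.
Proof.
move=> lt [d [N [Q [e1 e2 h1 h2]]]]; exists d, N, 0; rewrite mul0r rmorph0 subr0; split=> //.
  exact: wt_eq0.
have lt' : c' + wt d < c + wt d by rewrite ltrD2r.
rewrite -(subrK Q N); apply: wt_gtD => m; last by move/h1->.
by move/h2; apply: lt_trans.
Qed.

Lemma lead0_eq0 c (q : F) : lead c 0 q -> q = 0.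
Proof.
move=> [d [N [Q [e1 e2 h1 h2]]]].
have N0 : N = 0.
  by move: e1; rewrite mul0r => /esym/eqP; rewrite tofrac_eq0 => /eqP.
have Q0 : Q = 0.
  apply: (wt_eq_gt h1) => m hm; apply: h2; rewrite N0 sub0r mcoeffN oppr_eq0 //.
by move: e2; rewrite Q0 rmorph0 => /eqP; rewrite mulf_eq0 (negPf (monX_neq0 d)) orbF => /eqP.
Qed.

Lemma lead_mon d : lead (wt d) 'X_[d]%:F 'X_[d]%:F.
Proof.
exists 0%MM, 'X_[d], 'X_[d]; rewrite mpolyX0 rmorph1 mulr1; split=> //.
  have -> : wt 0%MM = 0 by rewrite /mweight big1 // => i _; rewrite mnm0E mul0r.
  by rewrite addr0; exact: wt_eqX.
by rewrite subrr; exact: wt_gt0.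
Qed.

Lemma lead_const (k : K) : lead 0 (k%:MP)%:F (k%:MP)%:F.
Proof.
exists 0%MM, k%:MP, k%:MP; rewrite mpolyX0 rmorph1 mulr1; split=> //.
  move=> m; rewrite mcoeffC; case: (m =P 0%MM) => [->|_]; last by rewrite mulr0 eqxx.
  by rewrite add0r.
by rewrite subrr; exact: wt_gt0.
Qed.

Lemma leadZ c (k : K) (y q : F) : lead c y q -> lead c (k *: y) (k *: q).
Proof. by move=> h; rewrite -[c]add0r; exact: leadM (lead_const k) h. Qed.

Lemma lead1 : lead 0 1 1.
Proof. by have := lead_const 1; rewrite mpolyC1 rmorph1. Qed.

Lemma lead0 c : lead c 0 0.
Proof.
exists 0%MM, 0, 0; rewrite mul0r rmorph0 subr0; split=> //; first exact: wt_eq0.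
exact: wt_gt0.
Qed.

Lemma lead_divX c (y q : F) i : lead c (y * ('X_i)%:F) (q * ('X_i)%:F) -> lead (c - om i) y q.
Proof.
move=> [d [N [Q [e1 e2 h1 h2]]]]; exists (U_(i) + d)%MM, N, Q.
have wE : c - om i + wt (U_(i) + d)%MM = c + wt d.
  by rewrite mweightD mweightU addrA subrK.
by rewrite mpolyXD rmorphM /= !mulrA wE.
Qed.
End Weights.

(** * Plane vectors with prescribed determinants along a triangulation *)

Section Ptolemy.
Variables (n : nat) (T : {set {set 'I_n}}).
Hypothesis T_tri : triangulation T.
Hypothesis n_gt2 : (2 < n)%N.
Variables (F : fieldType).
Implicit Types i j k l p q r s : 'I_n.
Implicit Types u v : F * F.

Definition det2 u v : F := u.1 * v.2 - u.2 * v.1.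

Variable xi : 'I_n -> 'I_n -> F.
Hypothesis xi_neq0 : forall i j, is_arc T i j -> xi i j != 0.

(** Proceed from triangle to triangle. Given the vectors at the ends of pq, two
    determinants determine the vector of the third vertex r. *)
Lemma det2_interval p q u v : is_arc T p q -> (p < q)%N -> det2 u v = xi p q ->
  exists vec : 'I_n -> F * F, [/\ vec p = u, vec q = v &
    forall i j, is_arc T i j -> (p <= i)%N -> (i < j)%N -> (j <= q)%N -> det2 (vec i) (vec j) = xi i j].
Proof.
have [m] := ubnP (q - p); elim: m p q u v => // m IH p q u v hm pq lt uv.
case: (pselect (exists x, cyc3 p x q)) => [[x /(arc_triangle T_tri pq)[r [prq pr rq]]]|nx].
  have lt1 : (p < r)%N by clear -lt prq; order_solve.
  have lt2 : (r < q)%N by clear -lt prq; order_solve.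
  have x0 := xi_neq0 pq.
  (* The combination of u and v with the prescribed determinants against both.
     *)
  pose w := ((xi p r * v.1 + xi r q * u.1) / xi p q, (xi p r * v.2 + xi r q * u.2) / xi p q).
  have uw : det2 u w = xi p r.
    by rewrite /det2 /=; move: x0; rewrite -uv /det2 => x0; field.
  have wv : det2 w v = xi r q.
    by rewrite /det2 /=; move: x0; rewrite -uv /det2 => x0; field.
  have m1 : (r - p < m)%N by clear -hm lt1 lt2; lia.
  have m2 : (q - r < m)%N by clear -hm lt1 lt2; lia.
  have [v1 [v1p v1r h1]] := IH _ _ _ _ m1 pr lt1 uw.
  have [v2 [v2r v2q h2]] := IH _ _ _ _ m2 rq lt2 wv.
  exists (fun x : 'I_n => if (x <= r)%N then v1 x else v2 x); split.
  - by rewrite ltnW.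
  - by rewrite leqNgt lt2.
  move=> i j ij pi lij jq; case: (leqP j r) => jr.
    by rewrite (leq_trans (ltnW lij) jr) h1.
  case: (ltnP r i) => ri; first by rewrite h2 // ltnW.
  case: (eqVneq i r) => [iE|ir].
    by rewrite iE v1r -v2r h2 ?leqnn // -iE.
  have ip : i = p.
    by have := arc_cross T_tri pr ij; clear -pi lij jq jr ri ir lt1 lt2; order_solve.
  have jE : j = q.
    by have := arc_cross T_tri ij rq; clear -pi lij jq jr ri ir lt1 lt2; order_solve.
  by rewrite ip jE v1p v2q.
exists (fun x : 'I_n => if x == p then u else v); rewrite eqxx; split=> //.
  by rewrite ifN // neq_ltn lt orbT.
move=> i j ij pi lij jq.
have nz z : cyc3 p z q = false by apply/negbTE/negP => h; apply: nx; exists z.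
have ip : i = p by have := nz i; clear -pi lij jq lt; order_solve.
have jE : j = q by have := nz j; clear -pi lij jq lt; order_solve.
by rewrite ip jE eqxx ifN // neq_ltn lt orbT.
Qed.

Lemma det2_exists : exists vec : 'I_n -> F * F,
  forall i j, is_arc T i j -> (i < j)%N -> det2 (vec i) (vec j) = xi i j.
Proof.
have h0 : (0 < n)%N by lia.
have h1 : (n.-1 < n)%N by lia.
pose p0 := Ordinal h0; pose p1 := Ordinal h1.
have lt : (p0 < p1)%N by rewrite /=; lia.
have e : is_arc T p0 p1 by apply: arc_root => //; rewrite ord_neqE ltn_eqF.
have uv : det2 (1, 0) (0, xi p0 p1) = xi p0 p1 by rewrite /det2 /= mul1r mul0r subr0.
have [vec [_ _ h]] := det2_interval e lt uv.
exists vec => i j ij lij; apply: h => //.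
by have := ltn_ord j; rewrite /=; lia.
Qed.

(** Determinants taken up to sign, so as to be symmetric: then the Pluecker
    relations read as Ptolemy relations. *)
Definition ptol (vec : 'I_n -> F * F) i j : F :=
  if (i < j)%N then det2 (vec i) (vec j) else det2 (vec j) (vec i).

Lemma ptol_sym vec i j : ptol vec i j = ptol vec j i.
Proof. by rewrite /ptol; case: ltngtP => // /ord_inj->. Qed.

Lemma ptol_rel_lin vec i j k l : (i < j)%N -> (j < k)%N -> (k < l)%N ->
  ptol vec i k * ptol vec j l = ptol vec i j * ptol vec k l + ptol vec i l * ptol vec j k.
Proof.
move=> ij jk kl; rewrite /ptol ij jk kl (ltn_trans ij jk) (ltn_trans jk kl).
by rewrite (ltn_trans ij (ltn_trans jk kl)) /det2; ring.
Qed.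

(** A Ptolemy relation is invariant under cyclic rotation, which reduces it to
    the linear order. *)
Lemma ptol_rel vec i j k l : cyc4 i j k l ->
  ptol vec i k * ptol vec j l = ptol vec i j * ptol vec k l + ptol vec i l * ptol vec j k.
Proof.
move=> c.
have : [|| (i < j) && (j < k) && (k < l), (j < k) && (k < l) && (l < i),
  (k < l) && (l < i) && (i < j) | (l < i) && (i < j) && (j < k)]%N.
  by clear -c; order_solve.
case/or4P => /andP[/andP[h1 h2] h3]; have := ptol_rel_lin vec h1 h2 h3 => //.
- by rewrite mulrC (ptol_sym vec k i) (ptol_sym vec l i) (ptol_sym vec j i) => ->; ring.
- by rewrite (ptol_sym vec k i) (ptol_sym vec l j) (ptol_sym vec l i) (ptol_sym vec k j) => ->; ring.
- by rewrite mulrC (ptol_sym vec l j) (ptol_sym vec l i) (ptol_sym vec l k) => ->; ring.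
Qed.

End Ptolemy.

Section PlueckerPoint.
Variables (K : fieldType) (n L : nat) (vec : 'I_n -> ratfun K L * ratfun K L).

Lemma pl_eval_pl i j : pl_eval (ptol vec) (pl K i j) = det2 (vec i) (vec j).
Proof.
case: (ltngtP i j) => ij.
- by rewrite pl_lt // pl_eval_pla // /ptol ij.
- have -> : pl K i j = - pla K j i.
    have h : ((j, i).1 < (j, i).2)%N by [].
    have e : insub (j, i) = Some (Sub (j, i) h : pl_index n) by rewrite insubT.
    by rewrite -pl_lt // /pl e insubF //= ltnNge ltnW.
  by rewrite rmorphN /= pl_eval_pla // /ptol ij /det2 /=; ring.
rewrite (ord_inj ij) /pl insubF ?ltnn // rmorph0 /det2; ring.
Qed.

Lemma pl_ideal_eval f : @pl_ideal K n f -> pl_eval (ptol vec) f = 0.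
Proof.
move=> If; have {If} : f \in in_ideal_gen _ := asboolT If.
apply: ideal_gen_ker => {}f [i [j [k [l [_ ->]]]]].
rewrite rmorphD rmorphB !rmorphM /= !pl_eval_pl /det2; ring.
Qed.
End PlueckerPoint.

(** * Leading parts of arc variables *)

Section ClusterMonomials.
Variables (K : fieldType) (n : nat) (T : {set {set 'I_n}}).
Hypothesis T_tri : triangulation T.
Local Notation V := (arc_of T).
Local Notation L := #|{: V + V}|.
Local Notation F := (ratfun K L).
Implicit Types i j k l p q : 'I_n.
Implicit Types v : {ffun V -> int}.

Definition cvar (a : V) : F := ratfunX K (enum_rank (inl a : V + V)).

Lemma cvar_neq0 a : cvar a != 0.
Proof. exact: monX_neq0. Qed.

(** Laurent monomials in the initial variables. *)
Definition cmon v : F := \prod_a cvar a ^ v a.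

Lemma cmonD v v' : cmon (v + v') = cmon v * cmon v'.
Proof.
rewrite /cmon -big_split /=; apply: eq_bigr => a _.
by rewrite ffunE expfzDr ?cvar_neq0.
Qed.

Lemma cmon0 : cmon 0 = 1.
Proof. by rewrite /cmon big1 // => a _; rewrite ffunE expr0z. Qed.

Lemma cmon_sum (I : Type) (r : seq I) (G : I -> {ffun V -> int}) :
  cmon (\sum_(i <- r) G i) = \prod_(i <- r) cmon (G i).
Proof. exact: (big_morph cmon cmonD cmon0). Qed.

Lemma cmonMn v m : cmon (v *+ m) = cmon v ^+ m.
Proof. by elim: m => [|m IH]; rewrite ?cmon0 // mulrS cmonD IH exprS. Qed.

(** The value 1 outside T keeps the function invertible everywhere. *)
Definition arc_var i j : F := if insub [set i; j] is Some a then cvar a else 1.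

Lemma arc_var_neq0 i j : arc_var i j != 0.
Proof. by rewrite /arc_var; case: insubP => [a _ _|_]; [exact: cvar_neq0|exact: oner_neq0]. Qed.

Lemma arc_varE (a : V) i j : val a = [set i; j] -> arc_var i j = cvar a.
Proof. by rewrite /arc_var => <-; rewrite valK. Qed.

Lemma arc_of_is_arc i j : is_arc T i j -> exists a : V, val a = [set i; j].
Proof. by move=> ij; exists (Sub [set i; j] ij). Qed.

Variable g : 'I_n -> 'I_n -> {ffun V -> int}.
Hypothesis g_add : tree_additive T g.
Hypothesis g_arc : forall i j, is_arc T i j -> g i j = fvec T int [set i; j].

Lemma cmon_arc i j : is_arc T i j -> cmon (g i j) = arc_var i j.
Proof.
move=> ij; have [a aE] := arc_of_is_arc ij.
rewrite (g_arc ij) (arc_varE aE) /cmon (bigD1 a) //= big1 => [|b ba].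
  by rewrite /fvec ffunE aE eqxx expr1z mulr1.
by rewrite /fvec ffunE -aE (inj_eq val_inj) (negPf ba) expr0z.
Qed.

Section LeadArcs.
Variables (R : realDomainType) (om : 'I_L -> R) (y : 'I_n -> 'I_n -> F) (s : 'I_n -> 'I_n -> R).
Hypothesis y_sym : forall i j, y i j = y j i.
Hypothesis y_arc : forall i j, is_arc T i j -> y i j = arc_var i j.
Hypothesis s_add : tree_additive T s.
Hypothesis s_arc : forall (a : V) i j, val a = [set i; j] -> s i j = om (enum_rank (inl a : V + V)).
Local Notation lead := (lead om).
Hypothesis y_rel : forall i j k l, cyc4 i j k l -> sep T i j k l -> exists r,
  y i k * y j l = y i j * y k l + r /\
  (lead (s i l) (y i l) (cmon (g i l)) -> lead (s j k) (y j k) (cmon (g j k)) ->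
   lead (s i k + s j l) r 0).

Lemma lead_arc_div i j p q : is_arc T p q ->
  lead (s i j + s p q) (y i j * y p q) (cmon (g i j) * cmon (g p q)) ->
  lead (s i j) (y i j) (cmon (g i j)).
Proof.
move=> pq; have [a aE] := arc_of_is_arc pq.
rewrite (s_arc aE) (y_arc pq) (cmon_arc pq) (arc_varE aE) => h.
by have := lead_divX h; rewrite addrK.
Qed.

(** Follow the induction on crossings with T. In y_ij y_pq = y_ip y_jq + y_pj
    y_iq, with pq in T, the term selected by the tree has leading part x^(g_ij +
    g_pq) and the other one is negligible; then divide by the variable y_pq. *)
Lemma lead_arcs i j : i != j -> lead (s i j) (y i j) (cmon (g i j)).
Proof.
have [ssym sadd] := s_add; have [gsym gadd] := g_add.
move: i j; apply: (arc_ind T_tri).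
- by move=> p q; rewrite ssym y_sym gsym.
- move=> p q pq; have [a aE] := arc_of_is_arc pq.
  rewrite (s_arc aE) (y_arc pq) (cmon_arc pq) (arc_varE aE).
  by rewrite -[om _]mweightU; exact: lead_mon.
move=> i p j q c pq h1 h2 h3 h4; apply: (lead_arc_div pq).
case: (boolP (sep T i p j q)) => sp.
  have [r [e hr]] := y_rel c sp.
  have c' : cyc4 p j q i by clear -c; order_solve.
  have sp' : ~~ sep T p j q i by rewrite (sep_excl T_tri c sp).
  have se : s i j + s p q = s i p + s j q.
    by rewrite addrC (ssym i j) sadd // (ssym p i).
  have ge : g i j + g p q = g i p + g j q.
    by rewrite addrC (gsym i j) gadd // (gsym p i).
  rewrite e -cmonD ge cmonD -[X in lead _ _ X]addr0; apply: leadD; last exact: hr.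
  by rewrite se; apply: leadM.
have c' : cyc4 p j q i by clear -c; order_solve.
have sp' : sep T p j q i by have := sep_or T_tri c; rewrite (negPf sp).
have [r [e hr]] := y_rel c' sp'.
have se : s i j + s p q = s p j + s q i.
  by rewrite sadd // addrC (ssym i q).
have ge : g i j + g p q = g p j + g q i.
  by rewrite gadd // addrC (gsym i q).
rewrite mulrC (y_sym i j) e -cmonD ge cmonD -[X in lead _ _ X]addr0; apply: leadD.
  by rewrite se; apply: leadM => //; rewrite (ssym q i) (y_sym q i) (gsym q i).
rewrite (ssym i j) addrC; apply: hr => //.
by rewrite (ssym p i) (y_sym p i) (gsym p i).
Qed.

Definition mon_weight (m : 'X_{1..#|pl_index n|}) : R :=
  \sum_u (expo m u)%:R * s (src u) (tgt u).

Lemma leadX c (z z' : F) (e : nat) : lead c z z' -> lead (e%:R * c) (z ^+ e) (z' ^+ e).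
Proof.
move=> h; elim: e => [|e IH]; first by rewrite mul0r; exact: lead1.
by rewrite !exprS mulrSr mulrDl mul1r addrC; exact: leadM.
Qed.

Lemma lead_pl_evalX m :
  lead (mon_weight m) (pl_eval y 'X_[m]) (pl_eval (fun i j => cmon (g i j)) 'X_[m]).
Proof.
rewrite !pl_evalX /mon_weight; pose P (c : R) (z z' : F) := lead c z z'.
apply: (big_ind3 P) => [|c1 c2 c3 c4 c5 c6|u _]; rewrite /P.
- exact: lead1.
- exact: leadM.
by apply: leadX; apply: lead_arcs; exact: pl_neq.
Qed.

Lemma lead_pl_eval_eq c (f : pl_ring K n) : (forall m, f@_m != 0 -> mon_weight m = c) ->
  lead c (pl_eval y f) (pl_eval (fun i j => cmon (g i j)) f).
Proof.
move=> h; rewrite (mpolyE f) !raddf_sum /=.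
rewrite big_seq [X in lead _ _ X]big_seq; pose P (z z' : F) := lead c z z'.
apply: (big_ind2 P) => [|c1 c2 c3 c4|m]; rewrite /P; [exact: lead0|exact: leadD|].
rewrite mcoeff_msupp => /h <-; rewrite !pl_evalZ; exact: leadZ (lead_pl_evalX m).
Qed.

Lemma lead_pl_eval_gt c (f : pl_ring K n) : (forall m, f@_m != 0 -> c < mon_weight m) ->
  lead c (pl_eval y f) 0.
Proof.
move=> h; rewrite (mpolyE f) !raddf_sum /= big_seq; pose P (z : F) := lead c z 0.
apply: (big_ind P) => [|c1 c2 h1 h2|m]; rewrite /P; first exact: lead0.
  by rewrite -[X in lead _ _ X]addr0; exact: leadD.
rewrite mcoeff_msupp => /h lt; rewrite pl_evalZ.
exact: lead_lt lt (leadZ _ (lead_pl_evalX m)).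
Qed.
End LeadArcs.
End ClusterMonomials.

(** * The initial ideal *)

Section InitialIdeal.
Variables (K : fieldType) (n : nat) (T : {set {set 'I_n}}).
Hypothesis T_tri : triangulation T.
Hypothesis n_gt2 : (2 < n)%N.
Local Notation V := (arc_of T).
Local Notation L := #|{: V + V}|.
Local Notation F := (ratfun K L).
Local Notation S := (pl_ring K n).
Implicit Types i j k l p q : 'I_n.

(** The morphism p_ij |-> x^(g_ij). *)
Definition geval : S -> F := pl_eval (fun i j => cmon K (gvec T int i j)).
HB.instance Definition _ := GRing.RMorphism.on geval.

Lemma gevalX m : geval 'X_[m] = cmon K (gsum T (expo m)).
Proof.
rewrite /geval pl_evalX /gsum cmon_sum; apply: eq_bigr => u _.
exact/esym/cmonMn.
Qed.

Definition xmon (e : V -> nat) : 'X_{1..L} :=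
  [multinom (if enum_val v is inl a then e a else 0%N) | v < L].

Lemma xmonE (e : V -> nat) a : xmon e (enum_rank (inl a : V + V)) = e a.
Proof. by rewrite mnmE enum_rankK. Qed.

Lemma cmon_nat (v : {ffun V -> int}) (e : V -> nat) : (forall a, v a = (e a)%:Z) ->
  cmon K v = tofrac 'X_[xmon e].
Proof.
move=> h; rewrite mpolyXE_id rmorph_prod /=.
rewrite (reindex (@enum_rank (V + V)%type)) /=; last first.
  by exists enum_val => u _; rewrite ?enum_rankK ?enum_valK.
rewrite big_sumType /= [X in _ * X]big1 => [|a _]; last first.
  by rewrite mnmE enum_rankK expr0 rmorph1.
rewrite mulr1; apply: eq_bigr => a _.
rewrite xmonE h.
rewrite [RHS]rmorphXn.
by [].
Qed.

(** The monomials of r have distinct images. *)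
Lemma geval_inj r : nc_supported r -> geval r = 0 -> r = 0.
Proof.
move=> nc r0; pose G m := gsum T (expo m).
pose D a := (\sum_(m <- msupp r) absz (G m a))%N.
(* Multiplication by the monomial of exponent Dv clears all denominators. *)
pose Dv : {ffun V -> int} := [ffun a => (D a)%:Z].
pose e m a := absz (G m a + (D a)%:Z).
have eE m a : m \in msupp r -> (G m + Dv) a = (e m a)%:Z.
  move=> mr; rewrite !ffunE /e gez0_abs //.
  have : (absz (G m a) <= D a)%N by rewrite /D (big_rem m) //= leq_addr.
  by clear; lia.
have E0 : \sum_(m <- msupp r) r@_m *: 'X_[xmon (e m)] = 0 :> {mpoly K[L]}.
  apply/eqP; rewrite -tofrac_eq0 rmorph_sum /=; apply/eqP.
  transitivity (geval r * cmon K Dv); last by rewrite r0 mul0r.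
  have -> : geval r = \sum_(m <- msupp r) r@_m *: cmon K (G m).
    rewrite {1}(mpolyE r) rmorph_sum; apply: eq_bigr => m _.
    by rewrite -gevalX; exact: pl_evalZ.
  rewrite mulr_suml big_seq [RHS]big_seq.
  apply: eq_bigr => m mr /=.
  rewrite -scalerAl -cmonD (cmon_nat (eE m ^~ mr)).
  by rewrite -mul_mpolyC rmorphM.
apply/mpolyP => m0; rewrite mcoeff0; apply/eqP/contraT => hm0.
have m0r : m0 \in msupp r by rewrite mcoeff_msupp.
have := congr1 (mcoeff (xmon (e m0))) E0.
rewrite raddf_sum /= mcoeff0 (bigD1_seq m0) //= mcoeffZ mcoeffX eqxx mulr1.
rewrite big1_seq ?addr0 => [h|m /andP[mm0 mr]]; first by rewrite h eqxx in hm0.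
rewrite mcoeffZ mcoeffX; case: eqP => [xe|_]; last by rewrite mulr0.
suff /(gsum_inj T_tri n_gt2) ee : gsum T (expo m) = gsum T (expo m0).
  case/eqP: mm0; apply/mnmP => v; have /= := ee (nc m _) (nc m0 hm0) (enum_val v).
  rewrite /expo enum_valK; apply; by rewrite -mcoeff_msupp.
apply: (addIr Dv); apply/ffunP => a; rewrite !eE //.
by rewrite -(xmonE (e m) a) xe xmonE.
Qed.

Lemma geval_binomial f : tree_binomial T f -> geval f = 0.
Proof.
have [gsym gadd] := gvec_additive T_tri n_gt2 int.
apply: tree_binomial_eval => [i j|i j k l c sp]; first by rewrite gsym.
by rewrite -!cmonD gadd.
Qed.

Lemma geval_ker f : geval f = 0 <-> f \in in_ideal_gen (tree_binomial (K := K) T).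
Proof. exact: (tree_kernel T_tri geval_binomial geval_inj). Qed.

Lemma wt_eqN (R : realDomainType) (N : nat) (om : 'I_N -> R) c (p : {mpoly K[N]}) :
  wt_eq om c p -> wt_eq om c (- p).
Proof. by move=> h m; rewrite mcoeffN oppr_eq0; exact: h. Qed.

Section BinomialInitial.
Variables (R : realDomainType) (s : 'I_n -> 'I_n -> R) (om : 'I_#|pl_index n| -> R).
Hypothesis s_om : forall u, om (enum_rank u) = s (src u) (tgt u).
Hypothesis s_add : tree_additive T s.
Hypothesis s_lt : forall i j k l, cyc4 i j k l -> sep T i j k l ->
  s i k + s j l < s i l + s j k.

Lemma wt_pla i j : (i < j)%N -> wt_eq om (s i j) (pla K i j).
Proof.
move=> /pl_index_of[u [<- <-]]; rewrite plaE.
have -> : s (src u) (tgt u) = mweight om U_(enum_rank u)%MM by rewrite mweightU s_om.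
exact: wt_eqX.
Qed.

Lemma pla_mul_neq i j k l i' j' k' l' : (i < j)%N -> (k < l)%N -> (i' < j')%N -> (k' < l')%N ->
  (i, j) != (i', j') -> (i, j) != (k', l') ->
  pla K i j * pla K k l - pla K i' j' * pla K k' l' != 0.
Proof.
move=> /pl_index_of[u [<- <-]] /pl_index_of[v [<- <-]].
move=> /pl_index_of[u' [<- <-]] /pl_index_of[v' [<- <-]] ne1 ne2.
rewrite !plaE -!mpolyXD; apply/eqP => /(congr1 (mcoeff (U_(enum_rank u) + U_(enum_rank v))%MM)).
rewrite mcoeffB !mcoeffX eqxx mcoeff0; case: eqP => [/mnmP/(_ (enum_rank u))|_].
  rewrite !mnmDE !mnm1E eqxx !(inj_eq enum_rank_inj).
  have -> : (u' == u) = false by apply: contraNF ne1 => /eqP->.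
  by have -> : (v' == u) = false by apply: contraNF ne2 => /eqP->.
by rewrite subr0 => /eqP; rewrite oner_eq0.
Qed.

(** In the Pluecker relation of i, j, k, l, the two terms paired by the tree
    have equal weights, and the third term is heavier. *)
Lemma binomial_initial f : tree_binomial T f ->
  f \in in_ideal_gen (initial_forms om (@pl_ideal K n)).
Proof.
move=> [i [j [k [l [[ij jk kl] h]]]]].
have [ik jl il] : [/\ (i < k)%N, (j < l)%N & (i < l)%N].
  by rewrite (ltn_trans ij jk) (ltn_trans jk kl) (ltn_trans ij (ltn_trans jk kl)).
have c : cyc4 i j k l by clear -ij jk kl; order_solve.
have c' : cyc4 j k l i by clear -ij jk kl; order_solve.
pose P : S := pl K i j * pl K k l - pl K i k * pl K j l + pl K i l * pl K j k.
have PI : @pl_ideal K n P.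
  by apply: (@asboolW (ideal_gen _ P)); apply: ideal_gen_sub; exists i, j, k, l.
rewrite -ideal_genN; apply: ideal_gen_sub; exists P => //; rewrite /P !pl_lt //.
have [ssym sadd] := s_add.
have wM (a b a' b' : 'I_n) : (a < b)%N -> (a' < b')%N ->
    wt_eq om (s a b + s a' b') (pla K a b * pla K a' b').
  by move=> ab ab'; apply: wt_eqM; apply: wt_pla.
have neij (a b a' b' : 'I_n) : (a != a') || (b != b') -> (a, b) != (a', b') :> 'I_n * 'I_n.
  by rewrite xpair_eqE negb_and.
case: h => -[sp ->].
  have sp' : sep T j k l i by have := sep_or T_tri c; rewrite (negPf sp).
  have -> : pla K i j * pla K k l - pla K i k * pla K j l + pla K i l * pla K j k =
    - (pla K i k * pla K j l - pla K i l * pla K j k) + pla K i j * pla K k l by ring.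
  apply: (@initial_formE _ _ _ _ _ _ (s i k + s j l)).
  - rewrite oppr_eq0; apply: pla_mul_neq => //; apply: neij.
      by clear -kl; order_solve.
    by clear -ij; order_solve.
  - apply: wt_eqN; apply: wt_eqD; first exact: wM.
    by apply: wt_eqN; rewrite sadd //; exact: wM.
  move=> m /(wM _ _ _ _ ij kl) ->; have := s_lt c' sp'.
  by rewrite (ssym k i) (ssym j i) [s j l + _]addrC.
have sp' : sep T i j k l.
  by have := sep_or T_tri c; rewrite (negPf sp) orbF.
have -> : pla K i j * pla K k l - pla K i k * pla K j l + pla K i l * pla K j k =
  - (pla K i k * pla K j l - pla K i j * pla K k l) + pla K i l * pla K j k by ring.
apply: (@initial_formE _ _ _ _ _ _ (s i k + s j l)).
- rewrite oppr_eq0; apply: pla_mul_neq => //; apply: neij.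
    by clear -jk; order_solve.
  by clear -ik; order_solve.
- apply: wt_eqN; apply: wt_eqD; first exact: wM.
  apply: wt_eqN; have := sadd _ _ _ _ c' sp; rewrite (ssym k i) (ssym j i) addrC => ->.
  exact: wM.
by move=> m /(wM _ _ _ _ il jk) ->; exact: s_lt.
Qed.

Lemma mweight_mon m : mweight om m = mon_weight s m.
Proof.
rewrite /mweight /mon_weight (reindex (@enum_rank (pl_index n))) /=; last first.
  by exists enum_val => u _; rewrite ?enum_rankK ?enum_valK.
by apply: eq_bigr => u _; rewrite s_om.
Qed.
End BinomialInitial.

Variables (R : realDomainType) (w : {ffun V -> R} -> R).
Hypothesis wD : forall u v, w (u + v) = w u + w v.
Hypothesis w_quad : quadrilateral_weight w.

Let s i j : R := w (gvec T R i j).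

Let s_add : tree_additive T s.
Proof.
have [gsym gadd] := gvec_additive T_tri n_gt2 R.
by split=> [i j|i j k l c sp]; rewrite /s ?(gsym i j) // -!wD gadd.
Qed.

Let s_lt i j k l : cyc4 i j k l -> sep T i j k l -> s i k + s j l < s i l + s j k.
Proof.
apply: (tree_additive_lt T_tri s_add) => a b c d c4 ab bc cd ad ac.
rewrite /s !(gvec_arc T_tri n_gt2) // -!wD; apply: w_quad => //.
by apply/and5P.
Qed.

Let s_om u : pl_weight w (enum_rank u) = s (src u) (tgt u).
Proof. by rewrite /pl_weight enum_rankK. Qed.

(** For f in the Pluecker ideal, evaluate f at determinants y_ij whose leading
    parts are x^(g_ij): the value 0 has the evaluation of the initial form at
    x^(g_ij) as its leading part. *)
Lemma initial_ideal f : f \in in_ideal_gen (initial_forms (pl_weight w) (@pl_ideal K n)) <->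
  f \in in_ideal_gen (tree_binomial (K := K) T).
Proof.
split; apply: ideal_gen_le => {f}; last exact: (binomial_initial s_om s_add s_lt).
move=> _ [f If <-]; apply/geval_ker.
have [vec vecE] := det2_exists T_tri n_gt2 (fun i j _ => arc_var_neq0 K T i j).
pose om (v : 'I_L) : R := if enum_val v is inl a then w (fvec T R (val a)) else 0.
pose y := ptol vec.
have y_arc i j : is_arc T i j -> y i j = arc_var K T i j.
  move=> ij; rewrite /y /ptol; case: ltngtP => h.
  - exact: vecE.
  - by rewrite vecE //; [rewrite /arc_var finset.setUC|rewrite arc_sym].
  - by have := arc_neq T_tri ij; rewrite ord_neqE h eqxx.
have s_arc (a : V) i j : val a = [set i; j] -> s i j = om (enum_rank (inl a : V + V)).
  move=> aE; rewrite /om enum_rankK aE /s (gvec_arc T_tri n_gt2) // /is_arc -aE.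
  exact: valP.
have y_rel i j k l : cyc4 i j k l -> sep T i j k l -> exists r,
    y i k * y j l = y i j * y k l + r /\
    (lead om (s i l) (y i l) (cmon K (gvec T int i l)) ->
     lead om (s j k) (y j k) (cmon K (gvec T int j k)) ->
     lead om (s i k + s j l) r 0).
  move=> c sp; exists (y i l * y j k); split; first exact: ptol_rel.
  by move=> h1 h2; apply: lead_lt (s_lt c sp) _; exact: leadM h1 h2.
have g_add := gvec_additive T_tri n_gt2 int.
have g_arc i j := gvec_arc T_tri n_gt2 int (i := i) (j := j).
have wtE := mweight_mon s_om.
have [c [h1 h2]] := initial_form_split (pl_weight w) f.
set P := initial_form _ f in h1 h2 *.
have l1 := lead_pl_eval_eq T_tri g_add g_arc (ptol_sym vec) y_arc s_add s_arc y_rel (f := P)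
  (fun m hm => etrans (esym (wtE m)) (h1 m hm)).
have h2' m : (f - P)@_m != 0 -> c < mon_weight s m by rewrite -wtE; exact: h2.
have l2 := lead_pl_eval_gt T_tri g_add g_arc (ptol_sym vec) y_arc s_add s_arc y_rel h2'.
have := leadD l1 l2; rewrite addr0 -rmorphD addrC subrK /= (pl_ideal_eval vec If).
exact: lead0_eq0.
Qed.
End InitialIdeal.

(** * The semigroup algebra *)

Section MonoidAlg.
Variables (K : comNzRingType) (M : nmodType).
Implicit Types (k : M) (g : monoid_alg K M).

Definition mexp k : monoid_alg K M := monalg.mkmalgU k 1.

Lemma mexpD k k' : mexp (k + k') = mexp k * mexp k'.
Proof. by rewrite /mexp [RHS]mon_mulUU mul1r. Qed.

Lemma mexp0 : mexp 0 = 1. Proof. by []. Qed.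

Lemma mexp_sum (I : Type) (r : seq I) (G : I -> M) :
  mexp (\sum_(i <- r) G i) = \prod_(i <- r) mexp (G i).
Proof. exact: (big_morph mexp mexpD mexp0). Qed.

Lemma mexpMn k m : mexp (k *+ m) = mexp k ^+ m.
Proof. by elim: m => [|m IH]; rewrite ?mulr0n ?mexp0 ?expr0 // mulrS mexpD IH exprS. Qed.

(** The coefficient as a function on the algebra, so that the lemmas on additive
    maps apply to it. *)
Definition mcf k : monoid_alg K M -> K := monalg.mcoeff k.
Fact mcf_additive k : additive (mcf k).
Proof. by move=> g g'; apply: monalg.mcoeffB. Qed.
HB.instance Definition _ k := GRing.isAdditive.Build (monoid_alg K M) K (mcf k) (mcf_additive k).

Lemma mcfZ k c g : mcf k (c *: g) = c * mcf k g.
Proof. exact: monalg.mcoeffZ. Qed.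

Lemma mcf_mexp k k' : mcf k' (mexp k) = (k == k')%:R.
Proof. exact: monalg.mcoeffU. Qed.

Lemma monoid_algE g : g = \sum_(k <- monalg.msupp g) monalg.mcoeff k g *: mexp k.
Proof.
rewrite [LHS]monalg.monalgE; apply: eq_bigr => k _; apply/monalg.malgP => k'.
by rewrite monalg.mcoeffZ !monalg.mcoeffU mulrnAr mulr1.
Qed.
End MonoidAlg.

Section SemigroupAlgebra.
Variables (K : fieldType) (n : nat) (T : {set {set 'I_n}}).
Hypothesis T_tri : triangulation T.
Hypothesis n_gt2 : (2 < n)%N.
Local Notation V := (arc_of T).
Local Notation S := (pl_ring K n).
Local Notation B := (monoid_alg K (gsemigroup T)).
Implicit Types i j k l p q : 'I_n.

(** For i = j the vector g_ii need not belong to the semigroup; the default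
    value is then 0. *)
Definition gelt i j : gsemigroup T := insubd (0 : gsemigroup T) (gvec T int i j).

Lemma val_gelt i j : i != j -> val (gelt i j) = gvec T int i j.
Proof.
have [gsym _] := gvec_additive T_tri n_gt2 int.
move=> ij; apply: insubdK; apply/asboolP; apply: submonoid_gen_in.
move: ij; rewrite ord_neqE neq_ltn => /orP[lt|lt]; first by exists i, j.
by exists j, i; split.
Qed.

Definition semi_eval : S -> B := pl_eval (fun i j => mexp K (gelt i j) : B).
HB.instance Definition _ := GRing.RMorphism.on semi_eval.

Lemma semi_evalX m : semi_eval 'X_[m] = mexp K (\sum_(u : pl_index n) gelt (src u) (tgt u) *+ expo m u).
Proof.
rewrite /semi_eval pl_evalX mexp_sum; apply: eq_bigr => u _.
exact/esym/mexpMn.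
Qed.

Lemma semi_evalZ c f : semi_eval (c *: f) = c *: semi_eval f.
Proof. exact: pl_evalZ. Qed.

Lemma val_semi m : val (\sum_(u : pl_index n) gelt (src u) (tgt u) *+ expo m u) = gsum T (expo m).
Proof.
rewrite raddf_sum; apply: eq_bigr => u _.
by rewrite raddfMn /= val_gelt ?pl_neq.
Qed.

Lemma semi_binomial f : tree_binomial T f -> semi_eval f = 0.
Proof.
have [gsym gadd] := gvec_additive T_tri n_gt2 int.
apply: tree_binomial_eval => [i j|i j k l c sp].
  by rewrite /gelt gsym.
have valD (x y : gsemigroup T) : val (x + y) = val x + val y := raddfD _ x y.
have [/val_gelt ik /val_gelt jl] : i != k /\ j != l by split; clear -c; order_solve.
have [/val_gelt il /val_gelt jk] : i != l /\ j != k by split; clear -c; order_solve.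
have e : gelt i k + gelt j l = gelt i l + gelt j k.
  apply: val_inj; rewrite !valD.
  exact: (etrans (congr2 +%R ik jl) (etrans (gadd i j k l c sp) (esym (congr2 +%R il jk)))).
have h := mexpD K (gelt i l) (gelt j k).
by rewrite -e (mexpD K (gelt i k) (gelt j l)) in h; exact h.
Qed.

Lemma semi_inj r : nc_supported r -> semi_eval r = 0 -> r = 0.
Proof.
move=> nc r0; apply/mpolyP => m0; rewrite mcoeff0; apply/eqP/contraT => hm0.
have m0r : m0 \in msupp r by rewrite mcoeff_msupp.
pose G m := \sum_(u : pl_index n) gelt (src u) (tgt u) *+ expo m u.
have mc m : mcf (G m0) (semi_eval (r@_m *: 'X_[m])) = r@_m * (G m == G m0)%:R.
  by rewrite semi_evalZ semi_evalX mcfZ mcf_mexp.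
have E0 : \sum_(m <- msupp r) semi_eval (r@_m *: 'X_[m]) = 0.
  by move: r0; rewrite {1}(mpolyE r) rmorph_sum.
have := congr1 (mcf (G m0)) E0.
rewrite raddf_sum. rewrite raddf0. rewrite (eq_bigr _ (fun m _ => mc m)).
rewrite (bigD1_seq m0 m0r (msupp_uniq r)). rewrite /= eqxx mulr1.
rewrite big1_seq ?addr0 => [h|m /andP[mm0 mr]]; first by rewrite h eqxx in hm0.
case: eqP => [/(congr1 val)|_]; last by rewrite mulr0.
rewrite !val_semi => /(gsum_inj T_tri n_gt2) ee.
case/eqP: mm0; apply/mnmP => v; have /= := ee (nc m _) (nc m0 hm0) (enum_val v).
by rewrite /expo enum_valK; apply; rewrite -mcoeff_msupp.
Qed.

Lemma semi_ker f : semi_eval f = 0 <-> f \in in_ideal_gen (tree_binomial (K := K) T).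
Proof. exact: (tree_kernel T_tri semi_binomial semi_inj). Qed.

Local Notation G := [set v : {ffun V -> int} |
  exists i j, (i < j)%N /\ v = gvec T int i j]%classic.

Lemma semi_surj_mexp v : submonoid_gen G v ->
  forall h : gsemigroup T, val h = v -> exists f, semi_eval f = mexp K h.
Proof.
elim=> {v} [v [i [j [ij ->]]]||u v hu IHu hv IHv] h hE.
- exists (pla K i j); apply: etrans (pl_eval_pla (fun i j => mexp K (gelt i j) : B) ij) _.
  have nij : i != j by rewrite ord_neqE ltn_eqF.
  by congr mexp; apply: val_inj; exact: (etrans (val_gelt nij) (esym hE)).
- exists 1; rewrite rmorph1 -mexp0; congr mexp; apply: val_inj.
  by rewrite hE raddf0.
have [f fE] := IHu (Submonoid (asboolT hu)) erefl.
have [f' f'E] := IHv (Submonoid (asboolT hv)) erefl.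
have hD : h = Submonoid (asboolT hu) + Submonoid (asboolT hv).
  by apply: val_inj; rewrite hE raddfD.
exists (f * f'); apply: etrans (rmorphM _ f f') _; rewrite hD mexpD.
exact: (congr2 *%R fE f'E).
Qed.

Lemma semi_surj (b : B) : exists f, semi_eval f = b.
Proof.
rewrite (monoid_algE b); elim: (enum_fset _) => [|h s [f IH]].
  by exists 0; rewrite rmorph0 big_nil.
have [f' f'E] := semi_surj_mexp (asboolW (valP h)) erefl.
exists (mcf h b *: f' + f); apply: etrans (rmorphD _ _ _) _; rewrite big_cons.
apply: etrans (congr2 +%R (semi_evalZ _ _) IH) _; rewrite f'E //.
Qed.
End SemigroupAlgebra.

(** * Isomorphisms of Proj and of quotient algebras *)

(** The inverse is carried along, because it is what transports primes and
    sections. *)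
Record graded_iso (K : pzRingType) (A B : gradedAlg K) (f : A -> B) (g : B -> A) : Prop :=
  GradedIso {
  giK : cancel f g;
  giK' : cancel g f;
  giD : {morph f : x y / x + y};
  giM : {morph f : x y / x * y};
  gi1 : f 1 = 1;
  giZ : forall c x, f (gscale c x) = gscale c (f x);
  gi_comp : forall d x, gcomp d x <-> gcomp d (f x) }.

Lemma graded_iso_sym (K : pzRingType) (A B : gradedAlg K) (f : A -> B) (g : B -> A) :
  graded_iso f g -> graded_iso g f.
Proof.
case=> fK gK fD fM f1 fZ fc; split=> //.
- by move=> x y; rewrite -{1}(gK x) -{1}(gK y) -fD fK.
- by move=> x y; rewrite -{1}(gK x) -{1}(gK y) -fM fK.
- by rewrite -f1 fK.
- by move=> c x; rewrite -{1}(gK x) -fZ fK.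
- by move=> d x; rewrite -{1}(gK x) -fc.
Qed.

Section ProjTransport.
Variables (K : pzRingType) (A B : gradedAlg K) (f : A -> B) (g : B -> A).
Hypothesis fg : graded_iso f g.
Local Open Scope classical_set_scope.

Let fK := giK fg. Let gK := giK' fg. Let fD := giD fg. Let fM := giM fg.
Let f1 := gi1 fg. Let fZ := giZ fg. Let fc := gi_comp fg.
Let gf := graded_iso_sym fg.
Let gD := giD gf. Let gM := giM gf. Let g1 := gi1 gf. Let gc := gi_comp gf.

Lemma gi_0 : f 0 = 0.
Proof. by apply: (addIr (f 0)); rewrite -fD !add0r. Qed.
Lemma gi_N : {morph f : x / - x}.
Proof. by move=> x; apply: (addIr (f x)); rewrite -fD !addNr gi_0. Qed.
Lemma gi_g0 : g 0 = 0. Proof. by rewrite -gi_0 fK. Qed.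

Lemma gi_sum (s : seq A) : f (\sum_(x <- s) x) = \sum_(y <- map f s) y.
Proof. by rewrite big_map; exact: (big_morph f fD gi_0). Qed.

Lemma gi_homog x : homogeneous x <-> homogeneous (f x).
Proof. by split=> -[d]; [rewrite fc|rewrite -fc]; exists d. Qed.

Lemma proj_prime_image (p : set A) : proj_prime p -> proj_prime (fun y => p (g y)).
Proof.
case=> p0 pD pMl p1 pM ph pr; split.
- by rewrite gi_g0.
- by move=> x y; rewrite gD; exact: pD.
- by move=> x y; rewrite gM; exact: pMl.
- by rewrite g1.
- by move=> x y; rewrite gM; exact: pM.
- move=> x /ph[s sp e]; exists (map f s).
    by move=> y /mapP[z /sp[hz pz] ->]; rewrite fK -gi_homog.
  by rewrite -gi_sum -e gK.
- case: pr => d [y [d0 yd ny]]; exists d, (f y); split=> //; first by rewrite -fc.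
  by rewrite fK.
Qed.

Definition proj_image (p : Proj A) : Proj B := exist _ _ (proj_prime_image (svalP p)).

Lemma proj_imageE p y : sval (proj_image p) y = sval p (g y). Proof. by []. Qed.

Lemma zariski_preimage (V : set (Proj B)) : zariski_open V -> zariski_open (proj_image @^-1` V).
Proof.
case=> E Eh VE; exists [set x | E (f x)]; first by move=> x /Eh; rewrite -gi_homog.
move=> p; rewrite /preimage /= VE; split=> [[y Ey ny]|[x Ex nx]].
  by exists (g y) => //=; rewrite gK.
by exists (f x) => //; rewrite proj_imageE fK.
Qed.

(** A fraction is a set of pairs, hence transported by pulling back pairs. *)
Lemma hfrac_image p a b (u : A * A) :
  hfrac (proj_image p) (f a) (f b) (f u.1, f u.2) <-> hfrac p a b u.
Proof.
rewrite /hfrac /=; split=> -[[d [h1 h2]] nu [h [hh nh e]]]; split.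
- by exists d; rewrite !fc.
- by rewrite fK in nu.
- exists (g h); split=> //; first by rewrite gi_homog gK.
  by apply: (can_inj fK); rewrite fM gK fD gi_N !fM gi_0.
- by exists d; rewrite -!fc.
- by rewrite fK.
- exists (f h); split; [by rewrite -gi_homog|by rewrite fK|].
  by rewrite -!fM -gi_N -fD -fM e gi_0.
Qed.

Definition psec_pull (s : psection B) : psection A :=
  fun p => [set u | s (proj_image p) (f u.1, f u.2)].

Lemma sheaf_pull V s : structure_sheaf V s -> structure_sheaf (proj_image @^-1` V) (psec_pull s).
Proof.
case=> s0 sl; split=> [p nVp|p Vp].
  by apply/seteqP; split=> u //; rewrite /psec_pull /= s0.
have [W [Wo Wp WV [d [a [b [ad bd h]]]]]] := sl _ Vp.
exists (proj_image @^-1` W); split=> //; first exact: zariski_preimage.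
  by move=> q; exact: WV.
exists d, (g a), (g b); split; [exact: (gc d a).1|exact: (gc d b).1|].
move=> q Wq.
have [nb sE] := h _ Wq; split; first exact: nb.
apply/predeqP => u; rewrite /psec_pull /= sE.
by have := hfrac_image q (g a) (g b) u; rewrite !gK.
Qed.

Lemma psec_pull_add s t : psec_pull (psec_add s t) = psec_add (psec_pull s) (psec_pull t).
Proof.
apply/funext => p; apply/predeqP => u; rewrite /psec_pull /psec_add /=.
split=> [[v [w [sv tw h]]]|[v [w [sv tw h]]]].
  exists (g v.1, g v.2), (g w.1, g w.2); rewrite /= !gK -!surjective_pairing; split=> //.
  by apply/hfrac_image; rewrite fD !fM !gK.
exists (f v.1, f v.2), (f w.1, f w.2); split=> //=.
by rewrite -!fM -fD; apply/hfrac_image.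
Qed.

Lemma psec_pull_mul s t : psec_pull (psec_mul s t) = psec_mul (psec_pull s) (psec_pull t).
Proof.
apply/funext => p; apply/predeqP => u; rewrite /psec_pull /psec_mul /=.
split=> [[v [w [sv tw h]]]|[v [w [sv tw h]]]].
  exists (g v.1, g v.2), (g w.1, g w.2); rewrite /= !gK -!surjective_pairing; split=> //.
  by apply/hfrac_image; rewrite !fM !gK.
exists (f v.1, f v.2), (f w.1, f w.2); split=> //=.
by rewrite -!fM; apply/hfrac_image.
Qed.

Lemma psec_pull_scale c s : psec_pull (psec_scale c s) = psec_scale c (psec_pull s).
Proof.
apply/funext => p; apply/predeqP => u; rewrite /psec_pull /psec_scale /=.
split=> [[v sv h]|[v sv h]].
  exists (g v.1, g v.2); rewrite /= ?gK -?surjective_pairing //.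
  by apply/hfrac_image; rewrite fZ !gK.
by exists (f v.1, f v.2) => //=; rewrite -fZ; apply/hfrac_image.
Qed.

Lemma psec_pull_one V : psec_pull (psec_one V) = psec_one (proj_image @^-1` V).
Proof.
apply/funext => p; apply/predeqP => u; rewrite /psec_pull /psec_one /= -f1.
by split=> -[h1 h2]; split=> //; apply/hfrac_image.
Qed.
End ProjTransport.

Lemma proj_imageK (K : pzRingType) (A B : gradedAlg K) (f : A -> B) (g : B -> A)
    (fg : graded_iso f g) (gf : graded_iso g f) :
  cancel (proj_image fg) (proj_image gf).
Proof.
case=> p pp; apply: eq_exist; apply/funext => x /=.
by rewrite (giK fg).
Qed.

Lemma graded_iso_proj (K : pzRingType) (A B : gradedAlg K) (f : A -> B) (g : B -> A) :
  graded_iso f g -> proj_isomorphic A B.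
Proof.
move=> fg; have gf := graded_iso_sym fg.
have phiK := proj_imageK fg gf; have psiK := proj_imageK gf fg.
exists (proj_image fg), (fun _ => psec_pull fg); split.
- by exists (proj_image gf).
- move=> V; split; first exact: zariski_preimage.
  move=> /(zariski_preimage gf); congr zariski_open.
  by apply/predeqP => q; rewrite /preimage /= psiK.
move=> V Vo /=; split.
- split.
  + by move=> s; exact: sheaf_pull.
  + move=> s t _ _ e; apply/funext => q; apply/predeqP => u.
    have := congr1 (fun s => s (proj_image gf q) (g u.1, g u.2)) e.
    by rewrite /psec_pull /= psiK !(giK gf) -surjective_pairing => ->.
  + move=> t tO; exists (psec_pull gf t).
      have := sheaf_pull gf tO; congr (structure_sheaf _ _).
      by apply/predeqP => q; rewrite /preimage /= psiK.
    apply/funext => p; apply/predeqP => u; rewrite /psec_pull /=.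
    by rewrite phiK !(giK fg) -surjective_pairing.
- by move=> s t _ _; exact: psec_pull_add.
- by move=> s t _ _; exact: psec_pull_mul.
- by split=> [c s _|]; [exact: psec_pull_scale|exact: psec_pull_one].
- by move=> W s _ _ _; apply/funext => p; apply/predeqP => u.
Qed.

Section QuotientIso.
Variables (K : comNzRingType) (A : comAlgType K) (E : set A).
Variables (B : comPzRingType) (sc : K -> B -> B) (th : A -> B).
Hypothesis thD : {morph th : x y / x + y}.
Hypothesis thM : {morph th : x y / x * y}.
Hypothesis th1 : th 1 = 1.
Hypothesis thZ : forall c x, th (c *: x) = sc c (th x).
Hypothesis th_ker : forall x, th x = 0 <-> x \in in_ideal_gen E.
Hypothesis th_surj : forall b, exists x, th x = b.

(** The isomorphism induced by a surjective morphism whose kernel is the ideal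
    generated by E. It is stated with bare operations because the target, itself
    a quotient, might be the zero ring. *)
Definition quot_map (u : quot_alg E) : B := th (repr u).

Lemma quot_mapE x : quot_map (quot_proj E x) = th x.
Proof.
have := repr_quot E x; rewrite -th_ker /quot_map; set r := repr _ => e.
by rewrite -[RHS]add0r -e -thD subrK.
Qed.

Lemma quot_mapD : {morph quot_map : u v / u + v}.
Proof.
move=> u v; have [x ->] := quot_proj_surj u; have [y ->] := quot_proj_surj v.
by rewrite -quot_projD !quot_mapE thD.
Qed.

Lemma quot_mapM : {morph quot_map : u v / u * v}.
Proof.
move=> u v; have [x ->] := quot_proj_surj u; have [y ->] := quot_proj_surj v.
by rewrite [_ * _]quot_mulE !quot_mapE thM.
Qed.

Lemma quot_map1 : quot_map 1 = 1. Proof. by rewrite quot_mapE th1. Qed.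

Lemma quot_mapZ c u : quot_map (c *: u) = sc c (quot_map u).
Proof.
have [x ->] := quot_proj_surj u.
by rewrite [_ *: _]quot_scaleE !quot_mapE thZ.
Qed.

Lemma quot_map_bij : bijective quot_map.
Proof.
have th0 : th 0 = 0 by apply: (addIr (th 0)); rewrite -thD !add0r.
have thN x : th (- x) = - th x by apply: (addIr (th x)); rewrite -thD !addNr.
have gP b : th (sval (cid (th_surj b))) = b by case: cid.
exists (fun b => quot_proj E (sval (cid (th_surj b)))) => [u|b].
  have [x ->] := quot_proj_surj u; apply/quot_projP/th_ker.
  by rewrite thD thN gP quot_mapE addrN.
by rewrite quot_mapE gP.
Qed.
End QuotientIso.

(** * Seeds labelled by triangulations *)

(** The entries of the exchange matrices are -1, 0 or 1. Writing them as
    differences of two booleans turns mutation into a boolean computation. *)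
Definition signed (p q : bool) : int := p%:R - q%:R.

Lemma signedN p q : - signed p q = signed q p.
Proof. by rewrite opprB. Qed.

Lemma sg_max_signed p q r s : Num.sg (signed p q) * Num.max (signed p q * signed r s) 0 =
  signed (p && ~~ q && (r && ~~ s)) (q && ~~ p && (s && ~~ r)).
Proof. by case: p; case: q; case: r; case: s. Qed.

Lemma signedD p q p1 q1 p2 q2 :
  ((p2 == p && ~~ q1 || p1 && ~~ q) && (q2 == q && ~~ p1 || q1 && ~~ p)) ->
  ~~ (p && p1) -> ~~ (q && q1) ->
  signed p q + signed p1 q1 = signed p2 q2.
Proof. by case: p; case: q; case: p1; case: q1; case: p2; case: q2. Qed.

Lemma joins_set n (p q x y : 'I_n) : ([set p; q] == [set x; y]) = joins p q x y.
Proof.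
apply/eqP/idP => [/set2_eq[[-> ->]|[-> ->]]|]; rewrite /joins ?eqxx ?orbT //.
by case/orP => /andP[/eqP/ord_inj -> /eqP/ord_inj ->] //; rewrite setUC.
Qed.

Lemma joins_eq n (p q x y : 'I_n) : joins p q x y -> (p = x /\ q = y) \/ (p = y /\ q = x).
Proof.
by case/orP => /andP[/eqP/ord_inj -> /eqP/ord_inj ->]; [left|right].
Qed.

Section Labels.
Variables (n : nat) (V : finType) (L : V -> 'I_n * 'I_n) (ep : V -> 'I_n * 'I_n).
Implicit Types a b c d i j : 'I_n.

(** The pair L v consists of the ends of the arc that labels v in the current
    triangulation, and ep v of the ends of v itself, in the initial one. *)
Definition lab v a b := joins (L v).1 (L v).2 a b.
Definition labelled a b := exists v, lab v a b.
(** The arc v turned by half a step separates a from b and c from d;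
    equivalently, for a, b, c, d in cyclic order, v joins [a, b) to [c, d). This
    is the exponent of t_v in the exchange relations. *)
Definition beta v a b c d : bool :=
  (hsep (ep v).1 (ep v).2 a (+) hsep (ep v).1 (ep v).2 b) &&
  (hsep (ep v).1 (ep v).2 c (+) hsep (ep v).1 (ep v).2 d).
Definition colpos a b c d (u : V + V) : bool :=
  match u with inl v => lab v b c || lab v d a | inr v => beta v a b c d end.
(** The column of the exchange matrix for the diagonal ac of a quadrilateral a b
    c d: its sides, taken with alternating signs, and the difference of the
    exponents of the two coefficients. *)
Definition column a b c d u : int := signed (colpos a b c d u) (colpos b c d a u).

(** The quadrilateral a b c d around the arc labelling k, together with its
    column in the exchange matrix. *)
Definition quad (col : V + V -> int) k a b c d : Prop :=
  [/\ cyc4 a b c d, lab k a c,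
     [/\ labelled a b, labelled b c, labelled c d & labelled d a] &
     forall u, col u = column a b c d u].

Lemma labC v a b : lab v a b = lab v b a.
Proof. by rewrite /lab /joins orbC. Qed.

Lemma betaC v a b c d : beta v a b c d = beta v c d a b.
Proof. by rewrite /beta andbC. Qed.

Lemma column_rot a b c d u : column a b c d u = column c d a b u.
Proof. by case: u => v; rewrite /column /colpos; [rewrite orbC [X in signed _ X]orbC|rewrite betaC (betaC v b)]. Qed.

Lemma quad_rot col k a b c d : quad col k a b c d -> quad col k c d a b.
Proof.
move=> [c4 ac [h1 h2 h3 h4] colE]; split=> //; first by clear -c4; order_solve.
  by rewrite labC.
by move=> u; rewrite column_rot.
Qed.
End Labels.

Section SeedLabels.
Variables (n : nat) (T : {set {set 'I_n}}).
Hypothesis T_tri : triangulation T.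
Local Notation V := (arc_of T).
Variables (F : fieldType) (X : 'I_n -> 'I_n -> F) (t : V -> F) (ep : V -> 'I_n * 'I_n).
Hypothesis epE : forall v, val v = [set (ep v).1; (ep v).2].
Hypothesis X_sym : forall i j, X i j = X j i.
Hypothesis X_neq0 : forall i j, i != j -> X i j != 0.
Hypothesis X_rel : forall i j k l, cyc4 i j k l ->
  X i k * X j l = (\prod_(v | beta ep v j k l i) t v) * (X i j * X k l) +
                  (\prod_(v | beta ep v i j k l) t v) * (X i l * X j k).
Implicit Types a b c d i j : 'I_n.
Implicit Types (L : V -> 'I_n * 'I_n) (s : seed F V).

(** The seed s is given by a triangulation: the variables are the x_ij of its
    arcs, and the columns are read off from the quadrilaterals. The labels are
    kept as pairs of vertices, so that statements on them are decided by
    comparisons. *)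
Record seed_lab s L : Prop := SeedLab {
  sl_neq : forall v, (L v).1 != (L v).2;
  sl_inj : forall v w, lab L v (L w).1 (L w).2 -> v = w;
  sl_nc : forall v w, crosses (L v).1 (L v).2 (L w).1 (L w).2 = false;
  sl_max : forall i j, i != j -> (forall v, crosses i j (L v).1 (L v).2 = false) ->
    labelled L i j;
  sl_frozen : forall v, frozen v -> L v = ep v;
  sl_var : forall v, s.1 (inl v) = X (L v).1 (L v).2;
  sl_coef : forall v, s.1 (inr v) = t v;
  sl_quad : forall k, ~~ frozen k ->
    exists a b c d, quad L ep (fun u => s.2 u k) k a b c d }.

Lemma ep_neq v : (ep v).1 != (ep v).2.
Proof. by apply: (arc_neq T_tri); rewrite /is_arc -epE; exact: valP. Qed.

Lemma frozen_cross v i j : frozen v -> crosses i j (ep v).1 (ep v).2 = false.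
Proof.
rewrite /frozen => /imsetP[u _]; rewrite epE => /eqP; rewrite joins_set => h.
by have := cyc3_ordS u i; have := cyc3_ordS u j; clear -h; order_solve.
Qed.

Lemma lab_nc s L v a b : seed_lab s L -> labelled L a b -> crosses (L v).1 (L v).2 a b = false.
Proof. by move=> sL [w]; rewrite /lab => wl; have := sl_nc sL v w; move: wl; clear; order_solve. Qed.

Lemma lab_uniq s L v w a b : seed_lab s L -> lab L v a b -> lab L w a b -> v = w.
Proof. by rewrite /lab => sL h1 h2; apply: (sl_inj sL); rewrite /lab; clear -h1 h2; order_solve. Qed.

Section Flip.
Variables (s : seed F V) (L : V -> 'I_n * 'I_n) (k : V) (a b c d : 'I_n).
Hypothesis sL : seed_lab s L.
Hypothesis kq : quad L ep (fun u => s.2 u k) k a b c d.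

Section NewQuad.
Variables (L' : V -> 'I_n * 'I_n).
Hypothesis L'k : lab L' k b d.
Hypothesis L'v : forall v, v != k -> L' v = L v.

Lemma flip_c4 : cyc4 a b c d. Proof. by case: kq. Qed.
Lemma flip_ac : lab L k a c. Proof. by case: kq. Qed.

(** An arc crossing bd but no side of the quadrilateral must be ac. *)
Lemma flip_diag v : crosses (L v).1 (L v).2 b d -> v = k.
Proof.
case: kq => c4 kac [/(lab_nc v sL) h1 /(lab_nc v sL) h2 /(lab_nc v sL) h3 /(lab_nc v sL) h4] _ h.
apply: (sl_inj sL); move: kac; rewrite /lab; clear -c4 h1 h2 h3 h4 h; order_solve.
Qed.

Lemma flip_labelled x y : labelled L x y -> ~~ lab L k x y -> labelled L' x y.
Proof.
move=> [v vl] nk; have vk : v != k by apply: contraNneq nk => <-.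
by exists v; rewrite /lab L'v.
Qed.

Lemma flip_lab_side v x y : v != k -> lab L v x y -> lab L' k x y = false.
Proof.
move=> vk vl; apply/negbTE/negP => kl.
have c4 := flip_c4.
have xy : crosses x y a c = false.
  have h := sl_nc sL v k; move: vl flip_ac; rewrite /lab => vl kac.
  by clear -h vl kac; order_solve.
have bd : joins b d x y.
  by move: kl L'k; rewrite /lab; clear; order_solve.
by clear -c4 xy bd; order_solve.
Qed.

Lemma mutate_col_k u : (mutate s k).2 u k = - s.2 u k.
Proof. by rewrite /= /mutate_matrix eqxx orbT. Qed.

Lemma mutate_col_inl (j : V) : j != k -> (mutate s k).2 (inl k) j = - s.2 (inl k) j.
Proof. by rewrite /= /mutate_matrix eqxx. Qed.

Lemma mutate_col u (j : V) : j != k -> u != inl k -> (mutate s k).2 u j =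
  s.2 u j + Num.sg (s.2 u k) * Num.max (s.2 u k * s.2 (inl k) j) 0.
Proof. by move=> /negPf jk /negPf uk; rewrite /= /mutate_matrix uk jk. Qed.

Lemma flip_quad_disjoint (j : V) a' b' c' d' : j != k ->
  quad L ep (fun u => s.2 u j) j a' b' c' d' ->
  ~~ lab L k a' b' -> ~~ lab L k b' c' -> ~~ lab L k c' d' -> ~~ lab L k d' a' ->
  quad L' ep (fun u => (mutate s k).2 u j) j a' b' c' d'.
Proof.
move=> jk [c4' jac [h1 h2 h3 h4] colE] n1 n2 n3 n4; split=> //.
- by rewrite /lab L'v.
- by split; apply: flip_labelled.
have kE : s.2 (inl k) j = 0.
  by rewrite colE /column /= (negPf n1) (negPf n2) (negPf n3) (negPf n4).
have side (x y : 'I_n) : labelled L x y -> ~~ lab L k x y -> lab L' k x y = false.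
  by case=> v vl nk; apply: (flip_lab_side (v := v)) => //; apply: contraNneq nk => <-.
move=> u; case: (u =P inl k) => [->|/eqP uk].
  by rewrite mutate_col_inl // kE /column /= !side.
rewrite mutate_col // kE mulr0 maxxx mulr0 addr0 colE.
case: u uk => v // vk; rewrite /column /= /lab L'v //.
Qed.

Lemma k_col u : s.2 u k = column L ep a b c d u. Proof. by case: kq. Qed.

Lemma flip_nac v : v != k -> joins (L v).1 (L v).2 a c = false.
Proof. by move=> vk; apply: contraNF vk => h; apply/eqP/(lab_uniq sL h flip_ac). Qed.

(** The triangle d a c of the quadrilateral of j becomes d b c when ac is
    flipped to bd. Mutation adds the positive part of column k, that is, the
    sides bc and da and the coefficient beta of a b c d. *)
Lemma flip_quad_next (j : V) d' : j != k -> quad L ep (fun u => s.2 u j) j d a c d' ->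
  quad L' ep (fun u => (mutate s k).2 u j) j d b c d'.
Proof.
move=> jk [c4' jdc [h1 h2 h3 h4] colE]; have c4 := flip_c4; have kac := flip_ac.
case: (kq) => _ _ [k1 k2 k3 k4] _.
have nk (x y : 'I_n) : ~~ joins a c x y -> lab L k x y = false.
  by move: kac; rewrite /lab => h h'; apply/negbTE; clear -h h'; order_solve.
have c4n : cyc4 d b c d' by clear -c4 c4'; order_solve.
split=> //.
- by rewrite /lab L'v.
- split; first by exists k; rewrite labC.
  + by apply: flip_labelled => //; rewrite nk //; clear -c4; order_solve.
  + by apply: flip_labelled => //; rewrite nk //; clear -c4 c4'; order_solve.
  + by apply: flip_labelled => //; rewrite nk //; clear -c4 c4'; order_solve.
have kE : s.2 (inl k) j = signed true false.
  rewrite colE /column /= kac (nk d' d) 1?(nk c d') 1?(nk d a) //; clear -c4 c4'; order_solve.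
move=> u; case: (u =P inl k) => [->|/eqP uk].
  rewrite mutate_col_inl // kE signedN /column; congr signed; apply/esym => /=.
    by move: L'k; rewrite /lab; clear -c4 c4'; order_solve.
  by rewrite [lab L' k d b]labC L'k orbT.
rewrite mutate_col // kE k_col /column sg_max_signed colE /column.
case: u uk => v uk /=.
  have vk : v != k by apply: contraNneq uk => ->.
  have v1 := lab_nc v sL (ex_intro _ k kac); have v2 := flip_nac vk; have vd := sl_neq sL v.
  apply: signedD; rewrite /lab ?L'v //; clear -c4 c4' v1 v2 vd; order_solve.
apply: signedD; rewrite /beta; clear -c4 c4'; order_solve.
Qed.

(** The case where the flipped diagonal ac precedes the diagonal of j in their
    common triangle; mutation now adds the negative part of column k. *)
Lemma flip_quad_prev (j : V) d' : j != k -> quad L ep (fun u => s.2 u j) j a c d d' ->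
  quad L' ep (fun u => (mutate s k).2 u j) j a b d d'.
Proof.
move=> jk [c4' jdc [h1 h2 h3 h4] colE]; have c4 := flip_c4; have kac := flip_ac.
case: (kq) => _ _ [k1 k2 k3 k4] _.
have nk (x y : 'I_n) : ~~ joins a c x y -> lab L k x y = false.
  by move: kac; rewrite /lab => h h'; apply/negbTE; clear -h h'; order_solve.
have c4n : cyc4 a b d d' by clear -c4 c4'; order_solve.
split=> //.
- by rewrite /lab L'v.
- split; last first.
  + by apply: flip_labelled => //; rewrite nk //; clear -c4 c4'; order_solve.
  + by apply: flip_labelled => //; rewrite nk //; clear -c4 c4'; order_solve.
  + by exists k.
  + by apply: flip_labelled => //; rewrite nk //; clear -c4; order_solve.
have kE : s.2 (inl k) j = signed false true.
  rewrite colE /column /= kac (nk d' a) 1?(nk d d') 1?(nk c d) //; clear -c4 c4'; order_solve.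
move=> u; case: (u =P inl k) => [->|/eqP uk].
  rewrite mutate_col_inl // kE signedN /column; congr signed; apply/esym => /=.
    by rewrite L'k.
  by move: L'k; rewrite /lab; clear -c4 c4'; order_solve.
rewrite mutate_col // kE k_col /column sg_max_signed colE /column.
case: u uk => v uk /=.
  have vk : v != k by apply: contraNneq uk => ->.
  have v1 := lab_nc v sL (ex_intro _ k kac); have v2 := flip_nac vk; have vd := sl_neq sL v.
  apply: signedD; rewrite /lab ?L'v //; clear -c4 c4' v1 v2 vd; order_solve.
apply: signedD; rewrite /beta; clear -c4 c4'; order_solve.
Qed.

End NewQuad.
End Flip.

(** Two triangles on the same side of ac would cross. *)
Lemma third_vertex s L a c x y : seed_lab s L -> cyc3 a c x -> cyc3 a c y ->
  labelled L c x -> labelled L x a -> labelled L c y -> labelled L y a -> x = y.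
Proof.
move=> sL ax ay [v1 h1] [v2 h2] cy ya; move: h1 h2; rewrite /lab => h1 h2.
have n1 := lab_nc v1 sL ya; have n2 := lab_nc v2 sL cy.
clear -n1 n2 h1 h2 ax ay; order_solve.
Qed.

(** Up to rotating the two quadrilaterals by two steps, either they share no
    triangle, or the diagonal of one is a side of the other in one of the two
    positions above. *)
Lemma flip_quad s L L' k a b c d (j : V) a' b' c' d' : seed_lab s L ->
  quad L ep (fun u => s.2 u k) k a b c d ->
  lab L' k b d -> (forall v, v != k -> L' v = L v) -> j != k ->
  quad L ep (fun u => s.2 u j) j a' b' c' d' ->
  exists a'' b'' c'' d'', quad L' ep (fun u => (mutate s k).2 u j) j a'' b'' c'' d''.
Proof.
move=> sL kq L'k L'v jk jq.
have near (x y z w : 'I_n) : quad L ep (fun u => s.2 u j) j x y z w ->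
    lab L k x y || lab L k y z ->
    exists a'' b'' c'' d'', quad L' ep (fun u => (mutate s k).2 u j) j a'' b'' c'' d''.
  wlog ac : a b c d kq L'k / (x = a /\ y = c) \/ (y = a /\ z = c) => [wl|] jq'.
    have kq' := quad_rot kq; have L'k' : lab L' k d b by rewrite labC.
    have kac := flip_ac kq => h.
    have h' : joins a c x y || joins a c y z.
      by move: h kac; rewrite /lab; clear; order_solve.
    case/orP: h' => /joins_eq[[e1 e2]|[e1 e2]].
    - by apply: (wl a b c d) => //; left.
    - by apply: (wl c d a b) => //; left.
    - by apply: (wl a b c d) => //; right.
    - by apply: (wl c d a b) => //; right.
  have [kc kac [k1 k2 k3 k4] _] := kq; have [jc jac [j1 j2 j3 j4] _] := jq'.
  have jl : labelled L x z by exists j.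
  have jl' : labelled L z x by exists j; rewrite labC.
  case: ac => [[xa yc]|[ya zc]] _; subst.
    have zE : z = d.
      by apply: (third_vertex sL _ _ j2 jl' k3 k4); clear -kc jc; order_solve.
    by subst; exists a, b, d, w; apply: (flip_quad_prev sL kq L'k L'v jk jq').
  have xE : x = d.
    by apply: (third_vertex sL _ _ jl' j1 k3 k4); clear -kc jc; order_solve.
  by subst; exists d, b, c, w; apply: (flip_quad_next sL kq L'k L'v jk jq').
case: (boolP (lab L k a' b' || lab L k b' c')) => [h|]; first exact: near jq h.
rewrite negb_or => /andP[n1 n2].
case: (boolP (lab L k c' d' || lab L k d' a')) => [h|]; first exact: near (quad_rot jq) h.
rewrite negb_or => /andP[n3 n4].
by exists a', b', c', d'; apply: (flip_quad_disjoint sL kq L'k L'v jk jq).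
Qed.

Definition flip L k b d : V -> 'I_n * 'I_n := fun v => if v == k then (b, d) else L v.

(** Rotating the quadrilateral by one step exchanges the two signs. *)
Lemma quad_mutated s L k a b c d : seed_lab s L ->
  quad L ep (fun u => s.2 u k) k a b c d ->
  quad (flip L k b d) ep (fun u => (mutate s k).2 u k) k b c d a.
Proof.
move=> sL kq; have [c4 kac [k1 k2 k3 k4] colE] := kq.
have L'v v : v != k -> flip L k b d v = L v by rewrite /flip => /negPf->.
have L'k : lab (flip L k b d) k b d by rewrite /lab /flip eqxx /joins !eqxx.
have nk (x y : 'I_n) : ~~ joins a c x y -> lab L k x y = false.
  by move: kac; rewrite /lab => h h'; apply/negbTE; clear -h h'; order_solve.
have side (x y : 'I_n) : labelled L x y -> ~~ joins a c x y -> labelled (flip L k b d) x y.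
  by move=> h1 h2; apply: (flip_labelled L'v h1); rewrite nk.
have side' (x y : 'I_n) : ~~ joins b d x y -> lab (flip L k b d) k x y = false.
  by move=> h; rewrite /lab /flip eqxx; apply: negbTE.
split=> //.
- by clear -c4; order_solve.
- by split; apply: side => //; clear -c4; order_solve.
move=> u; rewrite mutate_col_k colE signedN /column; case: u => v; last first.
  by congr signed => /=; rewrite betaC.
case: (eqVneq v k) => [->|vk].
  rewrite /colpos !nk ?side' //; clear -c4; order_solve.
by congr signed; rewrite /= /lab L'v // orbC.
Qed.

Lemma prod_labels s L v w a b c d : seed_lab s L -> lab L v a b -> lab L w c d -> v != w ->
  \prod_(u | lab L u a b || lab L u c d) s.1 (inl u) = X a b * X c d.
Proof.
move=> sL va wc vw.
have XE u (x y : 'I_n) : lab L u x y -> s.1 (inl u) = X x y.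
  by move=> /joins_eq[[<- <-]|[<- <-]]; rewrite (sl_var sL).
rewrite (bigD1 v) ?va // (bigD1 w) /= ?wc ?orbT; last by rewrite eq_sym.
rewrite big1 ?mulr1 ?(XE _ _ _ va) ?(XE _ _ _ wc) // => u /andP[/andP[/orP[h|h]]].
  by rewrite (lab_uniq sL h va) eqxx.
by rewrite (lab_uniq sL h wc) !eqxx.
Qed.

Lemma prod_colpos s L a b c d : seed_lab s L -> cyc4 a b c d ->
  labelled L b c -> labelled L d a -> \prod_(u | colpos L ep a b c d u) s.1 u =
  (\prod_(v | beta ep v a b c d) t v) * (X b c * X d a).
Proof.
move=> sL c4 [v vb] [w wd].
rewrite big_sumType /= mulrC; congr (_ * _); first by apply: eq_bigr => u _; rewrite (sl_coef sL).
apply: (prod_labels sL vb wd); apply: contraTneq vb => ->; move: wd; rewrite /lab.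
by clear -c4; order_solve.
Qed.

Lemma colpos_disjoint s L a b c d u : seed_lab s L -> cyc4 a b c d ->
  colpos L ep a b c d u -> ~~ colpos L ep b c d a u.
Proof.
case: u => v sL c4 /=; last by rewrite /beta; clear -c4; order_solve.
by have vn := sl_neq sL v; rewrite /lab; clear -c4 vn; order_solve.
Qed.

(** The exchange relation is the deformed Ptolemy relation. *)
Lemma exchange_relation s L k a b c d : seed_lab s L ->
  quad L ep (fun u => s.2 u k) k a b c d ->
  \prod_(u | 0 < s.2 u k) s.1 u ^+ `|s.2 u k|%N +
  \prod_(u | s.2 u k < 0) s.1 u ^+ `|s.2 u k|%N = X a c * X b d.
Proof.
move=> sL [c4 _ [k1 k2 k3 k4] colE].
have c4' : cyc4 b c d a by clear -c4; order_solve.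
have dis u := @colpos_disjoint s L a b c d u sL c4.
rewrite (X_rel c4) addrC; congr (_ + _).
  rewrite [X a b * _]mulrC -(prod_colpos sL c4' k3 k1).
  apply: eq_big => u; rewrite colE /column; have := dis u;
    case: colpos; case: colpos => //= h.
  by have := h isT.
rewrite [X a d * _]mulrC (X_sym a d) -(prod_colpos sL c4 k2 k4).
apply: eq_big => u; rewrite colE /column; have := dis u;
  case: colpos; case: colpos => //= h.
by have := h isT.
Qed.

(** Mutation is a flip. For maximality: an arc crossing ac, but no arc of the
    new triangulation, can only be bd. *)
Lemma seed_lab_mutate s L k a b c d : seed_lab s L -> ~~ frozen k ->
  quad L ep (fun u => s.2 u k) k a b c d -> seed_lab (mutate s k) (flip L k b d).
Proof.
move=> sL k_mut kq; have [c4 kac [k1 k2 k3 k4] colE] := kq.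
have L'v v : v != k -> flip L k b d v = L v by rewrite /flip => /negPf->.
have L'k : flip L k b d k = (b, d) by rewrite /flip eqxx.
have knc v := lab_nc v sL (ex_intro _ k kac).
have vnc v : v != k -> crosses (L v).1 (L v).2 b d = false.
  by move=> vk; apply: contraNF vk => /(flip_diag sL kq) ->.
split.
- move=> v; case: (eqVneq v k) => [->|vk]; last by rewrite L'v // (sl_neq sL).
  by rewrite L'k /=; clear -c4; order_solve.
- move=> v w; case: (eqVneq v k) => [->|vk]; case: (eqVneq w k) => [->|wk] //.
  + rewrite /lab L'k L'v //= => h; have h' := knc w; exfalso; clear -c4 h h'; order_solve.
  + rewrite /lab L'k L'v //= => h; have h' := knc v; exfalso; clear -c4 h h'; order_solve.
  + by rewrite /lab !L'v //; exact: (sl_inj sL).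
- move=> v w; case: (eqVneq v k) => [->|vk]; case: (eqVneq w k) => [->|wk]; rewrite ?L'k ?L'v //=.
  + clear -c4; order_solve.
  + by have := vnc w wk; clear; order_solve.
  + by rewrite vnc.
  + exact: (sl_nc sL).
- move=> i j ij h.
  have hv v : v != k -> crosses i j (L v).1 (L v).2 = false by move=> vk; rewrite -L'v.
  have hk := h k; rewrite L'k /= in hk.
  have side (x y : 'I_n) : ~~ joins a c x y -> labelled L x y -> crosses i j x y = false.
    move=> h1 [v hvl].
    have vk : v != k.
      apply: contraNneq h1 => vk; move: hvl kac; rewrite vk /lab => u1 u2; clear -u1 u2; order_solve.
    have u1 := hv v vk; move: hvl; rewrite /lab => u2; clear -u1 u2; order_solve.
  case: (boolP (crosses i j (L k).1 (L k).2)) => ck.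
    have s1 : crosses i j a b = false by apply: side k1; clear -c4; order_solve.
    have s2 : crosses i j b c = false by apply: side k2; clear -c4; order_solve.
    have s3 : crosses i j c d = false by apply: side k3; clear -c4; order_solve.
    have s4 : crosses i j d a = false by apply: side k4; clear -c4; order_solve.
    exists k; rewrite /lab L'k /=; move: kac; rewrite /lab; clear -c4 ck s1 s2 s3 s4 ij.
    order_solve.
  have [v|v vl] := sl_max sL ij.
    by case: (eqVneq v k) => [->|/hv //]; exact: negbTE.
  exists v; rewrite /lab L'v //; apply: (contraFneq _ hk) => vk.
  by move: vl kac; rewrite vk /lab; clear -c4; order_solve.
- move=> v vf; have vk : v != k by apply: contraTneq vf => ->.
  by rewrite L'v // (sl_frozen sL).
- move=> v; case: (eqVneq v k) => [->|vk]; last first.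
    by rewrite /= /mutate_cluster (inj_eq (@inl_inj _ _)) (negPf vk) L'v // (sl_var sL).
  rewrite L'k /= /mutate_cluster eqxx.
  have ac : a != c by clear -c4; order_solve.
  rewrite (exchange_relation sL kq) (sl_var sL) /=.
  have -> : X (L k).1 (L k).2 = X a c by case/joins_eq: kac => -[-> ->].
  by rewrite mulrAC divff ?mul1r // X_neq0.
- by move=> v; rewrite /= /mutate_cluster /= (sl_coef sL).
- move=> j jf; case: (eqVneq j k) => [->|jk].
    by exists b, c, d, a; exact: quad_mutated.
  have [a' [b' [c' [d' jq]]]] := sl_quad sL jf.
  apply: (flip_quad sL kq _ L'v jk jq).
  by rewrite /lab L'k /joins !eqxx.
Qed.

Lemma quad_orient s L (k : V) a b c d x y :
  quad L ep (fun u => s.2 u k) k a b c d -> lab L k x y ->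
  exists b' d', quad L ep (fun u => s.2 u k) k x b' y d'.
Proof.
move=> kq kxy; have := flip_ac kq; rewrite /lab => kac.
have : joins a c x y by move: kxy; rewrite /lab => kxy; clear -kac kxy; order_solve.
move=> /joins_eq[[<- <-]|[<- <-]]; first by exists b, d.
by exists d, b; exact: quad_rot.
Qed.

(** Among the arcs crossed by ij, one of the triangles next to i has its apex at
    i. The search goes from ac to the side of its triangle behind which i lies.
    *)
Lemma crossing_apex s L i j a c : seed_lab s L -> labelled L a c -> cyc4 a i c j ->
  exists k a' c' d', [/\ ~~ frozen k, quad L ep (fun u => s.2 u k) k a' i c' d' &
    cyc4 a' i c' j].
Proof.
move=> sL; have [m] := ubnP (cdist a c); elim: m a c => // m IH a c lt [k kac] ci.
have kf : ~~ frozen k.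
  apply/negP => kf; have := frozen_cross i j kf; rewrite -(sl_frozen sL kf).
  by move: kac; rewrite /lab => h h'; clear -ci h h'; order_solve.
have [a1 [b1 [c1 [d1 kq]]]] := sl_quad sL kf.
have [b [d kq']] := quad_orient kq kac.
have [c4 _ [k1 k2 _ _] _] := kq'.
have ab : cyc3 a b c by clear -c4; order_solve.
case: (eqVneq i b) => [iE|ib]; first by exists k, a, c, d; split=> //; rewrite iE.
have [cib|cib] : cyc4 a i b j \/ cyc4 b i c j.
  have : cyc4 a i b j || cyc4 b i c j by clear -ci c4 ib; order_solve.
  by case/orP; [left|right].
- by apply: (IH a b) => //; rewrite -ltnS; apply: leq_trans lt; rewrite ltnS; exact: cdist_lt.
- by apply: (IH b c) => //; rewrite -ltnS; apply: leq_trans lt; rewrite ltnS; exact: cdist_ltr.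
Qed.

(** Flipping the arc opposite to i in the first triangle that ij crosses
    replaces it by an arc ending at i, so that ij crosses fewer arcs. *)
Lemma seed_reach s L i j : seed_lab s L -> i != j ->
  exists ks L', [/\ all (fun k => ~~ frozen k) ks, seed_lab (foldl (@mutate F V) s ks) L' &
    labelled L' i j].
Proof.
move=> sL ij; have [m] := ubnP #|[set v | crosses i j (L v).1 (L v).2]|.
elim: m s L sL => // m IH s L sL lt.
case: (pickP [pred v | crosses i j (L v).1 (L v).2]) => [v /= vc|nc]; last first.
  by exists [::], L; split=> //; apply: (sl_max sL).
have [k [a [c [d [kf kq cj]]]]] : exists k a c d, [/\ ~~ frozen k,
    quad L ep (fun u => s.2 u k) k a i c d & cyc4 a i c j].
  case: (boolP (cyc4 (L v).1 i (L v).2 j)) => h.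
    by apply: crossing_apex h => //; exists v; rewrite /lab /joins !eqxx.
  have h' : cyc4 (L v).2 i (L v).1 j by clear -vc h; order_solve.
  by apply: crossing_apex h' => //; exists v; rewrite /lab /joins !eqxx orbT.
have kac := flip_ac kq; have [c4 _ _ _] := kq.
have sL' := seed_lab_mutate sL kf kq.
have [|ks [L' [h1 h2 h3]]] := IH _ _ sL'; last first.
  by exists (k :: ks), L'; rewrite /= kf.
rewrite -ltnS; apply: leq_trans lt; rewrite ltnS; apply/proper_card/properP; split.
  apply/subsetP => u; rewrite !inE /flip; case: eqP => // _ /= h; exfalso.
  by clear -h c4 cj; order_solve.
exists k; rewrite !inE ?/flip ?eqxx /=.
  by move: kac; rewrite /lab => h; clear -h cj; order_solve.
by apply/negP => h; clear -h c4 cj; order_solve.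
Qed.

Lemma ep_lab (v : V) (x y : 'I_n) : (val v == [set x; y]) = lab ep v x y.
Proof. by rewrite epE joins_set. Qed.

Lemma triangle3 (x y z : 'I_n) : cyc3 x y z -> is_arc T x y -> is_arc T y z -> is_arc T z x ->
  triangle T [set x; y; z].
Proof.
move=> c xy yz zx; rewrite /triangle cards3_neq ?eqxx /=; try by clear -c; order_solve.
apply/forallP => A; apply/implyP => /andP[sA /cards2P[p [q [pq AE]]]].
move: sA; rewrite {}AE subUset !sub1set !inE => /andP[].
move=> /orP[/orP[]|] /eqP hx /orP[/orP[]|] /eqP hy; subst p q; rewrite ?eqxx // in pq *.
all: by rewrite // setUC.
Qed.

Lemma triangle_side (X' A : {set 'I_n}) p q : triangle T X' -> A \subset X' -> A = [set p; q] -> p != q -> is_arc T p q.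
Proof.
move=> /andP[_ /forallP/(_ A)/implyP h] sA AE pq.
by rewrite /is_arc -AE; apply: h; rewrite sA AE cards2 pq.
Qed.

Lemma arc_third a c x y : cyc3 a c x -> cyc3 a c y ->
  is_arc T c x -> is_arc T x a -> is_arc T c y -> is_arc T y a -> x = y.
Proof.
move=> ax ay h1 h2 h3 h4; have := arc_cross T_tri h3 h2; have := arc_cross T_tri h1 h4.
by clear -ax ay; order_solve.
Qed.

Section InitialQuad.
Variables (k : V) (a b c d : 'I_n).
Hypothesis c4 : cyc4 a b c d.
Hypothesis kac : lab ep k a c.
Hypothesis kf : ~~ frozen k.
Hypotheses (ab : is_arc T a b) (bc : is_arc T b c) (cd : is_arc T c d) (da : is_arc T d a).

(** A third triangle would have a side crossing one of these two. *)
Lemma diagonal_triangle (Y : {set 'I_n}) : triangle T Y -> a \in Y -> c \in Y ->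
  Y = [set b; c; a] \/ Y = [set d; a; c].
Proof.
move=> tY aY cY; have ac : a != c by clear -c4; order_solve.
have /cards1P[x xE] : #|Y :\ a :\ c| == 1%N.
  have := cardsD1 c (Y :\ a); have := cardsD1 a Y.
  have /andP[/eqP -> _] := tY; rewrite aY in_setD1 cY [c == a]eq_sym ac /= !add1n.
  by case=> <- [<-].
have : x \in Y :\ a :\ c by rewrite xE inE.
rewrite !inE => /and3P[xc xa xY].
have YE : Y = [set x; a; c].
  apply/setP => y; move/setP/(_ y): xE; rewrite !inE; case: eqP => [->|_] /=.
    by rewrite orbT cY.
  by rewrite orbF; case: eqP => [->|_ /= ->]; rewrite ?orbT ?orbF.
have xaE : is_arc T x a by apply: (triangle_side (A := [set x; a]) tY); rewrite // subUset !sub1set xY.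
have xcE : is_arc T x c by apply: (triangle_side (A := [set x; c]) tY); rewrite // subUset !sub1set xY.
have [h|h] : cyc3 a c x \/ cyc3 c a x.
  by have : cyc3 a c x || cyc3 c a x by [clear -ac xc xa; order_solve]; case/orP; [left|right].
- right; rewrite YE; congr [set _; _; _]; apply: (arc_third h); rewrite ?(arc_sym T c x) //.
  by clear -c4; order_solve.
- left; rewrite YE -setUA [[set a; c]]setUC setUA; congr [set _; _; _].
  apply: (arc_third h); rewrite ?(arc_sym T a x) //; by clear -c4; order_solve.
Qed.

(** Counts the triangles which contribute an arrow: there is at most one, on the
    side of the diagonal where v lies. *)
Lemma diagonal_arrows (v : V) (P : {set 'I_n} -> bool) (p q r s : 'I_n) :
  (forall Y, P Y -> a \in Y /\ c \in Y) ->
  P [set b; c; a] = lab ep v p q -> P [set d; a; c] = lab ep v r s ->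
  ~~ (lab ep v p q && lab ep v r s) ->
  #|[set Y | triangle T Y && P Y]| = (lab ep v p q || lab ep v r s).
Proof.
move=> Pac P1 P2 dis.
have c1 : cyc3 b c a by clear -c4; order_solve.
have c2 : cyc3 d a c by clear -c4; order_solve.
have aE : [set a; c] \in T by have := valP k; rewrite (eqP (etrans (ep_lab k a c) kac)).
have t1 : triangle T [set b; c; a] by apply: triangle3 => //; rewrite arc_sym.
have t2 : triangle T [set d; a; c] by apply: triangle3.
have SE Y : (triangle T Y && P Y) =
    (Y == [set b; c; a]) && lab ep v p q || (Y == [set d; a; c]) && lab ep v r s.
  apply/andP/orP => [[tY PY]|[/andP[/eqP-> h]|/andP[/eqP-> h]]]; rewrite ?t1 ?t2 ?P1 ?P2 //.
  have [aY cY] := Pac _ PY; move: PY.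
  by case: (diagonal_triangle tY aY cY) => ->; rewrite ?P1 ?P2 eqxx => ->; [left|right].
case: (boolP (lab ep v p q)) dis SE => /= h1; [move=> /negPf h2|move=> _] => SE.
  rewrite -(cards1 [set b; c; a]); apply: eq_card => Y.
  by rewrite !inE SE h2 andbF andbT orbF.
case: (boolP (lab ep v r s)) SE => /= h2 SE.
  rewrite -(cards1 [set d; a; c]); apply: eq_card => Y.
  by rewrite !inE SE andbF andbT.
by apply: eq_card0 => Y; rewrite !inE SE !andbF.
Qed.

Lemma diagonal_val : val k = [set a; c].
Proof. by apply/eqP; rewrite ep_lab. Qed.

Lemma side_disjoint (v : V) : ~~ (lab ep v b c && lab ep v d a) /\ ~~ (lab ep v a b && lab ep v c d).
Proof. by have := ep_neq v; rewrite /lab; split; clear -c4; order_solve. Qed.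

Lemma arrows_into v : arrows v k = (lab ep v b c || lab ep v d a).
Proof.
rewrite /arrows (negPf kf) andbF; have [dis _] := side_disjoint v.
apply: diagonal_arrows => //.
- move=> Y /'exists_'exists_existsP[x [y [z /and4P[_ /eqP -> _ /eqP kE]]]].
  have kE' : [set a; c] = _ := etrans (esym diagonal_val) kE.
  by have := set21 a c; have := set22 a c; rewrite kE' !inE => /orP[]/eqP-> /orP[]/eqP->; rewrite !eqxx ?orbT.
- by rewrite diagonal_val [[set a; c]]setUC next_side_left -?ep_lab //; clear -c4; order_solve.
- by rewrite diagonal_val next_side_left -?ep_lab //; clear -c4; order_solve.
Qed.

Lemma arrows_from v : arrows k v = (lab ep v a b || lab ep v c d).
Proof.
rewrite /arrows (negPf kf) /=; have [_ dis] := side_disjoint v.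
apply: diagonal_arrows => //.
- move=> Y /'exists_'exists_existsP[x [y [z /and4P[_ /eqP -> /eqP kE _]]]].
  have kE' : [set a; c] = _ := etrans (esym diagonal_val) kE.
  by have := set21 a c; have := set22 a c; rewrite kE' !inE => /orP[]/eqP-> /orP[]/eqP->; rewrite !eqxx ?orbT.
- by rewrite diagonal_val [[set a; c]]setUC next_side_right -?ep_lab //; clear -c4; order_solve.

- by rewrite diagonal_val next_side_right -?ep_lab //; clear -c4; order_solve.
Qed.

(** Arrows follow the sides of a triangle clockwise, so those into ac come from
    bc and da. For the frozen rows, the only arc that joins [a, b) to [c, d) is
    ac, and none joins [b, c) to [d, a). *)
Lemma initial_quad : quad ep ep (fun u => exchange_matrix_prin u k) k a b c d.
Proof.
split=> //.
  have lb x y : is_arc T x y -> labelled ep x y.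
    by move=> xy; exists (Sub [set x; y] xy); rewrite -ep_lab.
  by split; apply: lb.
case=> v; rewrite /column /=.
  by rewrite /exchange_matrix arrows_into arrows_from /signed !natz [lab ep v c d || _]orbC.
have vn := ep_neq v; have vE : is_arc T (ep v).1 (ep v).2 by rewrite /is_arc -epE; exact: valP.
have kE : is_arc T a c by rewrite /is_arc -diagonal_val; exact: valP.
have nc p q : is_arc T p q -> crosses (ep v).1 (ep v).2 p q = false.
  by move=> pq; rewrite crossesE (arc_cross T_tri vE pq) (arc_cross T_tri vE) // arc_sym.
have := nc _ _ ab; have := nc _ _ bc; have := nc _ _ cd; have := nc _ _ da; have := nc _ _ kE.
move=> h1 h2 h3 h4 h5.
have -> : (v == k) = lab ep v a c by rewrite -(inj_eq val_inj) diagonal_val ep_lab.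
have -> : beta ep v a b c d = lab ep v a c.
  by rewrite /beta /lab; clear -c4 h1 h2 h3 h4 h5 vn; order_solve.
have -> : beta ep v b c d a = false.
  by rewrite /beta /lab; clear -c4 h1 h2 h3 h4 h5 vn; order_solve.
by rewrite /signed subr0.
Qed.
End InitialQuad.

Lemma seed_lab0 (x : V + V -> F) : (forall v, x (inl v) = X (ep v).1 (ep v).2) ->
  (forall v, x (inr v) = t v) -> seed_lab (x, @exchange_matrix_prin n T) ep.
Proof.
move=> xX xt.
have epT v : is_arc T (ep v).1 (ep v).2 by rewrite /is_arc -epE; exact: valP.
split=> //.
- exact: ep_neq.
- by move=> v w; rewrite -ep_lab -epE => /eqP/val_inj.
- by move=> v w; rewrite crossesE !(arc_cross T_tri) // arc_sym.
- move=> i j ij h; have ijE : is_arc T i j.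
    apply: (arc_max T_tri) => // r s rs.
    have := h (Sub [set r; s] rs); set v := Sub _ _ => hv.
    have : lab ep v r s by rewrite -ep_lab.
    by rewrite /lab => vl; clear -hv vl; order_solve.
  by exists (Sub [set i; j] ijE); rewrite -ep_lab.
move=> k kf; have kn := ep_neq k.
have nf (p q : 'I_n) : val k = [set p; q] -> p != q -> exists z, cyc3 p z q.
  move=> kE pq; case: (cyc3_between pq) => // qS; case/negP: kf.
  by rewrite /frozen kE qS; apply/imsetP; exists p.
have [z1 /(arc_triangle T_tri (epT k))[b [b1 b2 b3]]] := nf _ _ (epE k) kn.
have [z2 /(arc_triangle T_tri)[|d [d1 d2 d3]]] : exists z, cyc3 (ep k).2 z (ep k).1.
  by apply: nf; rewrite ?epE 1?setUC // eq_sym.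
  by rewrite arc_sym.
exists (ep k).1, b, (ep k).2, d; apply: initial_quad => //.
  by clear -b1 d1; order_solve.
by rewrite /lab /joins !eqxx.
Qed.
End SeedLabels.

(** * The cluster variables with principal coefficients *)

Lemma rescaled_relation (F : fieldType) (A B a1 a2 a3 a4 a5 a6 p1 p2 p3 p4 p5 p6 : F) :
  a1 != 0 -> a2 != 0 -> a3 != 0 -> a4 != 0 -> a5 != 0 -> a6 != 0 ->
  A * (a1 * a2) = a3 * a4 -> B * (a1 * a2) = a5 * a6 -> p1 * p2 = p3 * p4 + p5 * p6 ->
  p1 / a1 * (p2 / a2) = A * (p3 / a3 * (p4 / a4)) + B * (p5 / a5 * (p6 / a6)).
Proof.
move=> n1 n2 n3 n4 n5 n6 eA eB eP.
have -> : A = a3 * a4 / (a1 * a2) by rewrite -eA mulfK ?mulf_neq0.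
have -> : B = a5 * a6 / (a1 * a2) by rewrite -eB mulfK ?mulf_neq0.
transitivity (p1 * p2 / (a1 * a2)); first by field; rewrite n1 n2.
by rewrite eP; field; rewrite ?n1 ?n2 ?n3 ?n4 ?n5 ?n6.
Qed.

Section PrincipalVariables.
Variables (K : fieldType) (n : nat) (T : {set {set 'I_n}}).
Hypothesis T_tri : triangulation T.
Hypothesis n_gt2 : (2 < n)%N.
Local Notation V := (arc_of T).
Local Notation L := #|{: V + V}|.
Local Notation F := (ratfun K L).
Implicit Types i j k l p q : 'I_n.

Definition tvar (v : V) : F := ratfunX K (enum_rank (inr v : V + V)).

Lemma tvar_neq0 v : tvar v != 0.
Proof. exact: monX_neq0. Qed.

Variable ep : V -> 'I_n * 'I_n.
Hypothesis epE : forall v, val v = [set (ep v).1; (ep v).2].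

Definition past v i : bool := hsep (ep v).1 (ep v).2 i.
Definition tmon (B : pred V) : F := \prod_(v | B v) tvar v.

Lemma tmonE B : tmon B = \prod_v tvar v ^+ B v.
Proof.
by rewrite /tmon big_mkcond /=; apply: eq_bigr => v _; case: (B v); rewrite ?expr1.
Qed.

Lemma tmon_neq0 B : tmon B != 0.
Proof. by apply/prodf_neq0 => v _; exact: tvar_neq0. Qed.

(** The product of the t_v over the arcs v, turned by half a step, that have
    both i and j on the same chosen side. *)
Definition tpow i j : F := tmon (fun v => past v i && past v j).

(** With h_i = 0 or 1 the side of i, the exponents satisfy h_i h_l + h_j h_k -
    h_i h_k - h_j h_l = (h_i - h_j) (h_l - h_k), and this is the indicator of v
    separating i from j and k from l, since i, j, k, l are in cyclic order. *)
Lemma tpow_rel i j k l : cyc4 i j k l ->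
  tmon (fun v => beta ep v i j k l) * (tpow i k * tpow j l) = tpow i l * tpow j k.
Proof.
move=> c; rewrite /tpow !tmonE -!big_split /=; apply: eq_bigr => v _.
rewrite -!exprD; congr (_ ^+ _); rewrite /beta -!/(past v _).
have : ~~ [&& past v i, ~~ past v j, past v k & ~~ past v l] &&
       ~~ [&& ~~ past v i, past v j, ~~ past v k & past v l].
  by rewrite /past; clear -c; order_solve.
by case: (past v i); case: (past v j); case: (past v k); case: (past v l).
Qed.

Variable vec : 'I_n -> F * F.
Hypothesis vecE : forall i j, is_arc T i j -> (i < j)%N ->
  det2 (vec i) (vec j) = arc_var K T i j * tpow i j.

(** The vectors have determinant x_ij times a monomial in t; dividing by this
    monomial deforms the Ptolemy relations without changing the values on T. *)
Definition xvar i j : F := ptol vec i j / tpow i j.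

Lemma xvar_sym i j : xvar i j = xvar j i.
Proof.
by rewrite /xvar ptol_sym /tpow; congr (_ / _); apply: eq_bigl => v; rewrite andbC.
Qed.

Lemma xvar_arc i j : is_arc T i j -> xvar i j = arc_var K T i j.
Proof.
wlog ij : i j / (i < j)%N => [wl|] h.
  case: (ltngtP i j) => ij; [exact: wl|..].
    rewrite xvar_sym wl // 1?arc_sym // /arc_var finset.setUC //.
  by have := arc_neq T_tri h; rewrite (ord_inj ij) eqxx.
by rewrite /xvar /ptol ij vecE // mulfK ?tmon_neq0.
Qed.

Lemma xvar_rel i j k l : cyc4 i j k l ->
  xvar i k * xvar j l = tmon (fun v => beta ep v j k l i) * (xvar i j * xvar k l) +
                        tmon (fun v => beta ep v i j k l) * (xvar i l * xvar j k).
Proof.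
move=> c; have c' : cyc4 j k l i by clear -c; order_solve.
have tsym p q : tpow p q = tpow q p by apply: eq_bigl => v; rewrite andbC.
apply: rescaled_relation; try exact: tmon_neq0.
- rewrite (mulrC (tpow i k)) (tsym i k) (tsym i j); rewrite tpow_rel //; exact: mulrC.
- exact: tpow_rel.
- exact: ptol_rel.
Qed.

(** The degree in t: leading parts for this weight are the values at t = 0. *)
Definition tdeg (u : 'I_L) : int := if enum_val u is inr _ then 1 else 0.
Local Notation lead := (lead tdeg).

Lemma lead_tvar v : lead 0 (tvar v) 0.
Proof.
have := lead_mon K tdeg U_(enum_rank (inr v : V + V))%MM.
rewrite mweightU /tdeg enum_rankK; apply: lead_lt; exact: ltr01.
Qed.

Lemma lead_tmon B : exists q : F, lead 0 (tmon B) q.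
Proof.
rewrite /tmon; pose P (y : F) := exists q : F, lead 0 y q.
apply: (big_ind P) => [|y z [q h] [q' h']|v _]; rewrite /P.
- by exists 1; exact: lead1.
- by exists (q * q'); rewrite -[0]addr0; exact: leadM.
by exists 0; exact: lead_tvar.
Qed.

Lemma lead_tmon0 (B : pred V) v : B v -> lead 0 (tmon B) 0.
Proof.
move=> Bv; rewrite /tmon (bigD1 v) //=.
have [q h] := lead_tmon (fun u => B u && (u != v)).
by rewrite -[X in lead X]addr0 -[X in lead _ _ X](mul0r q); apply: leadM => //; exact: lead_tvar.
Qed.

Lemma beta_sep i j k l : cyc4 i j k l -> sep T i j k l -> exists v, beta ep v i j k l.
Proof.
move=> c /sepP[x [y [xy xi yk]]]; exists (Sub [set x; y] xy).
have : joins (ep (Sub [set x; y] xy)).1 (ep (Sub [set x; y] xy)).2 x y by rewrite -joins_set -epE.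
by rewrite /beta => h; clear -c h xi yk; order_solve.
Qed.

Lemma beta_nsep i j k l : cyc4 i j k l -> ~~ sep T i j k l -> forall v, beta ep v i j k l = false.
Proof.
move=> c nsep v; apply: contraNF nsep; have : is_arc T (ep v).1 (ep v).2 by rewrite /is_arc -epE; exact: valP.
move=> vE; rewrite /beta => h.
have : in_co (ep v).1 i j && in_co (ep v).2 k l || in_co (ep v).2 i j && in_co (ep v).1 k l.
  by clear -c h; order_solve.
case/orP => /andP[h1 h2]; apply/sepP; [exists (ep v).1, (ep v).2|exists (ep v).2, (ep v).1] => //.
by rewrite arc_sym.
Qed.

Local Notation g := (gvec T int).

(** One coefficient of the relation is 1, as no arc crosses both ways, and the
    other is divisible by some t_v, so that its term is negligible. *)
Lemma xvar_lead_rel i j k l : cyc4 i j k l -> sep T i j k l -> exists r : F,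
  xvar i k * xvar j l = xvar i j * xvar k l + r /\
  (lead 0 (xvar i l) (cmon K (g i l)) -> lead 0 (xvar j k) (cmon K (g j k)) -> lead (0 + 0) r 0).
Proof.
move=> c sp; exists (tmon (fun v => beta ep v i j k l) * (xvar i l * xvar j k)).
split; last first.
  move=> h1 h2; have [v vB] := beta_sep c sp.
  have h := leadM h1 h2; rewrite addr0 in h.
  rewrite -[X in lead _ _ X](mul0r (cmon K (g i l) * cmon K (g j k))).
  exact: leadM (lead_tmon0 vB) h.
rewrite xvar_rel //; congr (_ + _); rewrite /tmon big_pred0 ?mul1r // => v.
apply: beta_nsep; first by clear -c; order_solve.
by rewrite (sep_excl T_tri c sp).
Qed.

(** The initial variables have degree 0 in t. *)
Definition flat (_ _ : 'I_n) : int := 0.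

Lemma flat_additive : tree_additive T flat.
Proof. by split=> // *; rewrite /flat. Qed.

Lemma flat_arc (a : V) p q : val a = [set p; q] -> flat p q = tdeg (enum_rank (inl a : V + V)).
Proof. by rewrite /flat /tdeg enum_rankK. Qed.

Lemma lead_xvar i j : i != j -> lead 0 (xvar i j) (cmon K (g i j)).
Proof.
exact: (lead_arcs T_tri (gvec_additive T_tri n_gt2 int) (gvec_arc T_tri n_gt2 int)
         xvar_sym xvar_arc flat_additive flat_arc xvar_lead_rel).
Qed.

Lemma lead_xvar_eval (f : pl_ring K n) : lead 0 (pl_eval xvar f) (geval T f).
Proof.
apply: (lead_pl_eval_eq T_tri (gvec_additive T_tri n_gt2 int) (gvec_arc T_tri n_gt2 int)
         xvar_sym xvar_arc flat_additive flat_arc xvar_lead_rel) => m _.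
by rewrite /mon_weight big1 // => u _; rewrite mulr0.
Qed.

Lemma cmon_neq0 (v : {ffun V -> int}) : cmon K v != 0.
Proof. by apply/prodf_neq0 => a _; rewrite expfz_neq0 ?cvar_neq0. Qed.

(** The leading part is a monomial. *)
Lemma xvar_neq0 i j : i != j -> xvar i j != 0.
Proof.
move=> /lead_xvar h; apply/eqP => x0; rewrite x0 in h.
by have := cmon_neq0 (g i j); rewrite (lead0_eq0 h) eqxx.
Qed.

Lemma xvar_seed0 : seed_lab xvar tvar ep (prin_seed0 K T) ep.
Proof.
apply: (seed_lab0 T_tri) => // v.
by rewrite xvar_arc ?(arc_varE K (epE v)) //= /is_arc -epE; exact: valP.
Qed.

Lemma cluster_varsP x : @cluster_vars K n T x <-> exists i j, i != j /\ x = xvar i j.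
Proof.
split=> [[_ [ks ksf <-] [a ->]]|[i [j [ij ->]]]].
  have [L' sL] : exists L', seed_lab xvar tvar ep (foldl (@mutate _ _) (prin_seed0 K T) ks) L'.
    have : exists L', seed_lab xvar tvar ep (prin_seed0 K T) L' by exists ep; exact: xvar_seed0.
    elim: ks ksf (prin_seed0 K T) => [|k ks IH] //= /andP[kf ksf] s' [L' sL].
    have [b [c [d [e kq]]]] := sl_quad sL kf.
    apply: IH => //; exists (flip L' k c e).
    exact: (seed_lab_mutate xvar_sym xvar_neq0 xvar_rel sL kf kq).
  exists (L' a).1, (L' a).2; split; first exact: (sl_neq sL).
  exact: (sl_var sL).
have [ks [L' [ksf sL [v vl]]]] := seed_reach epE xvar_sym xvar_neq0 xvar_rel xvar_seed0 ij.
exists (foldl (@mutate _ _) (prin_seed0 K T) ks); first by exists ks.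
exists v; rewrite (sl_var sL); case/joins_eq: vl => -[-> ->] //; exact: xvar_sym.
Qed.
End PrincipalVariables.

(** * The fiber over t = 0 *)

Section QuotMorphism.
Variables (K : comNzRingType) (A : comAlgType K) (E : set A).

Lemma quot_proj_eq0 x : quot_proj E x = 0 <-> x \in in_ideal_gen E.
Proof.
have <- : quot_proj E 0 = 0.
  by apply: (addIr (quot_proj E 0)); rewrite -quot_projD !add0r.
by rewrite -[X in _ <-> X \in _]subr0; exact: quot_projP.
Qed.
End QuotMorphism.

Lemma pl_evalE (K : fieldType) (n : nat) (B : comAlgType K) (H : 'I_n -> 'I_n -> B) f :
  pl_eval H f = \sum_(m <- msupp f) f@_m *: \prod_u H (src u) (tgt u) ^+ m (enum_rank u).
Proof.
apply: eq_bigr => m _; rewrite mulr_algl; congr (_ *: _).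
by rewrite -pl_evalX /pl_eval mmapX.
Qed.

Lemma pl_eval_morph (K : fieldType) (n : nat) (B C : comAlgType K) (phi : {rmorphism B -> C})
    (H : 'I_n -> 'I_n -> B) : (forall c x, phi (c *: x) = c *: phi x) ->
  forall f, phi (pl_eval H f) = pl_eval (fun i j => phi (H i j)) f.
Proof.
move=> phiZ f; rewrite !pl_evalE raddf_sum /=; apply: eq_bigr => m _.
by rewrite phiZ rmorph_prod; congr (_ *: _); apply: eq_bigr => u _; rewrite rmorphXn.
Qed.

Lemma lead_uniq0 (K : fieldType) (N : nat) (R : realDomainType) (om : 'I_N -> R) c
    (y q : ratfun K N) : lead om c y q -> lead om c y 0 -> q = 0.
Proof.
move=> h h0; have := leadD h (leadZ (-1) h0).
by rewrite scaler0 addr0 scaleN1r subrr; exact: lead0_eq0.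
Qed.

Section PrincipalAlgebra.
Variables (K : fieldType) (n : nat) (T : {set {set 'I_n}}).
Hypothesis T_tri : triangulation T.
Hypothesis n_gt2 : (2 < n)%N.
Local Notation V := (arc_of T).
Local Notation L := #|{: V + V}|.
Local Notation F := (ratfun K L).
Local Notation S := (pl_ring K n).
Local Notation A := (prin_alg K T).
Local Notation t0 := (@prin_at0 K n T).
Implicit Types i j k l p q : 'I_n.
Variable ep : V -> 'I_n * 'I_n.
Hypothesis epE : forall v, val v = [set (ep v).1; (ep v).2].
Variable vec : 'I_n -> F * F.
Hypothesis vecE : forall i j, is_arc T i j -> (i < j)%N ->
  det2 (vec i) (vec j) = arc_var K T i j * tpow K ep i j.
Local Notation x := (xvar ep vec).
Local Notation lead := (lead (@tdeg n T)).
Local Notation gens := (@coef_vars K n T `|` @cluster_vars K n T)%classic.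

Lemma xvar_mem i j : x i j \in in_subalg_gen gens.
Proof.
case: (eqVneq i j) => [->|ij].
  have -> : x j j = 0 by rewrite /xvar /ptol ltnn /det2 [X in (X - _) / _]mulrC subrr mul0r.
  exact: rpred0.
apply/asboolP; apply: subalg_gen_in; right.
by apply/(cluster_varsP T_tri n_gt2 epE vecE); exists i, j.
Qed.

Lemma tvar_mem v : tvar K v \in in_subalg_gen gens.
Proof. by apply/asboolP; apply: subalg_gen_in; left; exists v. Qed.

(** Also for i = j, where the value is 0: this avoids a case distinction in the
    definition of the morphism below. *)
Definition xalg i j : A := Subalg (xvar_mem i j).
Definition talg v : A := Subalg (tvar_mem v).
Definition talg_mon (B : pred V) : A := \prod_(v | B v) talg v.

Lemma val_talg_mon B : val (talg_mon B) = tmon K B.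
Proof. by rewrite /talg_mon rmorph_prod. Qed.

Lemma xalg_sym i j : xalg i j = xalg j i.
Proof. by apply: val_inj; exact: xvar_sym. Qed.

Lemma xalg_rel i j k l : cyc4 i j k l ->
  xalg i k * xalg j l = talg_mon (fun v => beta ep v j k l i) * (xalg i j * xalg k l) +
                        talg_mon (fun v => beta ep v i j k l) * (xalg i l * xalg j k).
Proof.
move=> c; apply: val_inj; rewrite rmorphD !rmorphM /= !val_talg_mon.
exact: xvar_rel c.
Qed.

Lemma talg_at0 v : talg v \in in_ideal_gen t0.
Proof. by apply: ideal_gen_sub; exists v. Qed.

Lemma talg_mon_at0 (B : pred V) v : B v -> talg_mon B \in in_ideal_gen t0.
Proof. by move=> Bv; rewrite /talg_mon (bigD1 v) //= mulrC ideal_genM // talg_at0. Qed.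

Definition prin_eval : S -> A := pl_eval xalg.
HB.instance Definition _ := GRing.RMorphism.on prin_eval.

Lemma val_prin_eval f : val (prin_eval f) = pl_eval x f.
Proof. exact: (@pl_eval_morph K n A F (GRing.RMorphism.clone _ _ (\val : A -> F) _)). Qed.

(** In the deformed relation the term that does not appear in the binomial is
    divisible by some t_v. *)
Lemma prin_eval_binomial f : tree_binomial T f -> prin_eval f \in in_ideal_gen t0.
Proof.
move=> [i [j [k [l [[ij jk kl] h]]]]].
have [ik jl il] : [/\ (i < k)%N, (j < l)%N & (i < l)%N].
  by rewrite (ltn_trans ij jk) (ltn_trans jk kl) (ltn_trans ij (ltn_trans jk kl)).
have c : cyc4 i j k l by clear -ij jk kl; order_solve.
have c' : cyc4 j k l i by clear -c; order_solve.
have mon1 a b d e : cyc4 a b d e -> ~~ sep T a b d e ->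
    talg_mon (fun v => beta ep v a b d e) = 1.
  by move=> abde ns; rewrite /talg_mon big_pred0 // => v; exact: (beta_nsep epE).
have mon0 a b d e z : cyc4 a b d e -> sep T a b d e ->
    talg_mon (fun v => beta ep v a b d e) * z \in in_ideal_gen t0.
  move=> abde /(beta_sep epE abde)[v vB].
  by rewrite mulrC ideal_genM // (talg_mon_at0 vB).
have so := sep_or T_tri c.
case: h => -[ns ->]; rewrite rmorphB !rmorphM /= /prin_eval !pl_eval_pla // xalg_rel //.
  by rewrite (negPf ns) /= in so; rewrite (mon1 i j k l) // mul1r addrK mon0.
rewrite (negPf ns) orbF in so.
by rewrite (mon1 j k l i) // mul1r addrC addKr mon0.
Qed.

Lemma lead_prin_alg (z : A) : exists q : F, lead 0 (val z) q.
Proof.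
have /asboolP := valP z; elim=> {z} [y [[v ->]|/(cluster_varsP T_tri n_gt2 epE vecE)]|
  |y y' _ [q h] _ [q' h']|y y' _ [q h] _ [q' h']|c y _ [q h]].
- by exists 0; exact: lead_tvar.
- by move=> [i [j [ij ->]]]; exists (cmon K (gvec T int i j)); exact: lead_xvar.
- by exists 1; exact: lead1.
- by exists (q + q'); exact: leadD.
- by exists (q * q'); rewrite -[0]addr0; exact: leadM.
by exists (c *: q); exact: leadZ.
Qed.

(** Elements of the ideal vanish at t = 0. *)
Lemma lead_at0 (z : A) : z \in in_ideal_gen t0 -> lead 0 (val z) 0.
Proof.
apply: (ideal_gen_ind (P := fun z : A => lead 0 (val z) 0)) => [|y y' h h'|y y' [v vE]].
- exact: lead0.
- by have := leadD h h'; rewrite addr0 -rmorphD.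
have [q h] := lead_prin_alg y.
have h' := leadM h (lead_tvar K v); rewrite addr0 mulr0 in h'.
by rewrite rmorphM /= vE.
Qed.

Definition prin_eval0 (f : S) : quot_alg t0 := quot_proj t0 (prin_eval f).

Lemma prin_eval0D : {morph prin_eval0 : f g / f + g}.
Proof. by move=> f g; rewrite /prin_eval0 rmorphD quot_projD. Qed.
Lemma prin_eval0M : {morph prin_eval0 : f g / f * g}.
Proof. by move=> f g; rewrite /prin_eval0 rmorphM [RHS]quot_mulE. Qed.
Lemma prin_eval01 : prin_eval0 1 = 1.
Proof. by rewrite /prin_eval0 rmorph1. Qed.
Lemma prin_eval0Z c f : prin_eval0 (c *: f) = c *: prin_eval0 f.
Proof. by rewrite /prin_eval0 /prin_eval pl_evalZ [RHS]quot_scaleE. Qed.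

(** If the image of f lies in the ideal generated by the t_v, its part of degree
    0 in t vanishes; but this part is the image of f under p_ij |-> x^(g_ij). *)
Lemma prin_eval0_ker f : prin_eval0 f = 0 <-> f \in in_ideal_gen (tree_binomial (K := K) T).
Proof.
rewrite quot_proj_eq0; split=> [h|]; last first.
  move: f; apply: ideal_gen_ind => [|f g|f g]; first by rewrite rmorph0 rpred0.
    move=> hf hg; have e := rmorphD prin_eval f g; rewrite e; exact: ideal_genD hf hg.
  move=> /prin_eval_binomial hg; have e := rmorphM prin_eval f g; rewrite e; exact: ideal_genM.
apply: (proj1 (geval_ker T_tri n_gt2 f)).
have l1 := lead_at0 h; rewrite val_prin_eval in l1.
have l2 := lead_xvar_eval T_tri n_gt2 epE vecE f.
exact: lead_uniq0 l2 l1.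
Qed.

Lemma cluster_prin_eval0 y (z : A) : @cluster_vars K n T y -> val z = y ->
  exists2 f : S, f \is 1.-homog & prin_eval0 f = quot_proj t0 z.
Proof.
move=> /(cluster_varsP T_tri n_gt2 epE vecE)[i [j [ij yE]]] zE.
have {zE yE} -> : z = xalg i j by apply: val_inj; rewrite zE yE.
wlog lt : i j ij / (i < j)%N => [wl|].
  case: (ltngtP i j) => lt; [exact: wl|by rewrite xalg_sym; apply: wl; rewrite // eq_sym|].
  by rewrite (ord_inj lt) eqxx in ij.
have [u [ui uj]] := pl_index_of lt.
exists (pla K i j); last by rewrite /prin_eval0 /prin_eval pl_eval_pla.
rewrite -ui -uj plaE dhomogX; apply/eqP; exact: mdeg1.
Qed.

Lemma at0_prin_eval0 v y (z : A) : val z = tvar K v * y -> y \in in_subalg_gen gens ->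
  quot_proj t0 z = 0.
Proof.
move=> zE yA; apply/quot_proj_eq0.
have -> : z = (Subalg yA : A) * talg v by apply: val_inj; rewrite zE mulrC.
exact: ideal_genM (talg_at0 v).
Qed.

Lemma subalg_prin_eval0 y : subalg_gen gens y ->
  forall z : A, val z = y -> exists f, prin_eval0 f = quot_proj t0 z.
Proof.
elim=> {y} [y [[v yE]|yc] z zE||y y' hy IH hy' IH' z zE|y y' hy IH hy' IH' z zE|c y hy IH z zE].
- exists 0; have := at0_prin_eval0 (v := v) (y := 1) (z := z).
  rewrite zE yE mulr1 => -> //; last exact: rpred1.
  by apply/quot_proj_eq0; rewrite rmorph0 rpred0.
- by have [f _ fE] := cluster_prin_eval0 yc zE; exists f.
- move=> z zE; exists 1; rewrite prin_eval01; congr quot_proj; exact: val_inj.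
- have [f fE] := IH (Subalg (asboolT hy)) erefl.
  have [f' f'E] := IH' (Subalg (asboolT hy')) erefl.
  exists (f + f'); rewrite prin_eval0D fE f'E -quot_projD; congr quot_proj; exact: val_inj.
- have [f fE] := IH (Subalg (asboolT hy)) erefl.
  have [f' f'E] := IH' (Subalg (asboolT hy')) erefl.
  exists (f * f'); rewrite prin_eval0M fE f'E [LHS]quot_mulE; congr quot_proj; exact: val_inj.
have [f fE] := IH (Subalg (asboolT hy)) erefl.
exists (c *: f); rewrite prin_eval0Z fE [LHS]quot_scaleE; congr quot_proj; exact: val_inj.
Qed.

Lemma prin_eval0_surj b : exists f, prin_eval0 f = b.
Proof.
have [z ->] := quot_proj_surj b.
exact: (subalg_prin_eval0 (asboolW (valP z)) erefl).
Qed.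

Lemma prin_comp_mem d y : @prin_comp K n T d y -> y \in in_subalg_gen gens.
Proof.
elim=> {d y} [d|d y y' _ h _ h'|d c y _ h||d v y [u ->] _ h|d y y' yc _ h].
- exact: rpred0.
- exact: rpredD.
- exact: rpredZ.
- exact: rpred1.
- by apply: rpredM => //; exact: (tvar_mem u).
by apply: rpredM => //; apply/asboolP; apply: subalg_gen_in; right.
Qed.

(** Modulo the t_v, a component of degree d is spanned by products of d
    variables x_ij. *)
Lemma prin_comp_prin_eval0 d y : @prin_comp K n T d y ->
  forall z : A, val z = y -> exists2 f : S, f \is d.-homog & prin_eval0 f = quot_proj t0 z.
Proof.
elim=> {d y} [d z zE|d y y' hy IH hy' IH' z zE|d c y hy IH z zE|z zE|d v y [u ->] hy IH z zE
  |d y y' yc hy IH z zE].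
- exists 0; first exact: rpred0.
  by rewrite /prin_eval0 rmorph0; congr quot_proj; apply: val_inj.
- have [f fh fE] := IH (Subalg (prin_comp_mem hy)) erefl.
  have [f' fh' f'E] := IH' (Subalg (prin_comp_mem hy')) erefl.
  exists (f + f'); first exact: rpredD.
  rewrite prin_eval0D fE f'E -quot_projD; congr quot_proj; exact: val_inj.
- have [f fh fE] := IH (Subalg (prin_comp_mem hy)) erefl.
  exists (c *: f); first exact: rpredZ.
  rewrite prin_eval0Z fE [LHS]quot_scaleE; congr quot_proj; exact: val_inj.
- exists 1; first exact: dhomog1.
  rewrite prin_eval01; congr quot_proj; exact: val_inj.
- exists 0; first exact: rpred0.
  rewrite (at0_prin_eval0 zE (prin_comp_mem hy)).
  by apply/quot_proj_eq0; rewrite rmorph0 rpred0.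
have [f fh fE] := IH (Subalg (prin_comp_mem hy)) erefl.
have ymem : y \in in_subalg_gen gens by apply/asboolP; apply: subalg_gen_in; right.
have [f' fh' f'E] := cluster_prin_eval0 (z := Subalg ymem) yc erefl.
exists (f' * f); first by rewrite -[d.+1]add1n dhomogM.
rewrite prin_eval0M fE f'E [LHS]quot_mulE; congr quot_proj; exact: val_inj.
Qed.

Lemma prin_comp_sum d (I : eqType) (r : seq I) (G : I -> F) :
  (forall i : I, i \in r -> @prin_comp K n T d (G i)) -> @prin_comp K n T d (\sum_(i <- r) G i).
Proof.
move=> h; rewrite big_seq; apply: big_ind => //; [exact: prin_comp0|exact: prin_compD].
Qed.

Lemma prin_compM d d' y y' : @prin_comp K n T d y -> @prin_comp K n T d' y' ->
  @prin_comp K n T (d + d') (y * y').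
Proof.
move=> h h'; elim: h => {d y} [d|d y z _ IH _ IH'|d c y _ IH||d t y ht _ IH|d y z hy _ IH].
- by rewrite mul0r; exact: prin_comp0.
- by rewrite mulrDl; exact: prin_compD.
- by rewrite -scalerAl; exact: prin_compZ.
- by rewrite mul1r.
- by rewrite -mulrA; exact: prin_comp_coef.
by rewrite -mulrA addSn; exact: prin_comp_var.
Qed.

Lemma prin_comp_eval d f : f \is d.-homog -> @prin_comp K n T d (val (prin_eval f)).
Proof.
move=> fh; rewrite val_prin_eval pl_evalE; apply: prin_comp_sum => m mf.
apply: prin_compZ.
have <- : mdeg m = d by by move/dhomogP: fh => h; exact: h.
have -> : mdeg m = (\sum_(u : pl_index n) m (enum_rank u))%N.
  rewrite mdegE (reindex (@enum_rank (pl_index n))) //.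
  by exists enum_val => u _; rewrite ?enum_rankK ?enum_valK.
pose P (e : nat) (y : F) := @prin_comp K n T e y.
apply: (big_rec2 P) => [|u e y _ h]; rewrite /P; first exact: prin_comp1.
apply: prin_compM h; elim: (m _) => [|e' IH]; first by rewrite expr0; exact: prin_comp1.
rewrite exprS; apply: prin_comp_var IH.
by apply/(cluster_varsP T_tri n_gt2 epE vecE); exists (src u), (tgt u); rewrite pl_neq.
Qed.
End PrincipalAlgebra.

(** * The isomorphisms *)

Section CentralFibers.
Variables (K : fieldType) (n : nat) (T : {set {set 'I_n}}).
Hypothesis T_tri : triangulation T.
Hypothesis n_gt2 : (2 < n)%N.
Variables (R : realDomainType) (w : {ffun arc_of T -> R} -> R).
Hypothesis wD : {morph w : u v / u + v}.
Hypothesis w_quad : quadrilateral_weight w.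
Local Notation S := (pl_ring K n).

Lemma semigroup_alg_iso : exists f : initial_pl_quot K w -> semigroup_alg T K,
  [/\ linear f, GRing.monoid_morphism f & bijective f].
Proof.
have ker f : semi_eval T f = 0 <-> f \in in_ideal_gen (initial_forms (pl_weight w) (@pl_ideal K n)).
  by rewrite (initial_ideal T_tri n_gt2 wD w_quad); exact: (semi_ker T_tri n_gt2).
have surj := semi_surj (K := K) T_tri n_gt2.
have D := rmorphD (@semi_eval K n T); have M := rmorphM (@semi_eval K n T).
pose f : initial_pl_quot K w -> semigroup_alg T K :=
  quot_map (E := initial_forms (pl_weight w) (@pl_ideal K n)) (@semi_eval K n T).
exists f; split.
- move=> c u v.
  apply: etrans (quot_mapD D ker _ _) _.
  by congr (_ + _); exact: (quot_mapZ (sc := *:%R) D (@semi_evalZ K n T) ker).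
- split; first exact: (quot_map1 D (rmorph1 _) ker).
  by move=> u v; exact: (quot_mapM D M ker).
exact: (quot_map_bij D ker surj).
Qed.

Lemma central_fiber_iso : exists
    (f : groebner_central_fiber K w -> principal_central_fiber K T) g, graded_iso f g.
Proof.
have [ep epE] : exists ep : arc_of T -> 'I_n * 'I_n,
    forall v, val v = [set (ep v).1; (ep v).2].
  have /choice[ep h] : forall v : arc_of T, exists u : 'I_n * 'I_n, val v = [set u.1; u.2].
    by move=> v; have [i [j [vE _ _]]] := arc_ends T_tri (valP v); exists (i, j).
  by exists ep.
have xi_neq0 i j : is_arc T i j -> arc_var K T i j * tpow K ep i j != 0.
  by move=> _; rewrite mulf_neq0 ?arc_var_neq0 ?tmon_neq0.
have [vec vecE] := det2_exists T_tri n_gt2 xi_neq0.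
pose th := prin_eval0 T_tri n_gt2 epE vecE.
have D : {morph th : f g / f + g} := @prin_eval0D _ _ _ T_tri n_gt2 _ epE _ vecE.
have M : {morph th : f g / f * g} := @prin_eval0M _ _ _ T_tri n_gt2 _ epE _ vecE.
have ker f : th f = 0 <-> f \in in_ideal_gen (initial_forms (pl_weight w) (@pl_ideal K n)).
  rewrite (initial_ideal T_tri n_gt2 wD w_quad); exact: (prin_eval0_ker T_tri n_gt2 epE vecE).
have surj : forall b, exists f, th f = b := @prin_eval0_surj _ _ _ T_tri n_gt2 _ epE _ vecE.
have Z := @prin_eval0Z _ _ _ T_tri n_gt2 _ epE _ vecE.
pose f : groebner_central_fiber K w -> principal_central_fiber K T :=
  quot_map (E := initial_forms (pl_weight w) (@pl_ideal K n)) th.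
have [g fK gK] : bijective f := quot_map_bij D ker surj.
exists f, g; split=> //.
- exact: (quot_mapD D ker).
- exact: (quot_mapM D M ker).
- exact: (quot_map1 D (prin_eval01 T_tri n_gt2 epE vecE) ker).
- move=> c u; exact: (quot_mapZ (sc := fun c (b : quot_alg (@prin_at0 K n T)) => c *: b) D Z ker c u).
move=> d u; split=> [[p ph <-]|[z zd zE]].
  exists (prin_eval T_tri n_gt2 epE vecE p); first exact: prin_comp_eval ph.
  exact/esym/(quot_mapE D ker).
have [p ph pE] := prin_comp_prin_eval0 T_tri n_gt2 epE vecE zd erefl.
exists p => //; apply: (can_inj fK); rewrite -zE -pE.
exact: (quot_mapE D ker).
Qed.

End CentralFibers.

Theorem corollary4p45 (R : realType) (n : nat) (n_gt2 : (2 < n)%N)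
    (T : {set {set 'I_n}}) (T_triang : triangulation T)
    (w : {linear {ffun arc_of T -> R^o} -> R^o})
    (w_quad : quadrilateral_weight (R := R) w) :
  (exists f : initial_pl_quot R[i]%C (R := R) w -> semigroup_alg T R[i]%C,
     [/\ linear f, GRing.monoid_morphism f & bijective f]) /\
  proj_isomorphic (groebner_central_fiber R[i]%C (R := R) w)
                  (principal_central_fiber R[i]%C T).
Proof.
have wD : {morph (w : {ffun arc_of T -> R} -> R) : u v / u + v} := raddfD w.
split; first exact: (semigroup_alg_iso R[i]%C T_triang n_gt2 wD w_quad).
have [f [g fg]] := central_fiber_iso R[i]%C T_triang n_gt2 wD w_quad.
exact: graded_iso_proj fg.
Qed.
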